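(* Let $K\subset\{1,\dots,N\}$ and let $(\mathcal S,r)$, with $\mathcal S=\mathbb Z_+^{N,K}$, be a pair that is facet-homogeneous, communicating, averaging-regular and Skorokhod-compatible (as defined in the context). Then for every $\beta\in\mathcal F^{K,K}$ the local rate function is given by $$L(\beta)=\inf\Big\{\sum_{v\in V}\bar r_v\,\ell(c_v)\;:\;(\{\rho_I\}_{I\subset K},\{\bar r_v\}_{v\in V},\{c_v\}_{v\in V},\beta)\text{ is an admissible system}\Big\},$$ where an admissible system is a collection of real numbers satisfying $\rho_I\ge 0$, $\sum_{I\subset K}\rho_I=1$, $\bar r_v=\sum_{I\subset K}\rho_I r_{I,v}$, $c_v\ge 0$ and $\sum_{v\in V}\bar r_v c_v v=\beta$.
   Context: Notation. $N\ge1$; $e_1,\dots,e_N$ is the standard basis of $\mathbb R^N$, $\|\cdot\|$ the Euclidean norm. For $K\subset\{1,\dots,N\}$ put $\mathbb Z_+^{N,K}=\{x\in\mathbb Z^N:\langle x,e_i\rangle\ge0,\ i\in K\}$, $\mathbb R_+^{N,K}=\{x\in\mathbb R^N:\langle x,e_i\rangle\ge0,\ i\in K\}$, and for $I\subset K$ define the facet $\mathcal F^{K,I}=\{x\in\mathbb R^N:\langle x,e_j\rangle=0\ (j\in I),\ \langle x,e_i\rangle>0\ (i\in K\setminus I)\}$. Model. $\mathcal S=\mathbb Z_+^{N,K}$, and $r(x,v)\ge0$ ($x\in\mathcal S$, $v\in\mathbb Z^N$) is the jump intensity from $x$ to $x+v$, with $r(x,v)=0$ if $x+v\notin\mathcal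 S$. The pair $(\mathcal S,r)$ is facet-homogeneous if for all $I\subset K$ the value $r(x,v)$ does not depend on $x\in\mathcal F^{K,I}\cap\mathcal S$ (it is then denoted $r_{I,v}$) and $\{v:r_{I,v}>0\}$ is finite. $V\subset\mathbb Z^N$ is a fixed finite set of possible jump directions, containing every $v$ with $r_{I,v}>0$ for some $I\subset K$. The pair is communicating if there is $K_0$ such that for all $x,y\in\mathcal S$ there exist $J\in\mathbb N$ with $J\le K_0\|x-y\|$ and points $x_0=x,x_1,\dots,x_J=y$ in $\mathcal S$ with $r(x_j,x_{j+1}-x_j)>0$ for $j=0,\dots,J-1$. Local rate function. Let $X$ be the jump Markov process on $\mathcal S$ with intensities $r$, $X^n(t)=\frac1nX(nt)$ for $t\in[0,1]$, $\mathcal S^n=\frac1n\mathcal S$. For $y\in\mathcal S^n$, $\beta\in\mathbb R^N$, $\epsilon\in(0,1)$ put $q^n(y;\beta,\epsilon)=-\frac1n\log P\{\sup_{t\in[0,1]}\|X^n(t)-t\beta\|<\epsilon\mid X^n(0)=y\}$ ($-\log0=\infty$). It is known (Dupuis–Ellis) that if $(\mathcal S,r)$ is facet-homogeneous and communicating, then for each $\beta\in\mathcal F^{K,K}$ there is a number $L(\beta)\in[0,\infty)$ with $$\lim_{\epsilon\to0}\lim_{\delta\to0}\liminf_{n\to\infty}\inf_{y\in\mathcal S^n,\|y\|\le\delta}q^n(y;\beta,\epsilon)=\lim_{\epsilon\to0}\lim_{\delta\to0}\limsup_{n\to\infty}\sup_{y\in\mathcal S^n,\|y\|\le\delta}q^n(y;\beta,\epsilon)=L(\beta);$$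 this defines the local rate function $L$. $\ell(a)=a\log a-a+1$ for $a\ge0$ (with $0\log0=0$), $\ell(a)=\infty$ for $a<0$. Averaging-regular. A quadruple $(\{\rho_I\}_{I\subset K},\{\bar r_v\}_{v\in V},\{c_v\}_{v\in V},\beta)$ is an admissible system if $\rho_I\ge0$, $\sum_I\rho_I=1$, $\bar r_v=\sum_I\rho_Ir_{I,v}$, $c_v\ge0$, $\sum_v\bar r_vc_vv=\beta$. The pair $(\mathcal S,r)$ is averaging-regular if: (1) for any given $c_v>0$, $v\in V$, and every $\epsilon>0$ there is $\delta>0$ such that if $(\{\rho_I\},\{\bar r_v\},\{c_v\},\beta)$ and $(\{\rho_I'\},\{\bar r_v'\},\{c_v\},\beta')$ are admissible systems with $\beta,\beta'\in\mathcal F^{K,K}$ and $\|\beta-\beta'\|<\delta$, then $|\bar r_v-\bar r'_v|<\epsilon$ for all $v\in V$; (2) for every admissible system $(\{\rho_I\},\{\bar r_v\},\{c_v\},\beta)$ with $c_v\ge0$ and $\beta\in\mathcal F^{K,K}$ there is $M<\infty$ such that for every $\epsilon>0$ there is an admissible system $(\{\rho'_I\},\{\bar r'_v\},\{c'_v\},\beta')$ with $c'_v>0$ for all $v\in V$, $\beta'\in\mathcal F^{K,K}$, $|\bar r_v-\bar r'_v|<\epsilon$ for all $v\in V$, $\|\beta-\beta'\|<\epsilon$, $|c_v-c'_v|<\epsilon$ for $v$ with $\bar r_v\ne0$, and $c'_v\le M$ for $v$ with $\bar r_v=0$. Skorokhod Problem (SP). Let $G=\bigcap_{i=1}^q\{x\in\mathbb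 R^N:\langle x,n_i\rangle\ge0\}$ with unit vectors $n_i$ (the representation need not be minimal), and let $d_i$ be unit vectors with $\langle d_i,n_i\rangle>0$. For $x\in\partial G$ let $I(x)=\{i:\langle x,n_i\rangle=0\}$ and $d(x)=\{\gamma=\sum_{i\in I(x)}\alpha_id_i:\alpha_i\ge0,\|\gamma\|=1\}$. $D([0,1]:\mathbb R^N)$ denotes càdlàg paths, $D_G([0,1]:\mathbb R^N)$ those with $\psi(0)\in G$, and $|\eta|(t)$ the total variation of $\eta$ on $[0,t]$. $(\phi,\eta)$ solves the SP for $\psi\in D_G([0,1]:\mathbb R^N)$ if $\phi(0)=\psi(0)$ and for all $t\in[0,1]$: $\phi(t)=\psi(t)+\eta(t)$; $\phi(t)\in G$; $|\eta|(t)<\infty$; $|\eta|(t)=\int_{[0,t]}\mathbf 1\{\phi(\theta)\in\partial G\}\,d|\eta|(\theta)$; and there is a Borel $\gamma:[0,1]\to\mathbb R^N$ with $\gamma(t)\in d(\phi(t))$ $d|\eta|$-a.e. and $\eta(t)=\int_{[0,t]}\gamma(\theta)\,d|\eta|(\theta)$. The Skorokhod Map (SM) is $\Gamma(\psi)=\phi$, on the set of $\psi$ for which the SP has a unique solution. The SM is regular if it is defined on a subset $\mathcal G$ of $D_G([0,1]:\mathbb R^N)$ containing all paths of bounded variation and there is $K_1<\infty$ with $\sup_t\|\Gamma(\psi_1)(t)-\Gamma(\psi_2)(t)\|\le K_1\sup_t\|\psi_1(t)-\psi_2(t)\|$ for $\psi_1,\psi_2\in\mathcal G$. Skorokhod-compatible.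 $(\mathcal S,r)$ is Skorokhod-compatible if for every set of numbers $c_v>0$, $v\in V$, which is part of some admissible system with some $\beta\in\mathcal F^{K,K}$, there exist an integer $q\ge 0$ and unit vectors $n_1,\dots,n_q,d_1,\dots,d_q$ (possibly depending on $\{c_v\}$) such that: $\mathbb R_+^{N,K}=\bigcap_{i=1}^q\{x:\langle x,n_i\rangle\ge0\}$ (the empty intersection being $\mathbb R^N$); $\langle d_i,n_i\rangle>0$ for all $i$; the SM associated with $\{(n_i,d_i)\}_{i=1}^q$ is regular; and for every $\emptyset\ne I\subset K$, if $w_I=\sum_vc_v(r_{I,v}-r_{\emptyset,v})v\neq0$ then $w_I/\|w_I\|\in d(x)$ for $x\in\mathcal F^{K,I}$. *)

(* Defs.v *)
From HB Require Import structures.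
From mathcomp Require Export all_boot all_order all_algebra.
From mathcomp Require Export finmap.
From mathcomp Require Export all_classical all_reals all_analysis.
From mathcomp Require Export measurable_realfun.

Set Implicit Arguments.
Unset Strict Implicit.
Unset Printing Implicit Defensive.

Import Order.TTheory GRing.Theory Num.Theory.
Export numFieldNormedType.Exports.

Local Open Scope classical_set_scope.
Local Open Scope ring_scope.

(* The library norm on 'rV[R]_N is the sup norm, hence these two definitions;
   the topology of 'rV[R]_N is the usual one. *)
Definition dot (R : realType) (N : nat) (x y : 'rV[R]_N) : R :=
  \sum_(i < N) x ord0 i * y ord0 i.

Definition enorm (R : realType) (N : nat) (x : 'rV[R]_N) : R :=
  Num.sqrt (dot x x).

Definition toR (R : realType) (N : nat) (z : 'rV[int]_N) : 'rV[R]_N :=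
  map_mx (fun k : int => k%:~R) z.

Definition lattice (N : nat) (K : {set 'I_N}) : set 'rV[int]_N :=
  [set x | forall i, i \in K -> 0 <= x ord0 i].

Definition orthant (R : realType) (N : nat) (K : {set 'I_N}) :
    set 'rV[R]_N :=
  [set x | forall i, i \in K -> 0 <= x ord0 i].

Definition facet (R : realType) (N : nat) (K I : {set 'I_N}) :
    set 'rV[R]_N :=
  [set x | (forall j, j \in I -> x ord0 j = 0) /\
           (forall i, i \in K :\: I -> 0 < x ord0 i)].

(* r x v is the intensity of the jump from x to x + v. *)
Definition jump_rates (R : realType) (N : nat) (K : {set 'I_N})
    (r : 'rV[int]_N -> 'rV[int]_N -> R) : Prop :=
  forall x v, lattice K x ->
    0 <= r x v /\ (~ lattice K (x + v) -> r x v = 0).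

(* r_{I,v} is read off at one lattice point of the facet F^{K,I}; under
   facet homogeneity below, the choice of the point is immaterial. *)
Definition facet_point (N : nat) (K I : {set 'I_N}) : 'rV[int]_N :=
  \row_(i < N) (if i \in K :\: I then 1 else 0).

Definition facet_rate (R : realType) (N : nat) (K : {set 'I_N})
    (r : 'rV[int]_N -> 'rV[int]_N -> R) (I : {set 'I_N}) (v : 'rV[int]_N) : R :=
  r (facet_point K I) v.

Definition facet_homogeneous (R : realType) (N : nat) (K : {set 'I_N})
    (r : 'rV[int]_N -> 'rV[int]_N -> R) : Prop :=
  forall I : {set 'I_N}, I \subset K ->
    (forall x y v, lattice K x -> lattice K y ->
       facet K I (toR R x) -> facet K I (toR R y) -> r x v = r y v) /\
    finite_set [set v | 0 < facet_rate K r I v].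

Definition communicating (R : realType) (N : nat) (K : {set 'I_N})
    (r : 'rV[int]_N -> 'rV[int]_N -> R) : Prop :=
  exists K0 : R, forall x y, lattice K x -> lattice K y ->
    exists (J : nat) (p : nat -> 'rV[int]_N),
      [/\ J%:R <= K0 * enorm (toR R (x - y)),
          p 0%N = x /\ p J = y,
          (forall j, (j <= J)%N -> lattice K (p j)) &
          (forall j, (j < J)%N -> 0 < r (p j) (p j.+1 - p j))].

(* V is a finite set containing all possible jumps. *)
Definition total_rate (R : realType) (N : nat) (V : {fset 'rV[int]_N})
    (r : 'rV[int]_N -> 'rV[int]_N -> R) (x : 'rV[int]_N) : R :=
  \sum_(v <- V) r x v.

Definition jump_prob (R : realType) (N : nat) (V : {fset 'rV[int]_N})
    (r : 'rV[int]_N -> 'rV[int]_N -> R) (x y : 'rV[int]_N) : R :=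
  if total_rate V r x == 0 then (x == y)%:R
  else r x (y - x) / total_rate V r x.

(* Under P x the process X starts at x.  It is described by its jump chain Y
   and its holding times T: the chain moves according to jump_prob and, given
   the chain, the holding times are independent, the k-th one being exponential
   with parameter total_rate (Y k).  An absorbing state has holding time +oo.
   A jump v = 0, if r x 0 > 0, is a fictitious jump, without effect on X. *)
Definition jump_markov_process (R : realType) (N : nat) (K : {set 'I_N})
    (V : {fset 'rV[int]_N}) (r : 'rV[int]_N -> 'rV[int]_N -> R)
    (d : measure_display) (Omega : measurableType d)
    (P : 'rV[int]_N -> probability Omega R)
    (X : R -> Omega -> 'rV[int]_N) : Prop :=
  exists (Y : nat -> Omega -> 'rV[int]_N) (T : nat -> Omega -> \bar R),
  [/\ (forall k z, measurable [set w | Y k w = z]),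
      (forall k, measurable_fun setT (T k) /\ forall w, (0 <= T k w)%E),
      (forall w, (\sum_(i < k) T i w)%E @[k --> \oo] --> +oo%E),
      (forall w (t : R) k, 0 <= t ->
         (\sum_(i < k) T i w <= t%:E)%E -> (t%:E < \sum_(i < k.+1) T i w)%E ->
         X t w = Y k w) &
      (forall x, lattice K x ->
         forall (m : nat) (z : nat -> 'rV[int]_N) (s : nat -> R),
         (forall i, (i <= m)%N -> 0 <= s i) ->
         P x [set w | forall i, (i <= m)%N -> Y i w = z i /\ ((s i)%:E < T i w)%E]
         = ((z 0%N == x)%:R * (\prod_(i < m) jump_prob V r (z i) (z i.+1))
            * \prod_(i < m.+1) expR (- (total_rate V r (z i) * s i)))%:E)].

(* X^n(t) = X(nt)/n; the supremum is taken in \bar R. *)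
Definition tube (R : realType) (N : nat) (Omega : Type)
    (X : R -> Omega -> 'rV[int]_N) (n : nat) (beta : 'rV[R]_N) (e : R) :
    set Omega :=
  [set w | (ereal_sup [set (enorm (n%:R^-1 *: toR R (X (n%:R * t) w)
                                    - t *: beta))%:E
                      | t in (`[0%R, 1%R]%classic : set R)] < e%:E)%E].

(* q^n at the point y = z / n of the scaled lattice. *)
Definition qn (R : realType) (N : nat)
    (d : measure_display) (Omega : measurableType d)
    (P : 'rV[int]_N -> probability Omega R) (X : R -> Omega -> 'rV[int]_N)
    (n : nat) (z : 'rV[int]_N) (beta : 'rV[R]_N) (e : R) : \bar R :=
  (- ((n%:R^-1)%:E * lne (P z (tube X n beta e))))%E.

Definition qn_values (R : realType) (N : nat) (K : {set 'I_N})
    (d : measure_display) (Omega : measurableType d)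
    (P : 'rV[int]_N -> probability Omega R) (X : R -> Omega -> 'rV[int]_N)
    (beta : 'rV[R]_N) (e delta : R) (n : nat) : set (\bar R) :=
  [set qn P X n z beta e | z in
     [set z | lattice K z /\ enorm (n%:R^-1 *: toR R z) <= delta]].

(* The inner limit is required to exist for every e in (0,1). *)
Definition iterated_limit (R : realType) (F : R -> R -> \bar R) (l : \bar R) :
    Prop :=
  exists2 G : R -> \bar R,
    (forall e, 0 < e < 1 -> F e delta @[delta --> 0^'+] --> G e) &
    G e @[e --> 0^'+] --> l.

Definition local_rate_function (R : realType) (N : nat) (K : {set 'I_N})
    (d : measure_display) (Omega : measurableType d)
    (P : 'rV[int]_N -> probability Omega R) (X : R -> Omega -> 'rV[int]_N)
    (L : 'rV[R]_N -> R) : Prop :=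
  forall beta, facet K K beta ->
  [/\ 0 <= L beta,
      iterated_limit (fun e delta => limn_einf (fun n =>
        ereal_inf (qn_values K P X beta e delta n))) (L beta)%:E &
      iterated_limit (fun e delta => limn_esup (fun n =>
        ereal_sup (qn_values K P X beta e delta n))) (L beta)%:E].

(* With the library convention ln 0 = 0, the value at a = 0 is 1. *)
Definition ell (R : realType) (a : R) : \bar R :=
  if a < 0 then +oo%E else (a * ln a - a + 1)%:E.

Definition admissible (R : realType) (N : nat) (K : {set 'I_N})
    (V : {fset 'rV[int]_N}) (r : 'rV[int]_N -> 'rV[int]_N -> R)
    (rho : {set 'I_N} -> R) (rbar c : 'rV[int]_N -> R) (beta : 'rV[R]_N) :
    Prop :=
  [/\ (forall I : {set 'I_N}, I \subset K -> 0 <= rho I),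
      \sum_(I : {set 'I_N} | I \subset K) rho I = 1,
      (forall v, v \in V -> rbar v =
         \sum_(I : {set 'I_N} | I \subset K) rho I * facet_rate K r I v),
      (forall v, v \in V -> 0 <= c v) &
      \sum_(v <- V) (rbar v * c v) *: toR R v = beta].

Definition averaging_regular (R : realType) (N : nat) (K : {set 'I_N})
    (V : {fset 'rV[int]_N}) (r : 'rV[int]_N -> 'rV[int]_N -> R) : Prop :=
  (forall c : 'rV[int]_N -> R, (forall v, v \in V -> 0 < c v) ->
   forall eps : R, 0 < eps -> exists2 delta : R, 0 < delta &
   forall rho rbar beta rho' rbar' beta',
     admissible K V r rho rbar c beta -> admissible K V r rho' rbar' c beta' ->
     facet K K beta -> facet K K beta' -> enorm (beta - beta') < delta ->
     forall v, v \in V -> `|rbar v - rbar' v| < eps) /\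
  (forall rho rbar c beta,
   admissible K V r rho rbar c beta -> facet K K beta ->
   exists M : R, forall eps : R, 0 < eps ->
   exists rho' rbar' c' beta',
   [/\ admissible K V r rho' rbar' c' beta',
       facet K K beta',
       enorm (beta - beta') < eps &
       forall v, v \in V ->
         [/\ 0 < c' v, `|rbar v - rbar' v| < eps,
             (rbar v != 0 -> `|c v - c' v| < eps) &
             (rbar v = 0 -> c' v <= M)]]).

Definition cadlag01 (R : realType) (N : nat) (psi : R -> 'rV[R]_N) : Prop :=
  (forall t, 0 <= t < 1 -> psi s @[s --> t^'+] --> psi t) /\
  (forall t, 0 < t <= 1 -> cvg (psi s @[s --> t^'-])).

(* The library total variation, with the Euclidean norm in place of the
   absolute value. *)
Definition evariation (R : realType) (N : nat) (a b : R)
    (f : R -> 'rV[R]_N) (s : seq R) : R :=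
  let F := f \o nth b (a :: s) in
  \sum_(0 <= n < size s) enorm (F n.+1 - F n).

Definition etotal_variation (R : realType) (N : nat) (a b : R)
    (f : R -> 'rV[R]_N) : \bar R :=
  ereal_sup [set (evariation a b f s)%:E | s in itv_partition a b].

Definition polyhedron (R : realType) (N q : nat) (n : 'I_q -> 'rV[R]_N) :
    set 'rV[R]_N :=
  [set x | forall i, 0 <= dot x (n i)].

Definition bd (R : realType) (N : nat) (G : set 'rV[R]_N) : set 'rV[R]_N :=
  closure G `\` interior G.

(* The set d(x) of reflection directions.  For x in the interior of G the
   sum is empty, so that d(x) is empty as well. *)
Definition directions (R : realType) (N q : nat) (n d : 'I_q -> 'rV[R]_N)
    (x : 'rV[R]_N) : set 'rV[R]_N :=
  [set g | enorm g = 1 /\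
     exists2 a : 'I_q -> R, (forall i, 0 <= a i) &
       g = \sum_(i < q | dot x (n i) == 0) a i *: d i].

(* D_G([0,1] : R^N); paths are functions on R whose values outside [0,1] are
   irrelevant. *)
Definition paths_in (R : realType) (N : nat) (G : set 'rV[R]_N) :
    set (R -> 'rV[R]_N) :=
  [set psi | cadlag01 psi /\ G (psi 0)].

(* mu is the Stieltjes measure d|eta| on [0,1]: a finite measure there is
   determined by the masses of the intervals [0,t]. *)
Definition SP_solution (R : realType) (N q : nat) (n d : 'I_q -> 'rV[R]_N)
    (psi phi eta : R -> 'rV[R]_N) : Prop :=
  let G := polyhedron n in
  phi 0 = psi 0 /\
  (forall t, 0 <= t <= 1 ->
     [/\ phi t = psi t + eta t, G (phi t) &
         (etotal_variation 0 t eta < +oo)%E]) /\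
  exists2 mu : {finite_measure set (measurableTypeR R) -> \bar R},
    (forall t : R, 0 <= t <= 1 ->
       mu `[0, t]%classic = etotal_variation 0 t eta /\
       etotal_variation 0 t eta =
         (\int[mu]_(u in `[0%R, t]) (\1_(phi @^-1` bd G) u)%:E)%E) &
    exists gamma : R -> 'rV[R]_N,
      [/\ (forall j, measurable_fun (`[0%R, 1%R]%classic : set (measurableTypeR R))
                       (fun u => gamma u ord0 j)),
          {ae mu, forall u, 0 <= u <= 1 -> directions n d (phi u) (gamma u)} &
          (forall (t : R) j, 0 <= t <= 1 ->
             (eta t ord0 j)%:E =
               (\int[mu]_(u in `[0%R, t]) (gamma u ord0 j)%:E)%E)].

(* phi = Gamma(psi): psi lies in the domain of the Skorokhod map, i.e. the
   problem for psi has a unique solution on [0,1], whose first component is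
   phi. *)
Definition skorokhod_map (R : realType) (N q : nat) (n d : 'I_q -> 'rV[R]_N)
    (psi phi : R -> 'rV[R]_N) : Prop :=
  exists2 eta, SP_solution n d psi phi eta &
    forall phi' eta', SP_solution n d psi phi' eta' ->
      forall t, 0 <= t <= 1 -> phi' t = phi t /\ eta' t = eta t.

Definition esup_dist (R : realType) (N : nat) (f g : R -> 'rV[R]_N) : \bar R :=
  ereal_sup [set (enorm (f t - g t))%:E | t in (`[0%R, 1%R]%classic : set R)].

Definition SM_regular (R : realType) (N q : nat) (n d : 'I_q -> 'rV[R]_N) :
    Prop :=
  exists D : set (R -> 'rV[R]_N),
  [/\ D `<=` paths_in (polyhedron n),
      (forall psi, paths_in (polyhedron n) psi ->
         (etotal_variation 0 1 psi < +oo)%E -> D psi),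
      (forall psi, D psi -> exists phi, skorokhod_map n d psi phi) &
      exists K1 : R, forall psi1 psi2 phi1 phi2,
        D psi1 -> D psi2 ->
        skorokhod_map n d psi1 phi1 -> skorokhod_map n d psi2 phi2 ->
        (esup_dist phi1 phi2 <= K1%:E * esup_dist psi1 psi2)%E].

Definition skorokhod_compatible (R : realType) (N : nat) (K : {set 'I_N})
    (V : {fset 'rV[int]_N}) (r : 'rV[int]_N -> 'rV[int]_N -> R) : Prop :=
  forall c : 'rV[int]_N -> R, (forall v, v \in V -> 0 < c v) ->
  (exists rho rbar beta,
     admissible K V r rho rbar c beta /\ facet K K beta) ->
  exists (q : nat) (n d : 'I_q -> 'rV[R]_N),
  [/\ (forall i, enorm (n i) = 1 /\ enorm (d i) = 1),
      @orthant R N K = polyhedron n,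
      (forall i, 0 < dot (d i) (n i)),
      SM_regular n d &
      forall I : {set 'I_N}, I != finset.set0 -> I \subset K ->
        let w : 'rV[R]_N :=
          \sum_(v <- V) (c v * (facet_rate K r I v
                                - facet_rate K r finset.set0 v)) *: toR R v in
        w != 0 -> forall x, facet K I x ->
          directions n d x ((enorm w)^-1 *: w)].

(* Main.v *)
From HB Require Import structures.
Require Import Defs.
From mathcomp Require Import ring lra zify.

Set Implicit Arguments.
Unset Strict Implicit.
Unset Printing Implicit Defensive.

Import Order.TTheory GRing.Theory Num.Theory.

Local Open Scope classical_set_scope.
Local Open Scope ring_scope.

(** The two inequalities have separate proofs.  For both it suffices to start
    the process at 0, since the local rate function is at once a limit of
    infima and of suprema over the starting points (rate_ge, rate_le).

    Probabilities are reduced to finite sums.  Time is cut into slices of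
    length h = 1 / H, and a word records, slice by slice, whether the process
    stays or jumps, and how.  The holding times being exponential, the
    probability of a word is a product over its letters (ev_prob); the words of
    a given length exhaust the probability space up to a null set
    (covered_ae); and a word fixes the path up to a shift of time by at most h
    times the number of jumps (path_slice).  A product functional of the
    letters is summed over all words by bounding one step (wprod_le).

    Lower bound for L.  Write ham I a for the sum over v of
    r_{I,v} (exp (a, v) - 1).  The exponential Chebyshev inequality at time 1
    bounds the probability of a thin tube around t beta by
    exp (- n ((a, beta) - max_I ham I a)) up to lower order, for every vector a
    (tube_upper, rate_ge_dual).  Now minimise over a the sum over I of
    exp (k (ham I a - (a, beta))).  Communication makes the jumps possible in
    the interior span the space positively (interior_span), so that a minimiser
    exists; there the normalised summands rho_I, together with
    c_v = exp (a, v), form an admissible system, and its cost exceeds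
    (a, beta) - max_I ham I a by at most a constant over k (dual_system).

    Upper bound for L.  By the second half of averaging regularity it is
    enough to treat a system with all c_v positive.  Multiply the jump rates by
    c_v.  Under the tilted law, every count of the jumps v on the facet I stays
    close to its compensator, up to an exponentially small probability
    (bad_words_mass).  For a word with this property everything else is
    deterministic.  Its path solves a discrete Skorokhod problem, in which the
    excess drift on the boundary facets is the reflection; the unreflected part
    is nearly that of the straight line t beta, which solves the same problem.
    Regularity of the Skorokhod map, used for step functions with purely atomic
    reflection measures (discrete_lipschitz), keeps the path near the line
    (path_close).  Hence the empirical occupation of the facets has a drift
    near beta, so that by the first half of averaging regularity and compactness
    its cost is near that of the given system (near_cost), and n times this
    cost bounds the logarithm of the density of the tilted law
    (good_word_likelihood).  As these words have tilted mass at least 1/2, the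
    probability of the tube is at least exp (- n cost) up to lower order
    (tube_lower, qn_le_cost). *)

(** * The Euclidean norm *)

Section euclid.
Variables (R : realType) (N : nat).
Implicit Types (x y z : 'rV[R]_N) (a : R).

Lemma dotC x y : dot x y = dot y x.
Proof. by apply: eq_bigr => i _; rewrite mulrC. Qed.

Lemma dotDl x y z : dot (x + y) z = dot x z + dot y z.
Proof. by rewrite -big_split; apply: eq_bigr => i _; rewrite mxE mulrDl. Qed.

Lemma dotZl a x y : dot (a *: x) y = a * dot x y.
Proof. by rewrite mulr_sumr; apply: eq_bigr => i _; rewrite mxE mulrA. Qed.

Lemma dotDr x y z : dot x (y + z) = dot x y + dot x z.
Proof. by rewrite dotC dotDl !(dotC x). Qed.

Lemma dotZr a x y : dot x (a *: y) = a * dot x y.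
Proof. by rewrite dotC dotZl (dotC x). Qed.

Lemma dot0l x : dot 0 x = 0.
Proof. by rewrite -(scale0r x) dotZl mul0r. Qed.

Lemma dot0r x : dot x 0 = 0.
Proof. by rewrite dotC dot0l. Qed.

Lemma dotNl x y : dot (- x) y = - dot x y.
Proof. by rewrite -scaleN1r dotZl mulN1r. Qed.

Lemma dotBr x y z : dot x (y - z) = dot x y - dot x z.
Proof. by rewrite dotDr -scaleN1r dotZr mulN1r. Qed.

Lemma dot_sumr (I : Type) (s : seq I) (p : pred I) (F : I -> 'rV[R]_N) x :
  dot x (\sum_(i <- s | p i) F i) = \sum_(i <- s | p i) dot x (F i).
Proof. by elim/big_rec2: _ => [|i u v _ <-]; rewrite ?dot0r ?dotDr. Qed.

Lemma dot_ge0 x : 0 <= dot x x.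
Proof. by apply: sumr_ge0 => i _; rewrite -expr2 sqr_ge0. Qed.

Lemma enorm_ge0 x : 0 <= enorm x.
Proof. exact: sqrtr_ge0. Qed.

Lemma sqr_enorm x : enorm x ^+ 2 = dot x x.
Proof. by rewrite sqr_sqrtr // dot_ge0. Qed.

Lemma enorm0 : enorm (0 : 'rV[R]_N) = 0.
Proof. by rewrite /enorm dot0l sqrtr0. Qed.

Lemma enormZ a x : enorm (a *: x) = `|a| * enorm x.
Proof.
by rewrite /enorm dotZl dotZr mulrA -expr2 sqrtrM ?sqr_ge0 // sqrtr_sqr.
Qed.

Lemma enormN x : enorm (- x) = enorm x.
Proof. by rewrite -scaleN1r enormZ normrN1 mul1r. Qed.

Lemma enormBC x y : enorm (x - y) = enorm (y - x).
Proof. by rewrite -enormN opprB. Qed.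

Lemma enorm_eq0 x : (enorm x == 0) = (x == 0).
Proof.
apply/eqP/eqP => [x0|->]; last exact: enorm0.
have d0 : dot x x = 0 by rewrite -sqr_enorm x0 expr0n.
apply/rowP => i; rewrite mxE; apply/eqP; rewrite -sqrf_eq0 eq_le sqr_ge0 andbT.
rewrite -d0 /dot (bigD1 i) //= expr2 lerDl.
by apply: sumr_ge0 => j _; rewrite -expr2 sqr_ge0.
Qed.

(** The discriminant of the nonnegative quadratic t |-> |x + t y|^2. *)
Lemma cauchy_schwarz x y : `|dot x y| <= enorm x * enorm y.
Proof.
rewrite -[leRHS]ger0_norm ?mulr_ge0 ?enorm_ge0 // -ler_sqr ?nnegrE ?normr_ge0 //.
rewrite !real_normK ?num_real // exprMn !sqr_enorm.
have [y0|yN0] := eqVneq (dot y y) 0.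
  have /eqP y00 : enorm y == 0 by rewrite -sqrf_eq0 sqr_enorm y0.
  move/eqP: y00; rewrite enorm_eq0 => /eqP ->; rewrite !dot0r mulr0 expr0n //.
have yp : 0 < dot y y by rewrite lt_def yN0 dot_ge0.
have := dot_ge0 (dot y y *: x - dot x y *: y).
rewrite dotBr !(dotC (_ - _)) !dotBr !(dotZl, dotZr) (dotC y x).
set p := dot x x; set q := dot y y; set s := dot x y.
rewrite (_ : _ - _ = q * (p * q - s ^+ 2)); last by ring.
by rewrite pmulr_rge0 // subr_ge0.
Qed.

Lemma enormD x y : enorm (x + y) <= enorm x + enorm y.
Proof.
rewrite -[leRHS]ger0_norm ?addr_ge0 ?enorm_ge0 // -[leLHS]ger0_norm ?enorm_ge0 //.
rewrite -ler_sqr ?nnegrE ?normr_ge0 // !real_normK ?num_real //.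
rewrite sqr_enorm sqrrD !sqr_enorm dotDl !dotDr (dotC y x).
have := cauchy_schwarz x y; have := ler_norm (dot x y); lra.
Qed.

Lemma enormB x y : enorm (x - y) <= enorm x + enorm y.
Proof. by rewrite -(enormN y) enormD. Qed.

Lemma enorm_sum (I : Type) (s : seq I) (p : pred I) (F : I -> 'rV[R]_N) :
  enorm (\sum_(i <- s | p i) F i) <= \sum_(i <- s | p i) enorm (F i).
Proof.
elim/big_rec2: _ => [|i u v _ h]; first by rewrite enorm0.
by rewrite (le_trans (enormD _ _)) // lerD2l.
Qed.

End euclid.

Section toR.
Variables (R : realType) (N : nat).

Lemma toRD (x y : 'rV[int]_N) : toR R (x + y) = toR R x + toR R y.
Proof. by apply/rowP => i; rewrite !mxE intrD. Qed.

Lemma toRN (x : 'rV[int]_N) : toR R (- x) = - toR R x.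
Proof. by apply/rowP => i; rewrite !mxE mulrNz. Qed.

Lemma toR0 : toR R (0 : 'rV[int]_N) = 0.
Proof. by apply/rowP => i; rewrite !mxE. Qed.

End toR.

(** * Rates on facets *)

Section rates.
Variables (R : realType) (N : nat) (K : {set 'I_N}) (V : {fset 'rV[int]_N}).
Variable r : 'rV[int]_N -> 'rV[int]_N -> R.

(** The facet F^{K,I} through a lattice point x has the index I = zset x. *)
Definition zset (x : 'rV[int]_N) : {set 'I_N} := [set i in K | x ord0 i == 0].

(** Extending the rates from the lattice to all of Z^N by this formula makes
    every one-step identity below hold without mention of the boundary. *)
Definition rt (x v : 'rV[int]_N) : R := facet_rate K r (zset x) v.

Lemma rt_facet x v I : zset x = I -> rt x v = facet_rate K r I v.
Proof. by move=> <-. Qed.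

Definition lamI (I : {set 'I_N}) : R := \sum_(v <- V) facet_rate K r I v.

Lemma zset_sub x : zset x \subset K.
Proof. by apply/fintype.subsetP => i; rewrite inE => /andP[]. Qed.

Lemma facet_point_lattice I : lattice K (facet_point K I).
Proof. by move=> i iK; rewrite mxE; case: ifP. Qed.

Lemma facet_zset (x : 'rV[int]_N) : lattice K x -> facet K (zset x) (toR R x).
Proof.
move=> xK; split=> i; rewrite !inE.
  by move=> /andP[_ /eqP x0]; rewrite mxE x0.
move=> /andP[+ iK]; rewrite iK /= => x0.
by rewrite mxE ltr0z lt_def x0 /=; exact: xK.
Qed.

Lemma facet_facet_point (I : {set 'I_N}) :
  I \subset K -> facet K I (toR R (facet_point K I)).
Proof.
move=> IK; split=> i; rewrite !mxE !inE; first by move=> ->.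
by move=> /andP[/negbTE -> ->].
Qed.

Hypothesis hr : jump_rates K r.
Hypothesis hhom : facet_homogeneous K r.

Lemma facet_rate_ge0 I v : 0 <= facet_rate K r I v.
Proof. by have [] := hr v (facet_point_lattice I). Qed.

Lemma rt_ge0 x v : 0 <= rt x v. Proof. exact: facet_rate_ge0. Qed.

Lemma rtE x v : lattice K x -> r x v = rt x v.
Proof.
move=> xK; have [h _] := hhom (zset_sub x).
exact: (h _ _ v xK (facet_point_lattice _) (facet_zset xK)
  (facet_facet_point (zset_sub x))).
Qed.

Lemma rt_exit x v : lattice K x -> ~ lattice K (x + v) -> rt x v = 0.
Proof. by move=> xK xvK; rewrite -rtE //; have [_ ->] := hr v xK. Qed.

Lemma total_rateE x : lattice K x -> total_rate V r x = lamI (zset x).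
Proof. by move=> xK; apply: eq_bigr => v _; rewrite rtE. Qed.

End rates.

(** * Words *)

Section words.
Variables (R : realType) (N : nat) (V : {fset 'rV[int]_N}).

(** Time is cut into slices of equal length.  A letter records what happens in
    one slice: None if the process does not jump there, Some v if the current
    holding time ends there with a jump v.  A word lists the letters of the
    first slices, the latest one first. *)
Definition word := seq (option 'rV[int]_N).

Fixpoint pos (w : word) : 'rV[int]_N :=
  match w with
  | Some v :: u => pos u + v
  | None :: u => pos u
  | [::] => 0
  end.

Fixpoint njumps (w : word) : nat :=
  match w with
  | Some _ :: u => (njumps u).+1
  | None :: u => njumps u
  | [::] => 0%N
  end.

Fixpoint age (w : word) : nat :=
  match w with
  | None :: u => (age u).+1
  | _ => 0%N
  end.

Definition letters : seq (option 'rV[int]_N) := None :: [seq Some v | v <- V].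

Fixpoint words (l : nat) : seq word :=
  if l is k.+1 then [seq a :: u | u <- words k, a <- letters] else [:: [::]].

Fixpoint wprod (f : word -> option 'rV[int]_N -> R) (w : word) : R :=
  if w is a :: u then wprod f u * f u a else 1.

Lemma big_letters (F : option 'rV[int]_N -> R) :
  \sum_(a <- letters) F a = F None + \sum_(v <- V) F (Some v).
Proof. by rewrite /letters big_cons big_map. Qed.

Lemma big_wordsS (F : word -> R) l :
  \sum_(w <- words l.+1) F w =
  \sum_(u <- words l) \sum_(a <- letters) F (a :: u).
Proof. exact: big_allpairs_dep. Qed.

Lemma mem_wordsS l w :
  w \in words l.+1 -> exists u a, [/\ u \in words l, a \in letters & w = a :: u].
Proof. by case/allpairsP => -[u a] [ul al ->]; exists u, a. Qed.

Lemma words_size l w : w \in words l -> size w = l.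
Proof.
elim: l w => [|l ih] w; first by rewrite inE => /eqP ->.
by move=> /mem_wordsS[u [a [/ih <- _ ->]]].
Qed.

Lemma words_uniq l : uniq (words l).
Proof.
elim: l => [//|l ih]; rewrite [words _]/(allpairs _ _ _) allpairs_uniq //.
  rewrite /letters /= map_inj_uniq ?fset_uniq ?andbT; last by move=> x y [].
  by apply/mapP => -[].
by move=> [u a] [u' a'] _ _ /= [-> ->].
Qed.

Lemma words_behead l a w : a :: w \in words l.+1 -> w \in words l.
Proof. by move=> /mem_wordsS[u [b [ul _ [_ ->]]]]. Qed.

Lemma words_drop l w k : w \in words l -> drop k w \in words (l - k).
Proof.
elim: l k w => [|l ih] [|k] w; rewrite ?drop0 //.
  by rewrite inE => /eqP ->.
by case: w => [/words_size //|a w] /words_behead wl; rewrite subSS /= ih.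
Qed.

Lemma wprod_ge0 f w : (forall u a, 0 <= f u a) -> 0 <= wprod f w.
Proof. by move=> f0; elim: w => //= a u ih; rewrite mulr_ge0. Qed.

Lemma wprodM f g w : wprod (fun u a => f u a * g u a) w = wprod f w * wprod g w.
Proof. by elim: w => /= [|a u ->]; rewrite ?mulr1 // mulrACA. Qed.

(** A word extended by one letter multiplies the sum by at most the bound for
    one step; this replaces every supermartingale argument. *)
Lemma wprod_le f (th : R) l : (forall u a, 0 <= f u a) -> 0 <= th ->
  (forall u, \sum_(a <- letters) f u a <= th) ->
  \sum_(w <- words l) wprod f w <= th ^+ l.
Proof.
move=> f0 th0 fth; elim: l => [|l ih]; first by rewrite big_seq1.
rewrite big_wordsS exprSr (le_trans _ (ler_wpM2r th0 ih)) // mulr_suml.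
apply: ler_sum => u _; rewrite /= -mulr_sumr ler_wpM2l //.
exact: wprod_ge0.
Qed.

Lemma wprod_eq1 f l : (forall u, \sum_(a <- letters) f u a = 1) ->
  \sum_(w <- words l) wprod f w = 1.
Proof.
move=> f1; elim: l => [|l ih]; first by rewrite big_seq1.
by rewrite big_wordsS -ih; apply: eq_bigr => u _; rewrite /= -mulr_sumr f1 mulr1.
Qed.

(** Summing over the continuations of a word does not change its mass. *)
Lemma wprod_marginal f (F : word -> R) l k :
  (forall u, \sum_(a <- letters) f u a = 1) ->
  \sum_(w <- words (l + k)) wprod f w * F (drop k w) =
  \sum_(w <- words l) wprod f w * F w.
Proof.
move=> f1; elim: k => [|k ih].
  by rewrite addn0; apply: eq_bigr => w _; rewrite drop0.
rewrite addnS big_wordsS -ih; apply: eq_bigr => u _ /=.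
rewrite -[in RHS](mulr1 (wprod f u)) -(f1 u) mulr_sumr mulr_suml.
by [].
Qed.

End words.

(** * The law of the words *)

(** The joint law of the jump chain and the holding times for the starting
    point 0, and the way in which they determine the path. *)
Definition chain_law (R : realType) (N : nat) (V : {fset 'rV[int]_N})
    (r : 'rV[int]_N -> 'rV[int]_N -> R)
    (d : measure_display) (Omega : measurableType d) (P0 : probability Omega R)
    (Y : nat -> Omega -> 'rV[int]_N) (T : nat -> Omega -> \bar R) : Prop :=
  forall (m : nat) (z : nat -> 'rV[int]_N) (s : nat -> R),
  (forall i, (i <= m)%N -> 0 <= s i) ->
  P0 [set w | forall i, (i <= m)%N -> Y i w = z i /\ ((s i)%:E < T i w)%E]
  = ((z 0%N == 0)%:R * (\prod_(i < m) jump_prob V r (z i) (z i.+1))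
     * \prod_(i < m.+1) expR (- (total_rate V r (z i) * s i)))%:E.

Definition sample_path (R : realType) (N : nat) (Omega : Type)
    (X : R -> Omega -> 'rV[int]_N) (Y : nat -> Omega -> 'rV[int]_N)
    (T : nat -> Omega -> \bar R) : Prop :=
  forall w (t : R) k, 0 <= t ->
  (\sum_(i < k) T i w <= t%:E)%E -> (t%:E < \sum_(i < k.+1) T i w)%E ->
  X t w = Y k w.

Section cells.
Variables (R : realType) (N : nat) (V : {fset 'rV[int]_N}).
Variable r : 'rV[int]_N -> 'rV[int]_N -> R.
Variables (d : measure_display) (Omega : measurableType d).
Variables (P0 : probability Omega R).
Variables (Y : nat -> Omega -> 'rV[int]_N) (T : nat -> Omega -> \bar R).
Hypothesis mY : forall k z, measurable [set w | Y k w = z].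
Hypothesis mT : forall k, measurable_fun setT (T k).
Hypothesis hlaw : chain_law V r P0 Y T.

Lemma measurable_gtT k (s : R) : measurable [set w | (s%:E < T k w)%E].
Proof.
rewrite -[X in measurable X]setTI; exact: emeasurable_fun_o_infty.
Qed.

Lemma measurable_leT k (s : R) : measurable [set w | (T k w <= s%:E)%E].
Proof.
have -> : [set w | (T k w <= s%:E)%E] = ~` [set w | (s%:E < T k w)%E].
  by apply/seteqP; split=> w /=; rewrite leNgt => /negP.
exact/measurableC/measurable_gtT.
Qed.

(** The mixed form, with the first j intervals bounded, is what an induction
    turning half-lines into intervals one by one needs. *)
Definition cell (m : nat) (z : nat -> 'rV[int]_N) (s t : nat -> R) (j : nat) :
    set Omega :=
  [set w | forall i, (i <= m)%N ->
     [/\ Y i w = z i, ((s i)%:E < T i w)%E & (i < j)%N -> (T i w <= (t i)%:E)%E]].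

Lemma measurable_cell m z s t j : measurable (cell m z s t j).
Proof.
have -> : cell m z s t j = \bigcap_(i in `I_m.+1)
    ([set w | Y i w = z i] `&` [set w | ((s i)%:E < T i w)%E] `&`
     (if (i < j)%N then [set w | (T i w <= (t i)%:E)%E] else setT)).
  apply/seteqP; split=> w /= h i im.
    have [h1 h2 h3] := h i im; split=> //; case: ifP => // ij; exact: h3.
  have [[h1 h2] h3] := h i im; split=> // ij; by move: h3; rewrite ij.
apply: bigcap_measurableType => i _; apply: measurableI; last first.
  by case: ifP => // _; exact: measurable_leT.
by apply: measurableI => //; exact: measurable_gtT.
Qed.

(** Each bounded interval is a difference of two half-lines. *)
Lemma cell_prob m z (s t : nat -> R) j : (j <= m.+1)%N ->
  (forall i, (i <= m)%N -> 0 <= s i) -> (forall i, (i <= m)%N -> s i <= t i) ->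
  P0 (cell m z s t j) =
  ((z 0%N == 0)%:R * (\prod_(i < m) jump_prob V r (z i) (z i.+1)) *
   \prod_(i < m.+1) (expR (- (total_rate V r (z i) * s i)) -
      (if (i < j)%N then expR (- (total_rate V r (z i) * t i)) else 0)))%:E.
Proof.
elim: j s => [|j ih] s jm s0 st.
  have -> : cell m z s t 0 =
      [set w | forall i, (i <= m)%N -> Y i w = z i /\ ((s i)%:E < T i w)%E].
    by apply/seteqP; split=> w /= h i /h[]// .
  by rewrite hlaw //; congr (_ * _)%:E; apply: eq_bigr => i _; rewrite subr0.
pose s' i := if i == j then t j else s i.
have cellS : cell m z s t j.+1 = cell m z s t j `\` cell m z s' t j.
  apply/seteqP; split=> w /=.
    move=> h; split=> [i im|h'].
      by have [a b c] := h i im; split=> // ij; apply: c; rewrite ltnS ltnW.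
    have [_ _ c] := h j jm; have [_ + _] := h' j jm.
    by rewrite /s' eqxx ltNge c.
  move=> [h nh] i im; have [a b c] := h i im; split=> //.
  rewrite ltnS leq_eqVlt => /orP[/eqP ij|]; last exact: c.
  rewrite leNgt; apply/negP => tT; apply: nh => k km.
  have [a' b' c'] := h k km; split=> //; rewrite /s'; case: eqP => // kj.
  by rewrite -ij kj -ij in tT *.
have s't i : (i <= m)%N -> s' i <= t i.
  by rewrite /s'; case: eqP => [->//|_]; exact: st.
have s'0 i : (i <= m)%N -> 0 <= s' i.
  rewrite /s'; case: eqP => [->|_]; last exact: s0.
  by move=> jm'; rewrite (le_trans (s0 j jm')) // st.
have ss' : cell m z s' t j `<=` cell m z s t j.
  move=> w h i im; have [a b c] := h i im; split=> //.
  apply: le_lt_trans b; rewrite lee_fin /s'; case: eqP => // ->; exact: st.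
rewrite cellS measureD; [|exact: measurable_cell|exact: measurable_cell|]; last first.
  by rewrite (le_lt_trans (probability_le1 _ (measurable_cell _ _ _ _ _))) // ltry.
rewrite [X in (_ - P0 X)%E](_ : _ = cell m z s' t j); last exact: setIidr.
transitivity (P0 (cell m z s t j) - P0 (cell m z s' t j))%E => //.
rewrite (ih s (ltnW jm) s0 st) (ih s' (ltnW jm) s'0 s't) -EFinB -mulrBr.
congr (_ * _)%:E.
pose jj := Ordinal jm.
rewrite (bigD1 jj) //= ltnn subr0 [X in _ - X = _](bigD1 jj) //= ltnn subr0.
rewrite [in RHS](bigD1 jj) //= ltnSn /s' eqxx mulrBl; congr (_ - _ * _).
- congr (_ * _); apply: eq_bigr => i ij; rewrite ltnS [in RHS]leq_eqVlt.
  by rewrite (negbTE (_ : (nat_of_ord i != j)%N)) //.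
- apply: eq_bigr => i ij; rewrite ltnS [in RHS]leq_eqVlt.
  by rewrite (negbTE (_ : (nat_of_ord i != j)%N)) //.
Qed.

Variable h : R.
Hypothesis h0 : 0 < h.

(** The event that w describes the first slices.  Slices are half-open,
    and holding times are positive almost surely; recording both
    makes the events of distinct words of equal length disjoint and of the
    form cell. *)
Fixpoint ev (w : word N) : set Omega :=
  match w with
  | [::] => [set o | Y 0%N o = 0 /\ (0%:E < T 0%N o)%E]
  | None :: u => ev u `&` [set o | (((age u).+1%:R * h)%:E < T (njumps u) o)%E]
  | Some v :: u => ev u `&` [set o | [/\
      (T (njumps u) o <= ((age u).+1%:R * h)%:E)%E,
      Y (njumps u).+1 o = pos u + v & (0%:E < T (njumps u).+1 o)%E]]
  end.

Lemma ev_behead a u o : ev (a :: u) o -> ev u o.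
Proof. by case: a => [v|] []. Qed.

Lemma ev_current w o : ev w o ->
  Y (njumps w) o = pos w /\ (((age w)%:R * h)%:E < T (njumps w) o)%E.
Proof.
elim: w => [|[v|] w ih] /=; first by rewrite mul0r.
  by move=> [_ [_ ? ?]]; rewrite mul0r.
by move=> [/ih[]].
Qed.

Lemma ev_disjoint l u w o : u \in words V l -> w \in words V l ->
  ev u o -> ev w o -> u = w.
Proof.
elim: l u w => [|l ih] u w; first by rewrite !inE => /eqP-> /eqP->.
move=> /mem_wordsS[u' [a [u'l _ ->]]] /mem_wordsS[w' [b [w'l _ ->]]] eu ew.
have uw := ih _ _ u'l w'l (ev_behead eu) (ev_behead ew).
rewrite -{}uw in ew *; congr cons; move: eu ew.
case: a b => [v|] [v'|] //=.
- by move=> [_ [_ + _]] [_ [_ + _]] => -> /addrI ->.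
- by move=> [_ [+ _ _]] [_]; rewrite leNgt => /negP.
- by move=> [_] + [_ [+ _ _]]; rewrite leNgt => + /negP.
Qed.

(** The successive states of the chain along w, and the numbers of whole slices
    spent in each of them. *)
Fixpoint jumpseq (w : word N) : nat -> 'rV[int]_N :=
  match w with
  | [::] => fun=> 0
  | None :: u => jumpseq u
  | Some v :: u => fun i => if (i <= njumps u)%N then jumpseq u i else pos u + v
  end.

Fixpoint ageseq (w : word N) : nat -> nat :=
  match w with
  | [::] => fun=> 0%N
  | None :: u => fun i => if i == njumps u then (age u).+1 else ageseq u i
  | Some v :: u => fun i => if (i <= njumps u)%N then ageseq u i else 0%N
  end.

Lemma jumpseq_njumps w : jumpseq w (njumps w) = pos w.
Proof. by elim: w => [|[v|] w ih] //=; rewrite ltnn. Qed.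

Lemma ageseq_njumps w : ageseq w (njumps w) = age w.
Proof. by elim: w => [|[v|] w ih] //=; rewrite ?ltnn ?eqxx. Qed.

Lemma jumpseq0 w : jumpseq w 0 = 0.
Proof. by elim: w => [|[v|] w ih]. Qed.

Lemma evE w : ev w = cell (njumps w) (jumpseq w)
  (fun i => (ageseq w i)%:R * h) (fun i => (ageseq w i).+1%:R * h) (njumps w).
Proof.
elim: w => [|[v|] w ih] /=.
- apply/seteqP; split=> o /=.
    by move=> [a b] [|//] _; split=> //; rewrite mul0r.
  by move=> /(_ 0%N isT); rewrite mul0r => -[].
- rewrite ih; apply/seteqP; split=> o /=.
    move=> [ho [a b c]] i; rewrite leq_eqVlt ltnS => /predU1P[->|im].
      by rewrite !ltnn mul0r.
    rewrite im; have [a' b' c'] := ho i im; split=> // _.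
    move: im; rewrite leq_eqVlt => /predU1P[->|]; last exact: c'.
    by rewrite ageseq_njumps.
  move=> ho; split.
    move=> i im; have := ho i (leqW im); rewrite im => -[a b c]; split=> // im'.
    by apply: c; rewrite ltnS.
  have := ho (njumps w) (leqnSn _); rewrite leqnn ltnSn ageseq_njumps.
  move=> [_ _ /(_ isT) a]; have := ho _ (leqnn _); rewrite !ltnn mul0r.
  by move=> [b c _]; split.
- rewrite ih; apply/seteqP; split=> o /=.
    move=> [ho a] i im; have [a' b' c'] := ho i im; split=> //.
      by case: eqP => // ->.
    by move=> im'; rewrite (ltn_eqF im'); exact: c'.
  move=> ho; split; last first.
    by have [_ + _] := ho _ (leqnn _); rewrite eqxx.
  move=> i im; have [a b c] := ho i im; split=> //.
    move: b; case: eqP => // -> b; apply: le_lt_trans b.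
    by rewrite lee_fin ageseq_njumps ler_pM2r // ler_nat.
  by move=> im'; have := c im'; rewrite (ltn_eqF im').
Qed.

Lemma measurable_ev w : measurable (ev w).
Proof. by rewrite evE; exact: measurable_cell. Qed.

Definition pstep0 (u : word N) (a : option 'rV[int]_N) : R :=
  let e := expR (- (total_rate V r (pos u) * h)) in
  if a is Some v then (1 - e) * jump_prob V r (pos u) (pos u + v) else e.

Lemma ev_prob0 w : P0 (ev w) = (wprod pstep0 w)%:E.
Proof.
rewrite evE cell_prob ?leqW //; first last.
- by move=> i _; rewrite ler_pM2r // ler_nat.
- by move=> i _; rewrite mulr_ge0 // ltW.
rewrite jumpseq0 eqxx mul1r; congr _%:E.
pose B (w : word N) i : R :=
  expR (- (total_rate V r (jumpseq w i) * ((ageseq w i)%:R * h))) -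
  (if (i < njumps w)%N
   then expR (- (total_rate V r (jumpseq w i) * ((ageseq w i).+1%:R * h))) else 0).
rewrite -[X in _ * X]/(\prod_(i < (njumps w).+1) B w i).
pose e u := expR (- (total_rate V r (pos u) * h)).
pose E u := expR (- (total_rate V r (pos u) * ((age u)%:R * h))).
have ES u : expR (- (total_rate V r (pos u) * ((age u).+1%:R * h))) = E u * e u.
  by rewrite -natr1 mulrDl mul1r mulrDr opprD expRD.
have BE u : \prod_(i < (njumps u).+1) B u i = (\prod_(i < njumps u) B u i) * E u.
  by rewrite big_ord_recr /=; congr (_ * _);
    rewrite /B ltnn subr0 jumpseq_njumps ageseq_njumps.
elim: w => [|[v|] w ih]; first by rewrite BE /= !big_ord0 /E /= mul0r mulr0 oppr0 expR0 !mulr1.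
- have -> : \prod_(i < njumps (Some v :: w)) jump_prob V r
      (jumpseq (Some v :: w) i) (jumpseq (Some v :: w) i.+1) =
      (\prod_(i < njumps w) jump_prob V r (jumpseq w i) (jumpseq w i.+1)) *
      jump_prob V r (pos w) (pos w + v).
    rewrite big_ord_recr /= leqnn ltnn jumpseq_njumps; congr (_ * _).
    by apply: eq_bigr => i _; rewrite (ltnW (ltn_ord i)) ltn_ord.
  have -> : \prod_(i < (njumps (Some v :: w)).+1) B (Some v :: w) i =
      (\prod_(i < njumps w) B w i) * (E w * (1 - e w)).
    rewrite BE /= big_ord_recr /= -mulrA; congr (_ * _).
      apply: eq_bigr => i _.
      by rewrite /B /= (ltnW (ltn_ord i)) ltn_ord ltnS (ltnW (ltn_ord i)).
    rewrite /B /= ltnSn leqnn jumpseq_njumps ageseq_njumps ES.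
    by rewrite /E /= mul0r mulr0 oppr0 expR0; ring.
  rewrite /= -ih BE /pstep0 -/(e w); ring.
- have -> : \prod_(i < (njumps (None :: w)).+1) B (None :: w) i =
      (\prod_(i < njumps w) B w i) * (E w * e w).
    rewrite BE /= -ES; congr (_ * _).
    by apply: eq_bigr => i _; rewrite /B /= (ltn_eqF (ltn_ord i)).
  by rewrite /= -ih BE /pstep0 -/(e w); ring.
Qed.

End cells.

(** * Words and the sample path *)

Section word_law.
Variables (R : realType) (N : nat) (K : {set 'I_N}) (V : {fset 'rV[int]_N}).
Variable r : 'rV[int]_N -> 'rV[int]_N -> R.
Hypothesis hr : jump_rates K r.
Hypothesis hhom : facet_homogeneous K r.
Hypothesis hlam : forall I : {set 'I_N}, 0 < lamI K V r I.

Definition lam x : R := lamI K V r (zset K x).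

(** Since rates out of the lattice vanish, a word of positive weight never
    leaves it. *)
Lemma wprod_lattice (f : word N -> option 'rV[int]_N -> R) (w : word N) :
  (forall u v, lattice K (pos u) -> rt K r (pos u) v = 0 -> f u (Some v) = 0) ->
  wprod f w != 0 -> lattice K (pos w).
Proof.
move=> f0; elim: w => [_|[v|] w ih] /=.
- by move=> i _; rewrite mxE.
- rewrite mulf_eq0 negb_or => /andP[/ih lw fN0].
  apply: contrapT => nl; move: fN0; rewrite f0 ?eqxx //.
  exact: rt_exit nl.
- by rewrite mulf_eq0 negb_or => /andP[/ih lw _].
Qed.

Definition pstep (h : R) (u : word N) (a : option 'rV[int]_N) : R :=
  let e := expR (- (lam (pos u) * h)) in
  if a is Some v then (1 - e) * (rt K r (pos u) v / lam (pos u)) else e.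

Lemma pstep_sum1 h u : \sum_(a <- letters V) pstep h u a = 1.
Proof.
rewrite big_letters /pstep -mulr_sumr -mulr_suml.
rewrite -[\sum_(_ <- _) _]/(lam (pos u)) divff ?mulr1; last by rewrite gt_eqF // hlam.
by rewrite addrC subrK.
Qed.

Lemma pstep_ge0 h u a : 0 <= h -> 0 <= pstep h u a.
Proof.
move=> h0; rewrite /pstep; case: a => [v|]; last exact: expR_ge0.
have l0 := hlam (zset K (pos u)).
rewrite mulr_ge0 ?divr_ge0 ?rt_ge0 // ?(ltW l0) // subr_ge0 -expR0 ler_expR.
by rewrite oppr_le0 mulr_ge0 // ltW.
Qed.

Lemma wprod_pstep0 h w : wprod (pstep0 V r h) w = wprod (pstep h) w.
Proof.
elim: w => [//|a w /= ->].
have [->|nz] := eqVneq (wprod (pstep h) w) 0; first by rewrite !mul0r.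
congr (_ * _).
have wK : lattice K (pos w).
  apply: wprod_lattice nz => u v _ uv.
  by rewrite /pstep uv mul0r mulr0.
rewrite /pstep0 /pstep (total_rateE V hhom) // -/(lam _); case: a => [v|//].
rewrite /jump_prob (total_rateE V hhom) // gt_eqF ?(addrC (pos w)) ?addrK //.
by rewrite (rtE hhom).
Qed.

End word_law.

Section path.
Variables (R : realType) (N : nat) (K : {set 'I_N}) (V : {fset 'rV[int]_N}).
Variable r : 'rV[int]_N -> 'rV[int]_N -> R.
Hypothesis hr : jump_rates K r.
Hypothesis hhom : facet_homogeneous K r.
Hypothesis hlam : forall I : {set 'I_N}, 0 < lamI K V r I.
Variables (d : measure_display) (Omega : measurableType d).
Variables (P0 : probability Omega R).
Variables (X : R -> Omega -> 'rV[int]_N).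
Variables (Y : nat -> Omega -> 'rV[int]_N) (T : nat -> Omega -> \bar R).
Hypothesis mY : forall k z, measurable [set w | Y k w = z].
Hypothesis mT : forall k, measurable_fun setT (T k).
Hypothesis hlaw : chain_law V r P0 Y T.
Hypothesis Tdiv : forall w, (\sum_(i < k) T i w)%E @[k --> \oo] --> +oo%E.
Hypothesis XY : sample_path X Y T.

Lemma jump_time_gt (t : R) o : exists k, (t%:E < \sum_(i < k) T i o)%E.
Proof.
have /cvgeyPgt/(_ t) [k _ /(_ k (leqnn _)) kt] := Tdiv o.
by exists k.
Qed.

Lemma path_index (t : R) o : 0 <= t ->
  exists k, (\sum_(i < k) T i o <= t%:E)%E /\ (t%:E < \sum_(i < k.+1) T i o)%E.
Proof.
move=> t0; have [k kt] := jump_time_gt t o.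
elim: k kt => [|k ih] kt; first by move: kt; rewrite big_ord0 lte_fin ltNge t0.
have [/ih //|le] := ltP t%:E (\sum_(i < k) T i o)%E.
by exists k.
Qed.

Lemma measurable_sumT k : measurable_fun setT (fun o => \sum_(i < k) T i o)%E.
Proof. exact: emeasurable_sum. Qed.

Lemma measurable_path (t : R) z : 0 <= t -> measurable [set o | X t o = z].
Proof.
move=> t0.
have -> : [set o | X t o = z] = \bigcup_k
    (([set o | (\sum_(i < k) T i o <= t%:E)%E] `&`
      [set o | (t%:E < \sum_(i < k.+1) T i o)%E]) `&` [set o | Y k o = z]).
  apply/seteqP; split=> o /=.
    move=> <-; have [k [k1 k2]] := path_index o t0.
    by exists k => //; split=> //; rewrite (XY t0 k1 k2).
  by move=> [k _ [[k1 k2] <-]]; rewrite (XY t0 k1 k2).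
apply: bigcupT_measurable => k; apply: measurableI => //.
apply: measurableI; rewrite -[X in measurable X]setTI.
  by apply: emeasurable_fun_infty_c => //; exact: measurable_sumT.
by apply: emeasurable_fun_o_infty => //; exact: measurable_sumT.
Qed.

Variable h : R.
Hypothesis h0 : 0 < h.
Local Notation ev := (ev Y T h).

Lemma ev_prob w : P0 (ev w) = (wprod (pstep K V r h) w)%:E.
Proof. by rewrite (ev_prob0 mY mT hlaw h0) (wprod_pstep0 hr hhom hlam). Qed.

Lemma cells_mass l (s : seq (word N)) : uniq s -> {subset s <= words V l} ->
  P0 (\bigcup_(w in [set` s]) ev w) = (\sum_(w <- s) wprod (pstep K V r h) w)%:E.
Proof.
move=> us sl; rewrite measure_fin_bigcup //.
- rewrite -fsbig_seq // -sumEFin.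
  by apply: eq_bigr => w _; exact: ev_prob.
- exact: finite_seq.
- move=> u w /= us' ws' [om [uo wo]]; exact: ev_disjoint (sl _ us') (sl _ ws') uo wo.
- by move=> w _; exact: measurable_ev.
Qed.

Definition covered l := \bigcup_(w in [set` words V l]) ev w.

Lemma measurable_cells (s : seq (word N)) : measurable (\bigcup_(w in [set` s]) ev w).
Proof. by apply: fin_bigcup_measurable => [|w _]; [exact: finite_seq|]; exact: measurable_ev. Qed.

(** The cells of the words of length l are disjoint, and their masses, those of
    a product with step sums 1, add up to one. *)
Lemma covered_ae l : P0 (~` covered l) = 0%E.
Proof.
rewrite probability_setC; last exact: measurable_cells.
have cm := @cells_mass l _ (words_uniq V l) (fun _ wl => wl).
by rewrite [P0 _]cm wprod_eq1 ?subee // => u; exact: pstep_sum1.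
Qed.

(** Real time, as opposed to slice time h * size w: a jump cuts its slice
    short. *)
Definition elapsed (w : word N) o : \bar R :=
  (\sum_(i < njumps w) T i o + ((age w)%:R * h)%:E)%E.

Lemma elapsed_bounds w o : ev w o ->
  ((((size w)%:R - (njumps w)%:R) * h)%:E <= elapsed w o)%E /\
  (elapsed w o <= ((size w)%:R * h)%:E)%E.
Proof.
rewrite /elapsed; elim: w => [|[v|] w ih] /=.
- by rewrite big_ord0 subrr !mul0r add0e.
- move=> [wo [Tle _ _]]; have [lo up] := ih wo; have [_ ageT] := ev_current wo.
  rewrite mul0r adde0 big_ord_recr /=; split.
    apply: (@le_trans _ _ (\sum_(i < njumps w) T i o + ((age w)%:R * h)%:E)%E).
      apply: le_trans lo; rewrite lee_fin ler_pM2r // -[(size w).+1%:R]natr1 -natr1; lra.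
    by rewrite leeD2l // ltW.
  apply: (@le_trans _ _ (\sum_(i < njumps w) T i o + ((age w)%:R * h)%:E + h%:E)%E).
    rewrite -addeA leeD2l // (le_trans Tle) // -EFinD lee_fin -natr1 mulrDl mul1r //.
  rewrite -natr1 mulrDl mul1r EFinD leeD2r //.
- move=> [wo Tgt]; have [lo up] := ih wo.
  have S x : x.+1%:R * h = x%:R * h + h by rewrite -natr1 mulrDl mul1r.
  rewrite S EFinD addeA; split.
    rewrite (_ : ((size w).+1%:R - _) * h = ((size w)%:R - (njumps w)%:R) * h + h); last first.
      by rewrite -natr1; ring.
    by rewrite EFinD leeD2r.
  by rewrite S EFinD leeD2r.
Qed.

Lemma elapsed_ge w o : (\sum_(i < njumps w) T i o <= elapsed w o)%E.
Proof. by rewrite leeDl // lee_fin mulr_ge0 // ltW. Qed.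

(** A time covered by w falls in the true span of one slice, whose position
    in slice time is known up to the number of jumps made so far. *)
Lemma path_slice w o (t : R) : ev w o -> 0 <= t -> (t%:E < elapsed w o)%E ->
  exists k, let u := drop k w in
  [/\ (size u < size w)%N, ((size u)%:R - (njumps u)%:R) * h <= t,
      t < (size u).+1%:R * h & X t o = pos u].
Proof.
elim: w => [|a w ih].
  by rewrite {1}/elapsed /= big_ord0 mul0r add0e lte_fin => _ t0 /lt_geF; rewrite t0.
move=> awo t0 taw; have wo := ev_behead awo.
have [tw|wt] := ltP t%:E (elapsed w o).
  have [k [k1 k2 k3 k4]] := ih wo t0 tw; exists k.+1; split=> //=.
  exact: ltn_trans (ltnSn _).
exists 1%N; rewrite /= drop0; split=> //.
- by have [lo _] := elapsed_bounds wo; rewrite -lee_fin (le_trans lo).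
- by have [_ up] := elapsed_bounds awo; rewrite -lte_fin (lt_le_trans taw).
have [<- _] := ev_current wo; apply: XY => //.
  exact: le_trans (elapsed_ge _ _) wt.
apply: lt_le_trans taw _; rewrite /elapsed.
case: a awo => [v|] /= [_ h2].
  by rewrite mul0r adde0.
by rewrite big_ord_recr /= leeD2l // ltW.
Qed.

Lemma ev_drop k w o : ev w o -> ev (drop k w) o.
Proof.
by elim: w k => [|a w ih] [|k] //= awo; apply: ih; exact: ev_behead awo.
Qed.

(** * Measurability of the tubes *)

Lemma path_right_constant (t : R) o : 0 <= t ->
  exists2 s, t < s & forall u, t <= u < s -> X u o = X t o.
Proof.
move=> t0; have [k [k1 k2]] := path_index o t0.
have [s ts sk] : exists2 s, t < s & (s%:E <= \sum_(i < k.+1) T i o)%E.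
  move: k2; case: (\sum_(i < k.+1) T i o)%E => [s ts|_|//].
    by exists s => //; rewrite -lte_fin.
  by exists (t + 1); rewrite ?ltrDl // leey.
exists s => // u /andP[tu us]; rewrite (XY t0 k1 k2).
apply: XY; first exact: le_trans tu.
  by rewrite (le_trans k1) // lee_fin.
by rewrite (lt_le_trans _ sk) // lte_fin.
Qed.

Variable beta : 'rV[R]_N.
Variable n : nat.
Hypothesis n0 : (0 < n)%N.

Definition deviation (t : R) o : R :=
  enorm (n%:R^-1 *: toR R (X (n%:R * t) o) - t *: beta).

(** The path is constant to the right of every time, so the tube is decided by
    countably many times. *)
Lemma deviation_rat (c : R) o :
  (forall q : rat, 0 <= (ratr q : R) <= 1 -> deviation (ratr q) o <= c) ->
  forall t, 0 <= t <= 1 -> deviation t o <= c.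
Proof.
move=> qc t /andP[t0]; rewrite le_eqVlt => /predU1P[->|t1].
  by have := qc 1; rewrite rmorph1 ler01 lexx; exact.
have nt0 : 0 <= n%:R * t by rewrite mulr_ge0.
have np : 0 < n%:R :> R by rewrite ltr0n.
have [s ts Xs] := path_right_constant o nt0.
apply/ler_addgt0Pr => e e0.
pose b := enorm beta + 1.
have b0 : 0 < b by rewrite ltr_wpDl // enorm_ge0.
have [|q] := @rat_in_itvoo R t (Num.min 1 (Num.min (s / n%:R) (t + e / b))).
  rewrite !lt_min t1 ltrDl divr_gt0 // andbT ltr_pdivlMr // mulrC //.
rewrite in_itv /= !lt_min => /andP[tq /andP[q1 /andP[qs qe]]].
have q01 : 0 <= (ratr q : R) <= 1 by rewrite (ltW q1) (le_trans t0) // ltW.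
rewrite (le_trans _ (lerD (qc q q01) (lexx e))) // /deviation.
rewrite (Xs (n%:R * ratr q)); last first.
  by rewrite ler_pM2l // (ltW tq) /= mulrC -ltr_pdivlMr.
rewrite (_ : _ - t *: beta = (n%:R^-1 *: toR R (X (n%:R * t) o) - ratr q *: beta)
   + (ratr q - t) *: beta); last by rewrite scalerBl addrA subrK.
rewrite (le_trans (enormD _ _)) // lerD2l enormZ ger0_norm; last by rewrite subr_ge0 ltW.
apply: (@le_trans _ _ ((ratr q - t) * b)).
  by rewrite ler_wpM2l ?subr_ge0 ?(ltW tq) // lerDl.
by rewrite -ler_pdivlMr // lerBlDl ltW.
Qed.

Lemma measurable_deviation (t c : R) : 0 <= t -> measurable [set o | deviation t o <= c].
Proof.
move=> t0.
have -> : [set o | deviation t o <= c] = \bigcup_(z : 'rV[int]_N)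
   (if enorm (n%:R^-1 *: toR R z - t *: beta) <= c
    then [set o | X (n%:R * t) o = z] else set0).
  apply/seteqP; split=> o /=.
    by move=> h1; exists (X (n%:R * t) o) => //; rewrite ifT.
  by move=> [z _]; case: ifP => // h1 /= Xz; rewrite /deviation Xz.
apply: countable_bigcupT_measurable => // z; case: ifP => // _.
by apply: measurable_path; rewrite mulr_ge0.
Qed.

(** The strict bound on the supremum holds iff the deviations at rational times
    stay below some e - 1 / (m + 1). *)
Lemma tubeE e : tube X n beta e =
  \bigcup_(m : nat) \bigcap_(q : rat)
    (if 0 <= (ratr q : R) <= 1 then [set o | deviation (ratr q) o <= e - m.+1%:R^-1]
     else setT).
Proof.
apply/seteqP; split=> o /=; last first.
  move=> [m _ mo].
  have /deviation_rat dev : forall q : rat, 0 <= (ratr q : R) <= 1 ->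
      deviation (ratr q) o <= e - m.+1%:R^-1.
    by move=> q q01; have := mo q I; rewrite q01.
  rewrite /tube /=; apply: (@le_lt_trans _ _ (e - m.+1%:R^-1)%:E).
    apply: ge_ereal_sup => _ [t t01 <-]; rewrite lee_fin; apply: dev.
    by move: t01; rewrite /= in_itv.
  by rewrite lte_fin ltrBlDr ltrDl invr_gt0.
rewrite /tube /=; set S := ereal_sup _ => Se.
have devS t : 0 <= t <= 1 -> ((deviation t o)%:E <= S)%E.
  by move=> t01; apply: ereal_sup_ubound; exists t => //; rewrite /= in_itv.
have [s Ss] : exists s, S = s%:E.
  have S0 : (0%:E <= S)%E.
    by apply: le_trans (devS 0 _); rewrite ?lexx ?ler01 // lee_fin enorm_ge0.
  by move: Se S0; case: S {devS} => [s _ _|//|//]; exists s.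
rewrite Ss lte_fin in Se.
have [m sm] : exists m : nat, m.+1%:R^-1 < e - s.
  have es : 0 < e - s by rewrite subr_gt0.
  exists (Num.truncn (e - s)^-1); rewrite invf_plt ?posrE //.
  by rewrite truncnS_gt.
exists m => // q _; case: ifP => //= q01.
have := devS _ q01; rewrite Ss lee_fin => /le_trans; apply.
by rewrite lerBrDr -lerBrDl ltW.
Qed.

Lemma measurable_tube e : measurable (tube X n beta e).
Proof.
rewrite tubeE; apply: bigcupT_measurable => m.
rewrite -[X in measurable X]setCK setC_bigcap; apply: measurableC.
apply: bigcupT_measurable_rat => q; apply: measurableC; case: ifP => // /andP[q0 _].
exact: measurable_deviation.
Qed.

End path.

(** * An exponential upper bound for the probability of a tube *)

Section upper.
Variables (R : realType) (N : nat) (K : {set 'I_N}) (V : {fset 'rV[int]_N}).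
Variable r : 'rV[int]_N -> 'rV[int]_N -> R.
Hypothesis hr : jump_rates K r.
Hypothesis hhom : facet_homogeneous K r.
Hypothesis hlam : forall I : {set 'I_N}, 0 < lamI K V r I.
Variables (d : measure_display) (Omega : measurableType d).
Variables (P0 : probability Omega R).
Variables (X : R -> Omega -> 'rV[int]_N).
Variables (Y : nat -> Omega -> 'rV[int]_N) (T : nat -> Omega -> \bar R).
Hypothesis mY : forall k z, measurable [set w | Y k w = z].
Hypothesis mT : forall k, measurable_fun setT (T k).
Hypothesis hlaw : chain_law V r P0 Y T.
Hypothesis T0 : forall k w, (0 <= T k w)%E.
Hypothesis Tdiv : forall w, (\sum_(i < k) T i w)%E @[k --> \oo] --> +oo%E.
Hypothesis XY : sample_path X Y T.

Variable H : nat.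
Hypothesis H0 : (0 < H)%N.
Local Notation h := (H%:R^-1 : R).
Local Notation ev := (ev Y T h).
Local Notation lam := (lam K V r).
Local Notation rt := (rt K r).

Let h0 : 0 < h. Proof. by rewrite invr_gt0 ltr0n. Qed.

(** A word long enough to cover the time n either locates X n or consists
    almost only of jumps; the latter is excluded for a word longer than n H by
    more than the number of jumps that the process makes before n. *)
Lemma path_cover (n : nat) o : (forall l, covered V Y T h l o) ->
  exists i u, [/\ u \in words V (n * H + i), ev u o, (i <= njumps u)%N &
                  X n%:R o = pos u].
Proof.
move=> cov; have [k nk] := jump_time_gt Tdiv n%:R o.
have [w wl wo] := cov (n * H + k)%N.
have sw := words_size wl.
have nHh : (n * H)%:R * h = n%:R by rewrite natrM mulfK // pnatr_eq0 -lt0n.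
have nat_of (u : word N) : ((size u)%:R - (njumps u)%:R) * h <= n%:R ->
    (size u <= n * H + njumps u)%N.
  by rewrite -nHh ler_pM2r // lerBlDr -natrD ler_nat.
have [nw|wn] := ltP n%:R%:E (elapsed T h w o); last first.
  have [lo _] := elapsed_bounds h0 wo.
  have /nat_of : ((size w)%:R - (njumps w)%:R) * h <= n%:R.
    by rewrite -lee_fin (le_trans lo).
  rewrite sw leq_add2l => knj.
  have := le_trans (elapsed_ge T h0 w o) wn; rewrite leNgt => /negP[].
  apply: lt_le_trans nk _.
  by apply: (lee_sum_nneg_ord (T^~ o) xpredT) knj => i _; exact: T0.
have [j [u1 u2 u3 u4]] := path_slice XY h0 wo (ler0n _ _) nw.
set u := drop j w in u1 u2 u3 u4.
have ul : u \in words V (size u).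
  have := words_drop j wl; rewrite -/u => ul; by rewrite (words_size ul).
have nu : (n * H <= size u)%N.
  move: u3; rewrite -nHh ltr_pM2r // ltr_nat ltnS //.
exists (size u - n * H)%N, u; split=> //; first by rewrite subnKC.
- exact: ev_drop.
- by rewrite leq_subLR; exact: nat_of.
Qed.

Variables (beta : 'rV[R]_N) (n : nat) (n0 : (0 < n)%N).
Variables (alpha : 'rV[R]_N) (gam Lam e : R).
Hypothesis gam0 : 0 < gam.
Hypothesis hLam : forall I : {set 'I_N},
  \sum_(v <- V) facet_rate K r I v * expR (dot alpha (toR R v) + gam)
  - lamI K V r I + lamI K V r I ^+ 2 * h <= Lam.
Hypothesis hsmall : h * Lam <= gam / 2.

Let tilt (u : word N) (a : option 'rV[int]_N) : R :=
  if a is Some v then expR (dot alpha (toR R v) + gam) else 1.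

Lemma wprod_tilt w :
  wprod tilt w = expR (dot alpha (toR R (pos w)) + gam * (njumps w)%:R).
Proof.
elim: w => [|[v|] w ih] /=.
- by rewrite toR0 dot0r mulr0 addr0 expR0.
- by rewrite ih -expRD; congr expR; rewrite toRD dotDr -natr1; ring.
- by rewrite ih mulr1.
Qed.

Lemma expR_lower2 (x : R) : 0 <= x -> x - x ^+ 2 <= 1 - expR (- x).
Proof.
move=> x0; have x1 : 0 < 1 + x by rewrite ltr_pwDl.
have : expR (- x) <= (1 + x)^-1.
  by rewrite expRN lef_pV2 ?posrE ?expR_gt0 // expR_ge1Dx.
have : (1 + x)^-1 <= 1 - x + x ^+ 2.
  rewrite -[leLHS]mul1r ler_pdivrMr //.
  rewrite (_ : (1 - x + x ^+ 2) * (1 + x) = 1 + x ^+ 3); last by ring.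
  by rewrite lerDl exprn_ge0.
lra.
Qed.

(** The letter Some v has probability about h r_v, so the sum is about
    1 + h (sum_v r_v exp ((alpha, v) + gam) - lam); the term lam ^ 2 * h in the
    bound for Lam absorbs the difference 1 - exp (- lam h) - lam h. *)
Lemma tilted_step u :
  \sum_(a <- letters V) pstep K V r h u a * tilt u a <= expR (h * Lam).
Proof.
rewrite big_letters /pstep /tilt mulr1.
set l := lam (pos u); set x := expR (- (l * h)).
have l0 : 0 < l by exact: hlam.
under eq_bigr do rewrite -!mulrA (mulrCA _ l^-1).
rewrite -mulr_sumr -mulr_sumr.
set B := \sum_(v <- V) _.
have B0 : 0 <= B.
  by apply: sumr_ge0 => v _; rewrite mulr_ge0 ?expR_ge0 // rt_ge0.
have lB : B - l + l ^+ 2 * h <= Lam by exact: hLam.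
apply: le_trans (expR_ge1Dx _).
have x1 : 1 - x <= l * h by have := expR_ge1Dx (- (l * h)); rewrite -/x; lra.
have x2 : l * h - (l * h) ^+ 2 <= 1 - x.
  by apply: expR_lower2; rewrite mulr_ge0 // ltW.
suff : (1 - x) * (B - l) <= l * (h * Lam).
  move=> le; rewrite (_ : x + _ = 1 + (1 - x) * (B - l) / l); last first.
    by field; rewrite gt_eqF.
  by rewrite lerD2l ler_pdivrMr // [leRHS]mulrC.
have h00 := ltW h0.
apply: (@le_trans _ _ (l * (h * (B - l + l ^+ 2 * h)))); last first.
  by rewrite ler_wpM2l ?(ltW l0) // ler_wpM2l.
have [Bl|Bl] := leP 0 (B - l).
  apply: (@le_trans _ _ (l * h * (B - l))); first by rewrite ler_wpM2r.
  rewrite -mulrA ler_wpM2l ?(ltW l0) // ler_wpM2l // lerDl.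
  by rewrite mulr_ge0 // sqr_ge0.
apply: (@le_trans _ _ ((l * h - (l * h) ^+ 2) * (B - l))).
  by rewrite ler_wnM2r // ltW.
rewrite -subr_ge0 (_ : _ - _ = l ^+ 2 * h ^+ 2 * B); last by ring.
by apply: mulr_ge0 B0; apply: mulr_ge0; exact: sqr_ge0.
Qed.

(** Each of the words in the sum has
    exp ((alpha, pos w - n beta) + n |alpha| e + gam (njumps w - i)) >= 1; the
    reward gam per jump makes the bounds summable in i. *)
Lemma hitting_words_mass i :
  \sum_(w <- [seq w <- words V (n * H + i) |
     (enorm (n%:R^-1 *: toR R (pos w) - beta) < e) && (i <= njumps w)%N])
    wprod (pstep K V r h) w <=
  expR (- (n%:R * (dot alpha beta - enorm alpha * e - Lam))) * expR (- (gam / 2)) ^+ i.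
Proof.
set C := - (n%:R * (dot alpha beta - enorm alpha * e)) - gam * i%:R.
have np : 0 < n%:R :> R by rewrite ltr0n.
apply: (@le_trans _ _ (expR C * expR (h * Lam) ^+ (n * H + i))); last first.
  rewrite -!expRM_natl -!expRD ler_expR natrD natrM /C.
  have -> : (n%:R * H%:R + i%:R) * (h * Lam) = n%:R * Lam + i%:R * (h * Lam).
    by field; rewrite pnatr_eq0 -lt0n.
  have : i%:R * (h * Lam) <= i%:R * (gam / 2) by rewrite ler_wpM2l.
  lra.
have pge u a : 0 <= pstep K V r h u a.
  exact: (pstep_ge0 hr hlam _ _ (ltW h0)).
have tge u a : 0 <= tilt u a by case: a => [v|]; rewrite ?ler01 ?expR_ge0.
have le := wprod_le (n * H + i) (fun u a => mulr_ge0 (pge u a) (tge u a))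
  (expR_ge0 _) tilted_step.
apply: le_trans (ler_wpM2l (expR_ge0 C) le).
rewrite mulr_sumr big_filter [leLHS]big_mkcond /=; apply: ler_sum => w _.
rewrite wprodM wprod_tilt.
have wp : 0 <= wprod (pstep K V r h) w by exact: wprod_ge0.
case: ifP => [/andP[we iw]|_]; last by rewrite !mulr_ge0 ?expR_ge0.
rewrite mulrCA -expRD ler_peMr // -[leLHS]expR0 ler_expR /C.
have iw' : gam * i%:R <= gam * (njumps w)%:R by rewrite ler_pM2l // ler_nat.
have : - (enorm alpha * e) <= dot alpha (n%:R^-1 *: toR R (pos w) - beta).
  have := cauchy_schwarz alpha (n%:R^-1 *: toR R (pos w) - beta).
  rewrite ler_norml => /andP[+ _]; apply: le_trans.
  by rewrite lerN2 ler_wpM2l ?enorm_ge0 // ltW.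
rewrite dotBr dotZr -(ler_pM2l np) mulrBr mulVKf ?gt_eqF //; lra.
Qed.

Lemma tube_upper : (P0 (tube X n beta e) <=
  ((1 - expR (- (gam / 2)))^-1 *
   expR (- (n%:R * (dot alpha beta - enorm alpha * e - Lam))))%:E)%E.
Proof.
set D := expR (- (n%:R * _)); set th := expR (- (gam / 2)).
have th1 : th < 1 by rewrite -expR0 ltr_expR oppr_lt0 divr_gt0.
pose s i := [seq w <- words V (n * H + i) |
     (enorm (n%:R^-1 *: toR R (pos w) - beta) < e) && (i <= njumps w)%N].
pose A i := \bigcup_(w in [set` s i]) ev w `|` ~` covered V Y T h (n * H + i).
pose B := \bigcup_i ~` covered V Y T h i.
have mc (s' : seq (word N)) : measurable (\bigcup_(w in [set` s']) ev w).
  exact: (measurable_cells mY mT h0).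
have mcov l : measurable (~` covered V Y T h l) by apply: measurableC; exact: mc.
have mA i : measurable (A i) by apply: measurableU.
have cov0 l : P0 (~` covered V Y T h l) = 0%E.
  exact: (covered_ae hr hhom hlam mY mT hlaw h0).
have PA i : (P0 (A i) <= (D * th ^+ i)%:E)%E.
  rewrite measureU0; [|exact: mc|exact: mcov|exact: cov0].
  have us : uniq (s i) by rewrite filter_uniq // words_uniq.
  have ss : {subset s i <= words V (n * H + i)}.
    by move=> w; rewrite mem_filter => /andP[].
  have cm := cells_mass hr hhom hlam mY mT hlaw h0 us ss.
  by rewrite [leLHS]cm lee_fin; exact: hitting_words_mass.
have mB : measurable B by apply: bigcupT_measurable.
have PB : P0 B = 0%E.
  apply/eqP; rewrite eq_le measure_ge0 andbT.
  apply: le_trans (measure_sigma_subadditive P0 mcov mB (@subset_refl _ _)) _.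
  by rewrite eseries0 // => i _ _; exact: cov0.
have mU : measurable (\bigcup_i A i) by exact: bigcupT_measurable.
have tA : tube X n beta e `<=` \bigcup_i A i `|` B.
  move=> o to; have [Bo|Bo] := pselect (B o); [by right|left].
  have cov l : covered V Y T h l o.
    by apply: contrapT => ncov; apply: Bo; exists l.
  have [i [u [ul uo iu Xu]]] := path_cover n cov.
  exists i => //; left; exists u => //=.
  rewrite mem_filter ul iu andbT /= andbT -Xu.
  rewrite -lte_fin; apply: le_lt_trans to; apply: ereal_sup_ubound.
  by exists 1; rewrite /= ?in_itv /= ?ler01 ?lexx // mulr1 scale1r.
apply: (@le_trans _ _ (P0 (\bigcup_i A i `|` B))).
  rewrite le_measure ?inE //; last exact: measurableU.
  exact: (measurable_tube mY mT Tdiv XY beta n0 e).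
rewrite measureU0 //.
apply: le_trans (measure_sigma_subadditive _ mA mU (@subset_refl _ _)) _.
apply: lime_le; first exact: is_cvg_nneseries.
near=> k; apply: (@le_trans _ _ (\sum_(0 <= i < k) (D * th ^+ i)%:E)%E).
  by apply: lee_sum => i _; exact: PA.
rewrite sumEFin lee_fin -mulr_sumr mulrC ler_wpM2r ?expR_ge0 //.
rewrite -[leRHS]mul1r ler_pdivlMr ?subr_gt0 //.
rewrite big_mkord; have := subrX1 th k; have : 0 <= th ^+ k by rewrite exprn_ge0 // expR_ge0.
set S := \sum_(_ < _) _; lra.
Unshelve. all: by end_near.
Qed.

End upper.

(** * From tube probabilities to the local rate function *)

Section limits.
Variable R : realType.

Lemma limn_esup_le (u : (\bar R)^nat) c n0 :
  (forall n, (n0 <= n)%N -> (u n <= c)%E) -> (limn_esup u <= c)%E.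
Proof.
move=> uc; rewrite limn_esup_lim; apply: lime_le; first exact: is_cvg_esups.
exists n0 => // n n0n; apply: ge_ereal_sup => _ [k /= nk <-].
by apply: uc; exact: leq_trans nk.
Qed.

Lemma limn_einf_ge (u : (\bar R)^nat) c n0 :
  (forall n, (n0 <= n)%N -> (c <= u n)%E) -> (c <= limn_einf u)%E.
Proof.
move=> uc; rewrite limn_einf_lim; apply: lime_ge; first exact: is_cvg_einfs.
exists n0 => // n n0n; apply: le_ereal_inf_tmp => _ [k /= nk <-].
by apply: uc; exact: leq_trans nk.
Qed.

Variables (N : nat) (K : {set 'I_N}).
Variables (d : measure_display) (Omega : measurableType d).
Variables (P : 'rV[int]_N -> probability Omega R) (X : R -> Omega -> 'rV[int]_N).
Variable beta : 'rV[R]_N.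

Lemma qn0_values e dl n : 0 <= dl -> qn_values K P X beta e dl n (qn P X n 0 beta e).
Proof.
move=> dl0; exists 0 => //=; split; last by rewrite toR0 scaler0 enorm0.
by move=> i _; rewrite mxE.
Qed.

(** Both iterated limits being equal, the starting point 0 alone determines
    the local rate function; this is its use for lower bounds. *)
Lemma rate_ge (Lb a b : R) :
  iterated_limit (fun e delta => limn_esup (fun n =>
    ereal_sup (qn_values K P X beta e delta n))) Lb%:E ->
  0 <= b ->
  (forall e eta, 0 < e < 1 -> 0 < eta ->
     exists n0, forall n, (n0 <= n)%N -> ((a - b * e - eta)%:E <= qn P X n 0 beta e)%E) ->
  a <= Lb.
Proof.
move=> [G FG GL] b0 h; apply/ler_addgt0Pr => eta eta0.
suff : ((a - eta)%:E <= Lb%:E)%E by rewrite lee_fin lerBlDr.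
have eta2 : 0 < eta / 2 by rewrite divr_gt0.
apply: cvge_ge GL; near=> e.
have e01 : 0 < e < 1 by apply/andP; split; near: e; [exact: nbhs_right_gt|exact: nbhs_right_lt].
have be : b * e <= eta / 2.
  have : e * (b + 1) <= eta / 2.
    rewrite -ler_pdivlMr ?ltr_wpDl //; near: e; apply: nbhs_right_le.
    by rewrite divr_gt0 // ltr_wpDl.
  by apply: le_trans; rewrite mulrC ler_pM2l ?lerDl //; case/andP: e01.
have [n0 hn] := h e _ e01 eta2.
apply: (@le_trans _ _ (a - b * e - eta / 2)%:E); first by rewrite lee_fin; lra.
apply: cvge_ge (FG e e01); near=> dl.
apply: le_trans (limn_einf_sup _).
apply: (@limn_einf_ge _ _ n0) => n /hn /le_trans; apply.
by apply/ereal_sup_ubound/qn0_values.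
Unshelve. all: by end_near. Qed.

Lemma rate_le (Lb a : R) :
  iterated_limit (fun e delta => limn_einf (fun n =>
    ereal_inf (qn_values K P X beta e delta n))) Lb%:E ->
  (forall e eta, 0 < e < 1 -> 0 < eta ->
     exists n0, forall n, (n0 <= n)%N -> (qn P X n 0 beta e <= (a + eta)%:E)%E) ->
  Lb <= a.
Proof.
move=> [G FG GL] h; apply/ler_addgt0Pr => eta eta0.
suff : (Lb%:E <= (a + eta)%:E)%E by rewrite lee_fin.
apply: cvge_le GL; near=> e.
have e01 : 0 < e < 1 by apply/andP; split; near: e; [exact: nbhs_right_gt|exact: nbhs_right_lt].
have [n0 hn] := h e _ e01 eta0.
apply: cvge_le (FG e e01); near=> dl.
apply: le_trans (limn_einf_sup _) _.
apply: (@limn_esup_le _ _ n0) => n /hn; apply: le_trans.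
by apply/ereal_inf_lbound/qn0_values.
Unshelve. all: by end_near. Qed.

Lemma qn_ge (C A e : R) n : (0 < n)%N -> 0 < C ->
  (P 0 (tube X n beta e) <= (C * expR (- (n%:R * A)))%:E)%E ->
  ((A - ln C / n%:R)%:E <= qn P X n 0 beta e)%E.
Proof.
move=> n0 C0 le.
have np : 0 < n%:R :> R by rewrite ltr0n.
have CE : 0 < C * expR (- (n%:R * A)) by rewrite mulr_gt0 ?expR_gt0.
rewrite /qn -[leLHS]oppeK leeN2.
have -> : (- (A - ln C / n%:R)%:E = (n%:R^-1)%:E * (ln C - n%:R * A)%:E)%E.
  by rewrite -EFinM -EFinN; congr _%:E; field; rewrite gt_eqF.
rewrite lee_pmul2l ?lte_fin ?invr_gt0 //.
have -> : (ln C - n%:R * A)%:E = lne (C * expR (- (n%:R * A)))%:E.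
  by rewrite lne_EFin // lnM ?posrE ?expR_gt0 // expRK.
by rewrite lee_lne // in_itv /= leey andbT ?measure_ge0 // lee_fin ltW.
Qed.

Lemma qn_le (C A e : R) n : (0 < n)%N -> 0 < C ->
  ((C * expR (- (n%:R * A)))%:E <= P 0 (tube X n beta e))%E ->
  (qn P X n 0 beta e <= (A - ln C / n%:R)%:E)%E.
Proof.
move=> n0 C0 le.
have np : 0 < n%:R :> R by rewrite ltr0n.
have CE : 0 < C * expR (- (n%:R * A)) by rewrite mulr_gt0 ?expR_gt0.
rewrite /qn -[leRHS]oppeK leeN2.
have -> : (- (A - ln C / n%:R)%:E = (n%:R^-1)%:E * (ln C - n%:R * A)%:E)%E.
  by rewrite -EFinM -EFinN; congr _%:E; field; rewrite gt_eqF.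
rewrite lee_pmul2l ?lte_fin ?invr_gt0 //.
have -> : (ln C - n%:R * A)%:E = lne (C * expR (- (n%:R * A)))%:E.
  by rewrite lne_EFin // lnM ?posrE ?expR_gt0 // expRK.
by rewrite lee_lne // in_itv /= leey andbT ?measure_ge0 // lee_fin ltW.
Qed.

End limits.

Section rate_lower.
Variables (R : realType) (N : nat) (K : {set 'I_N}) (V : {fset 'rV[int]_N}).
Variable r : 'rV[int]_N -> 'rV[int]_N -> R.
Hypothesis hr : jump_rates K r.
Hypothesis hhom : facet_homogeneous K r.
Hypothesis hlam : forall I : {set 'I_N}, 0 < lamI K V r I.
Variables (d : measure_display) (Omega : measurableType d).
Variables (P : 'rV[int]_N -> probability Omega R).
Variables (X : R -> Omega -> 'rV[int]_N).
Hypothesis hX : jump_markov_process K V r P X.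

Lemma small_inv_nat (x : R) : 0 < x -> exists2 H : nat, (0 < H)%N & (H%:R : R)^-1 <= x.
Proof.
move=> x0; exists (Num.truncn x^-1).+1 => //.
by rewrite invf_ple ?posrE // ltW // truncnS_gt.
Qed.

Lemma div_nat_le (c x : R) : 0 <= c -> 0 < x ->
  exists n0, (0 < n0)%N /\ forall n, (n0 <= n)%N -> c / n%:R <= x.
Proof.
move=> c0 x0; have xc : 0 < x / (c + 1) by rewrite divr_gt0 // ltr_wpDl.
have [n0 n00 le] := small_inv_nat xc.
exists n0; split=> // n n0n.
have n0' : (0 < n)%N by exact: leq_trans n0n.
have : n%:R^-1 <= x / (c + 1).
  by rewrite (le_trans _ le) // lef_pV2 ?posrE ?ltr0n // ler_nat.
rewrite ler_pdivlMr ?ltr_wpDl // mulrC mulrDl mul1r; apply: le_trans.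
by rewrite lerDl.
Qed.

(** The Hamiltonian of the process with the homogeneous rates of the facet I. *)
Definition ham (I : {set 'I_N}) (alpha : 'rV[R]_N) : R :=
  \sum_(v <- V) facet_rate K r I v * (expR (dot alpha (toR R v)) - 1).

Variables (beta alpha : 'rV[R]_N) (Lb Lam0 : R).
Hypothesis hL : iterated_limit (fun e delta => limn_esup (fun n =>
    ereal_sup (qn_values K P X beta e delta n))) Lb%:E.
Hypothesis hham : forall I, ham I alpha <= Lam0.

(** First gam, the reward per jump, is taken so small that it hardly changes
    ham; then h small against gam. *)
Lemma rate_ge_dual : dot alpha beta - Lam0 <= Lb.
Proof.
case: hX => Y [T [mY mT Tdiv XY law]].
have K0 : lattice K 0 by move=> i _; rewrite mxE.
apply: (rate_ge hL (enorm_ge0 alpha)) => e eta /andP[e0 _] eta0.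
pose B I := \sum_(v <- V) facet_rate K r I v * expR (dot alpha (toR R v)).
have B0 I : 0 <= B I.
  by apply: sumr_ge0 => v _; rewrite mulr_ge0 ?expR_ge0 ?(facet_rate_ge0 hr).
pose Bm := \sum_I B I; pose lm := \sum_I lamI K V r I.
have BBm I : B I <= Bm by rewrite /Bm (bigD1 I) //= lerDl sumr_ge0.
have llm I : lamI K V r I <= lm.
  by rewrite /lm (bigD1 I) //= lerDl sumr_ge0 // => J _; rewrite ltW.
have Bm0 : 0 <= Bm by exact: sumr_ge0.
have lm0 : 0 <= lm by apply: sumr_ge0 => I _; exact/ltW.
have eta4 : 0 < eta / 4 by rewrite divr_gt0.
pose x := eta / 4 / (Bm + 1).
have x0 : 0 < x by rewrite divr_gt0 // ltr_wpDl.
pose gam := ln (1 + x).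
have gam0 : 0 < gam by rewrite ln_gt0 // ltrDl.
pose Lam := Lam0 + eta / 2.
pose y1 := eta / 4 / (lm ^+ 2 + 1); pose y2 := gam / 2 / (`|Lam| + 1).
have y10 : 0 < y1 by rewrite divr_gt0 // ltr_wpDl // sqr_ge0.
have y20 : 0 < y2 by rewrite !divr_gt0 // ltr_wpDl.
have [|H H0] := @small_inv_nat (Num.min y1 y2); first by rewrite lt_min y10.
rewrite le_min => /andP[hy1 hy2].
have h0 : 0 < (H%:R : R)^-1 by rewrite invr_gt0 ltr0n.
have hsmall : H%:R^-1 * Lam <= gam / 2.
  have : H%:R^-1 * (`|Lam| + 1) <= gam / 2 by rewrite -ler_pdivlMr // ltr_wpDl.
  apply: le_trans; rewrite ler_wpM2l ?(ltW h0) //.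
  by rewrite (le_trans (ler_norm _)) // lerDl.
have hLam I : \sum_(v <- V) facet_rate K r I v * expR (dot alpha (toR R v) + gam)
  - lamI K V r I + lamI K V r I ^+ 2 * H%:R^-1 <= Lam.
  have -> : \sum_(v <- V) facet_rate K r I v * expR (dot alpha (toR R v) + gam)
      = B I * (1 + x).
    rewrite /B mulr_suml; apply: eq_bigr => v _.
    by rewrite expRD lnK ?mulrA // posrE ltr_wpDl // ltW.
  have hamE : ham I alpha = B I - lamI K V r I.
    by rewrite /ham /B /lamI -sumrB; apply: eq_bigr => v _; rewrite mulrBr mulr1.
  have : B I * x <= eta / 4.
    have : (Bm + 1) * x = eta / 4 by rewrite mulrC /x divfK // gt_eqF // ltr_wpDl.
    move=> <-; rewrite ler_wpM2r ?(ltW x0) //.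
    by rewrite (le_trans (BBm I)) // lerDl.
  have : lamI K V r I ^+ 2 * H%:R^-1 <= eta / 4.
    have : (lm ^+ 2 + 1) * H%:R^-1 <= eta / 4.
      by rewrite mulrC -ler_pdivlMr // ltr_wpDl // sqr_ge0.
    apply: le_trans; rewrite ler_wpM2r ?(ltW h0) //.
    rewrite (le_trans (lerXn2r 2 _ _ (llm I))) ?nnegrE ?lerDl //.
    exact/ltW.
  have := hham I; rewrite hamE /Lam; lra.
pose C := (1 - expR (- (gam / 2)))^-1.
have th1 : expR (- (gam / 2)) < 1 by rewrite -[ltRHS]expR0 ltr_expR oppr_lt0 divr_gt0.
have C1 : 1 <= C.
  rewrite invf_ge1 ?subr_gt0 // lerBlDr lerDl; exact: expR_ge0.
have C0 : 0 < C by rewrite (lt_le_trans ltr01).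
have eta2 : 0 < eta / 2 by rewrite divr_gt0.
have lnC : 0 <= ln C by exact: ln_ge0.
have [n0 [n00 hn0]] := div_nat_le lnC eta2.
exists n0 => n n0n; have np : (0 < n)%N by exact: leq_trans n0n.
have up := tube_upper hr hhom hlam mY (fun k => (mT k).1) (law 0 K0)
  (fun k => (mT k).2) Tdiv XY H0 beta np e gam0 hLam hsmall.
apply: le_trans (qn_ge np C0 up).
by rewrite lee_fin /Lam; have := hn0 n n0n; lra.
Qed.

End rate_lower.

(** * Consequences of communication *)

Section communication.
Variables (R : realType) (N : nat) (hN : (0 < N)%N) (K : {set 'I_N}).
Variables (V : {fset 'rV[int]_N}) (r : 'rV[int]_N -> 'rV[int]_N -> R).
Hypothesis hr : jump_rates K r.
Hypothesis hhom : facet_homogeneous K r.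
Hypothesis hV : forall (I : {set 'I_N}) (v : 'rV[int]_N),
    I \subset K -> 0 < facet_rate K r I v -> v \in V.
Hypothesis hcomm : communicating K r.

Lemma facet_rateI (I : {set 'I_N}) v :
  facet_rate K r I v = facet_rate K r (I :&: K) v.
Proof.
rewrite /facet_rate; congr r; apply/rowP => i; rewrite !mxE !inE.
by case: (i \in K); rewrite ?andbT ?andbF.
Qed.

Lemma positive_rate x v : lattice K x -> 0 < r x v -> v \in V.
Proof. by move=> xK; rewrite (rtE hhom) //; apply: hV; exact: zset_sub. Qed.

Let e0 : 'rV[int]_N := delta_mx ord0 (Ordinal hN).

Lemma lamI_gt0 (I : {set 'I_N}) : 0 < lamI K V r I.
Proof.
have [K0 hK0] := hcomm.
set x := facet_point K I.
have xK : lattice K x by exact: facet_point_lattice.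
have yK : lattice K (x + e0).
  by move=> i iK; rewrite mxE addr_ge0 ?xK // !mxE; case: (_ && _).
have [J [p [_ [p0 pJ] pl pr]]] := hK0 _ _ xK yK.
case: J pJ pl pr => [|J] pJ pl pr.
  have : e0 = 0 by apply: (addrI x); rewrite addr0 -pJ p0.
  by move=> /matrixP/(_ ord0 (Ordinal hN)); rewrite !mxE !eqxx.
have := pr 0%N isT; rewrite p0 => r0.
have vV := positive_rate xK r0.
rewrite /lamI (big_fsetD1 _ vV) /= ltr_pwDl //.
by apply: sumr_ge0 => w _; exact: (facet_rate_ge0 hr).
Qed.

(** A path between neighbouring points far from the boundary has boundedly
    many steps, hence stays far from the boundary; so the jumps possible in
    the interior span the whole space positively. *)
Lemma interior_span : exists2 J : nat, (0 < J)%N &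
  forall (alpha : 'rV[R]_N) i, exists v, [/\ v \in V, 0 < facet_rate K r finset.set0 v &
    `|alpha ord0 i| <= J%:R * dot alpha (toR R v)].
Proof.
have [K0 hK0] := hcomm.
pose Jm := Num.truncn K0.
exists Jm.+1 => // alpha i; apply: contrapT => nex.
have small v : v \in V -> 0 < facet_rate K r finset.set0 v ->
    Jm.+1%:R * dot alpha (toR R v) < `|alpha ord0 i|.
  by move=> vV r0; rewrite ltNge; apply/negP => le; apply: nex; exists v.
(* vm bounds the coordinates of a jump; the starting point lies B deep *)
pose vm : nat := \sum_(v <- V) \sum_j `|v ord0 j|%N.
have vmP v j : v \in V -> (`|v ord0 j| <= vm)%N.
  move=> vV; rewrite /vm (big_fsetD1 v vV) /= (bigD1 j) //= -addnA leq_addr //.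
pose B : nat := (Jm.+1 * vm).+1.
pose x : 'rV[int]_N := const_mx B%:Z.
pose s : int := if 0 <= alpha ord0 i then 1 else -1.
pose y := x + s *: delta_mx ord0 i.
have xK : lattice K x by move=> j _; rewrite mxE.
have yK : lattice K y.
  move=> j jK; rewrite !mxE /s /B; case: ifP => _; case: (_ && _); lia.
have [J [p [J_le [p0 pJ] pl pr]]] := hK0 _ _ xK yK.
have xy : enorm (toR R (x - y)) = 1.
  rewrite /y opprD addNKr toRN enormN /enorm /dot (bigD1 i) //= big1; last first.
    by move=> j ji; rewrite !mxE (negbTE ji) andbF mulr0 mulr0.
  by rewrite !mxE !eqxx /= mulr1 addr0 /s; case: ifP; rewrite ?mulrNN ?mulr1 sqrtr1.
rewrite xy mulr1 in J_le.
have JJm : (J <= Jm)%N.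
  by rewrite /Jm truncn_ge_nat // (le_trans _ J_le).
have stepV j : (j < J)%N -> p j.+1 - p j \in V.
  by move=> jJ; apply: positive_rate (pr j jJ); apply: pl; exact: ltnW.
have far j l : (j <= J)%N -> ((B - j * vm)%N%:Z <= p j ord0 l).
  elim: j => [_|j ih jJ]; first by rewrite p0 mxE mul0n subn0.
  have step (m a b : nat) (u w : int) : (m + a <= b)%N -> (`|w - u| <= m)%N ->
      ((m + b).+1 - a)%N%:Z <= u -> ((m + b).+1 - (m + a))%N%:Z <= w by lia.
  rewrite /B !mulSn; apply: step (ih (ltnW jJ)).
    by rewrite -mulSn leq_mul2r (leq_trans jJ JJm) orbT.
  by have := vmP _ l (stepV j jJ); rewrite !mxE.
have interior j : (j < J)%N -> 0 < facet_rate K r finset.set0 (p j.+1 - p j).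
  move=> jJ; have pjK := pl j (ltnW jJ).
  rewrite -(_ : zset K (p j) = finset.set0) -/(rt K r (p j) _) -?(rtE hhom) ?pr //.
  apply/setP => l; rewrite !inE; apply/negbTE; rewrite negb_and orbC.
  have := far j l (ltnW jJ).
  have : (j * vm <= Jm * vm)%N by rewrite leq_mul2r (leq_trans (ltnW jJ) JJm) orbT.
  rewrite /B mulSn; move: (j * vm)%N (Jm * vm)%N => a b ab; lia.
have J0 : (0 < J)%N.
  case: J {J_le pl pr JJm stepV far interior} pJ => // pJ.
  move: pJ; rewrite p0 /y => /esym/eqP; rewrite -subr_eq0 addrAC subrr add0r.
  move=> /eqP/matrixP/(_ ord0 i); rewrite !mxE !eqxx /s; by case: ifP.
have sumE : `|alpha ord0 i| = \sum_(j < J) dot alpha (toR R (p j.+1 - p j)).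
  rewrite -dot_sumr.
  have -> : \sum_(j < J) toR R (p j.+1 - p j) = toR R (y - x).
    rewrite -p0 -pJ -(telescope_sumr p (leq0n J)) big_mkord.
    by elim/big_rec2: _ => [|j a b _ ->]; rewrite ?toR0 ?toRD.
  rewrite /y addrC addKr /dot (bigD1 i) //= big1 ?addr0; last first.
    by move=> j ji; rewrite !mxE (negbTE ji) andbF mulr0 mulr0.
  rewrite !mxE !eqxx /= mulr1 /s; case: ifP => a0; first by rewrite mulr1 ger0_norm.
  by rewrite ltr0_norm ?mulrN1 // ltNge a0.
have : Jm.+1%:R * `|alpha ord0 i| < J%:R * `|alpha ord0 i|.
  rewrite (_ : J%:R * _ = \sum_(j < J) `|alpha ord0 i|); last first.
    by rewrite sumr_const card_ord mulr_natl.
  rewrite {1}sumE mulr_sumr.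
  apply: ltr_sum => [|j _]; first by apply/hasP; exists (Ordinal J0); rewrite ?mem_index_enum.
  by apply: small; [exact: stepV|exact: interior].
rewrite ltNge ler_wpM2r ?normr_ge0 // ler_nat; exact: leqW.
Qed.

End communication.

(** * Duality *)

Section continuity.
Variables (R : realType) (N : nat) (T : topologicalType).

Lemma continuous_sum (I : Type) (s : seq I) (p : pred I) (F : I -> T -> R) :
  (forall i, continuous (F i)) -> continuous (fun x => \sum_(i <- s | p i) F i x).
Proof. by move=> cF; apply: continuous_big => //; exact: add_continuous. Qed.

Lemma continuous_mul (f g : T -> R) : continuous f -> continuous g ->
  continuous (fun x => f x * g x).
Proof. by move=> cf cg x; exact: cvgM (cf x) (cg x). Qed.

Lemma continuous_add (f g : T -> R) : continuous f -> continuous g ->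
  continuous (fun x => f x + g x).
Proof. by move=> cf cg x; exact: cvgD (cf x) (cg x). Qed.

Lemma continuous_abs (f : T -> R) : continuous f -> continuous (fun x => `|f x|).
Proof. by move=> cf x; apply: (@cvg_norm _ R); exact: cf. Qed.

Lemma continuous_const (c : R) : continuous (fun _ : T => c).
Proof. by move=> x; exact: cvg_cst. Qed.

Lemma continuous_exp (f : T -> R) : continuous f -> continuous (fun x => expR (f x)).
Proof. by move=> cf x; apply: continuous_comp; [exact: cf|exact: continuous_expR]. Qed.

Lemma continuous_dot (a : T -> 'rV[R]_N) (b : 'rV[R]_N) :
  (forall j, continuous (fun x => a x ord0 j)) -> continuous (fun x => dot (a x) b).
Proof.
by move=> ca; apply: continuous_sum => j; apply: continuous_mul => //;
  exact: continuous_const.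
Qed.

End continuity.

Section duality.
Variables (R : realType) (N : nat) (hN : (0 < N)%N) (K : {set 'I_N}).
Variables (V : {fset 'rV[int]_N}) (r : 'rV[int]_N -> 'rV[int]_N -> R).
Hypothesis hr : jump_rates K r.
Variable J : nat.
Hypothesis J0 : (0 < J)%N.
Hypothesis hspan : forall (alpha : 'rV[R]_N) i, exists v,
  [/\ v \in V, 0 < facet_rate K r finset.set0 v &
      `|alpha ord0 i| <= J%:R * dot alpha (toR R v)].
Variable beta : 'rV[R]_N.
Variable k : R.
Hypothesis k1 : 1 <= k.

Local Notation hamI := (ham K V r).
Local Notation fr := (facet_rate K r).

Let k0 : 0 < k. Proof. exact: lt_le_trans k1. Qed.

Definition excess I alpha : R := hamI I alpha - dot alpha beta.

Definition excess_grad I alpha : 'rV[R]_N :=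
  \sum_(v <- V) (fr I v * expR (dot alpha (toR R v))) *: toR R v - beta.

(** A smooth proxy for the exponential of k times the largest excess. *)
Definition softmax alpha : R :=
  \sum_(I : {set 'I_N} | I \subset K) expR (k * excess I alpha).

Definition softmax_grad alpha : 'rV[R]_N :=
  \sum_(I : {set 'I_N} | I \subset K)
     expR (k * excess I alpha) *: excess_grad I alpha.

Lemma expR_tangent (x y : R) : expR x * (1 + (y - x)) <= expR y.
Proof.
rewrite -[X in _ <= expR X](subrK x) [X in _ <= expR X]addrC expRD.
by rewrite ler_wpM2l ?expR_ge0 // expR_ge1Dx.
Qed.

Lemma excess_tangent I a b :
  excess I a + dot (b - a) (excess_grad I a) <= excess I b.
Proof.
rewrite /excess /excess_grad dotBr dot_sumr.
have -> : dot (b - a) beta = dot b beta - dot a beta by rewrite dotDl dotNl.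
suff : hamI I a + \sum_(v <- V) dot (b - a) ((fr I v * expR (dot a (toR R v))) *: toR R v)
    <= hamI I b by lra.
rewrite /hamI -big_split /=; apply: ler_sum => v _.
rewrite dotZr -mulrA -mulrDr ler_wpM2l ?(facet_rate_ge0 hr) //.
have := expR_tangent (dot a (toR R v)) (dot b (toR R v)).
by rewrite dotDl dotNl; lra.
Qed.

Lemma softmax_tangent a b :
  softmax a + k * dot (b - a) (softmax_grad a) <= softmax b.
Proof.
rewrite /softmax_grad dot_sumr mulr_sumr /softmax -big_split /=.
apply: ler_sum => I _; rewrite dotZr.
apply: le_trans (expR_tangent (k * excess I a) _).
have := excess_tangent I a b; rewrite -(ler_pM2l k0) => le.
set E := expR _; have E0 : 0 <= E by exact: expR_ge0.
have -> : E + k * (E * dot (b - a) (excess_grad I a)) =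
  E * (1 + k * dot (b - a) (excess_grad I a)) by ring.
rewrite ler_wpM2l //; lra.
Qed.

Lemma continuous_excess (T : topologicalType) (a : T -> 'rV[R]_N) I :
  (forall j, continuous (fun x => a x ord0 j)) ->
  continuous (fun x => excess I (a x)).
Proof.
move=> ca; rewrite /excess; under eq_fun do rewrite -mulN1r.
apply: continuous_add; last first.
  by apply: continuous_mul; [exact: continuous_const|exact: continuous_dot].
apply: continuous_sum => v; apply: continuous_mul; first exact: continuous_const.
apply: continuous_add; last exact: continuous_const.
by apply: continuous_exp; exact: continuous_dot.
Qed.

Lemma continuous_softmax (T : topologicalType) (a : T -> 'rV[R]_N) :
  (forall j, continuous (fun x => a x ord0 j)) ->
  continuous (fun x => softmax (a x)).
Proof.
move=> ca; apply: continuous_sum => I; apply: continuous_exp.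
by apply: continuous_mul; [exact: continuous_const|exact: continuous_excess].
Qed.

Lemma continuous_softmax_grad (T : topologicalType) (a : T -> 'rV[R]_N) b :
  (forall j, continuous (fun x => a x ord0 j)) ->
  continuous (fun x => dot b (softmax_grad (a x))).
Proof.
move=> ca; under eq_fun do rewrite dot_sumr.
apply: continuous_sum => I; under eq_fun do rewrite dotZr dotBr dot_sumr.
apply: continuous_mul.
  apply: continuous_exp.
  by apply: continuous_mul; [exact: continuous_const|exact: continuous_excess].
apply: continuous_add; last exact: continuous_const.
apply: continuous_sum => v; under eq_fun do rewrite dotZr.
apply: continuous_mul; last exact: continuous_const.
apply: continuous_mul; first exact: continuous_const.
by apply: continuous_exp; exact: continuous_dot.
Qed.

Lemma expR_ge_sqr (x : R) : 0 <= x -> x ^+ 2 / 4 <= expR x.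
Proof.
move=> x0; have -> : expR x = expR (x / 2) ^+ 2.
  by rewrite -expRM_natl; congr expR; field.
have := expR_ge1Dx (x / 2); have := expR_ge0 (x / 2); nra.
Qed.

(** The jumps in the interior alone make the excess grow at infinity. *)
Lemma excess_coercive (M : R) : exists2 s : R, 0 <= s &
  forall alpha : 'rV[R]_N, (exists i, s < `|alpha ord0 i|) -> M <= excess finset.set0 alpha.
Proof.
pose i0 := Ordinal hN.
(* q is a positive lower bound for the positive interior rates *)
pose q : R := (1 + \sum_(v <- V) (fr finset.set0 v)^-1)^-1.
have S0 : 0 <= \sum_(v <- V) (fr finset.set0 v)^-1.
  by apply: sumr_ge0 => v _; rewrite invr_ge0 (facet_rate_ge0 hr).
have q0 : 0 < q by rewrite invr_gt0 ltr_wpDr.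
have qP v : v \in V -> 0 < fr finset.set0 v -> q <= fr finset.set0 v.
  move=> vV r0; rewrite invf_ple ?posrE ?ltr_wpDr //.
  rewrite (big_fsetD1 v vV) /= addrCA lerDl addr_ge0 //.
  by apply: sumr_ge0 => w _; rewrite invr_ge0 (facet_rate_ge0 hr).
pose A := q / (4 * J%:R ^+ 2).
have Jp : 0 < J%:R :> R by rewrite ltr0n.
have A0 : 0 < A by rewrite divr_gt0 // mulr_gt0 // exprn_gt0.
pose b := \sum_j `|beta ord0 j|.
have b0 : 0 <= b by exact: sumr_ge0.
pose l := lamI K V r finset.set0.
have l0 : 0 <= l by apply: sumr_ge0 => v _; exact: (facet_rate_ge0 hr).
pose s := 1 + (b + l + `|M|) / A.
have s0 : 1 <= s by rewrite lerDl divr_ge0 ?addr_ge0 // ltW.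
exists s => [|alpha [j sj]]; first by rewrite (le_trans _ s0).
pose i := [arg max_(i > i0) `|alpha ord0 i|]%O.
have iP j' : `|alpha ord0 j'| <= `|alpha ord0 i|.
  by rewrite /i; case: arg_maxP => // i' _; exact.
set t := `|alpha ord0 i|.
have st : s < t by exact: lt_le_trans (iP j).
have [v [vV rv vt]] := hspan alpha i; rewrite -/t in vt.
have t0 : 0 <= t by exact: normr_ge0.
have dot_le : dot alpha beta <= b * t.
  rewrite /dot /b mulr_suml; apply: ler_sum => j' _.
  rewrite (le_trans (ler_norm _)) // normrM mulrC ler_wpM2l //.
have ham_ge : A * t ^+ 2 - l <= hamI finset.set0 alpha.
  have -> : hamI finset.set0 alpha =
      \sum_(w <- V) fr finset.set0 w * expR (dot alpha (toR R w)) - l.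
    by rewrite /ham -sumrB; apply: eq_bigr => w _; rewrite mulrBr mulr1.
  rewrite lerD2r (big_fsetD1 v vV) /= ler_wpDr //.
    by apply: sumr_ge0 => w _; rewrite mulr_ge0 ?expR_ge0 // (facet_rate_ge0 hr).
  have tJ : t / J%:R <= dot alpha (toR R v) by rewrite ler_pdivrMr // mulrC.
  have tJ0 : 0 <= t / J%:R by rewrite divr_ge0 // ltW.
  apply: (@le_trans _ _ (q * expR (t / J%:R))).
    have := expR_ge_sqr tJ0; rewrite -(ler_pM2l q0); apply: le_trans.
    rewrite /A le_eqVlt; apply/orP; left; apply/eqP; field.
    by rewrite gt_eqF.
  by rewrite ler_pM ?expR_ge0 ?(ltW q0) // ?qP // ler_expR.
have At : b + l + `|M| <= A * t - A.
  rewrite -[X in _ - X]mulr1 -mulrBr mulrC -ler_pdivrMr //.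
  by rewrite lerBrDl; exact: ltW.
rewrite /excess.
have := ler_norm M.
have M0 : 0 <= `|M| by exact: normr_ge0.
have : 0 <= (t - 1) * (A * t - b).
  by apply: mulr_ge0; [have := le_lt_trans s0 st; lra|clear -At l0 M0 A0; lra].
rewrite (_ : (t - 1) * _ = A * t ^+ 2 - b * t - A * t + b); last by ring.
clear -dot_le ham_ge At A0; lra.
Qed.

(** Outside of a large cube the interior summand alone exceeds the value at
    0. *)
Lemma softmax_min : exists a, forall b, softmax a <= softmax b.
Proof.
have [s s0 hs] := excess_coercive (softmax 0).
pose box := [set a : 'rV[R]_N | forall i, `[- s, s]%classic (a ord0 i)].
have box0 : box 0 by move=> i /=; rewrite in_itv /= mxE oppr_le0 s0.
have cbox : compact box.
  by apply: (@rV_compact R N (fun=> `[- s, s]%classic)) => i; exact: segment_compact.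
have csm : {within box, continuous softmax}.
  apply: continuous_subspaceT; apply: continuous_softmax => j.
  exact: coord_continuous.
have [a _ amin] := EVT_min_rV (ex_intro _ _ box0) cbox csm.
exists a => b; have [bbox|nb] := pselect (box b); first by apply: amin; rewrite inE.
apply: (@le_trans _ _ (softmax 0)); first by apply: amin; rewrite inE.
have /hs le : exists i, s < `|b ord0 i|.
  apply: contrapT => nex; apply: nb => i /=; rewrite in_itv /= -ler_norml leNgt.
  by apply/negP => lt; apply: nex; exists i.
have s00 : 0 <= softmax 0 by apply: sumr_ge0 => I _; exact: expR_ge0.
rewrite [X in _ <= X]/softmax (bigD1 finset.set0) ?finset.sub0set //=.
apply: ler_wpDr; first by apply: sumr_ge0 => I _; exact: expR_ge0.
have := expR_ge1Dx (k * excess finset.set0 b).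
have : excess finset.set0 b <= k * excess finset.set0 b.
  by rewrite ler_peMl // (le_trans s00).
lra.
Qed.

(** At a minimiser a, the tangent inequality at the nearby points a - t D, with
    D the gradient at a, gives (D, gradient at a - t D) <= 0 for t > 0. *)
Lemma softmax_critical : exists a, softmax_grad a = 0.
Proof.
have [a amin] := softmax_min; exists a.
pose D := softmax_grad a.
pose f t := dot D (softmax_grad (a - t *: D)).
have f_le t : 0 < t -> f t <= 0.
  move=> t0; have := softmax_tangent (a - t *: D) a.
  have := amin (a - t *: D); rewrite opprB addrCA subrr addr0 dotZl -/(f t) => h1 h2.
  have : k * (t * f t) <= 0 by lra.
  by rewrite pmulr_rle0 // pmulr_rle0.
have cf : continuous f.
  apply: (@continuous_softmax_grad R (fun t : R => a - t *: D) D) => j.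
  under eq_fun do rewrite !mxE -mulNr -mulN1r -mulrA.
  apply: continuous_add; first exact: continuous_const.
  apply: continuous_mul; first exact: continuous_const.
  apply: continuous_mul; last exact: continuous_const.
  by move=> x; exact: cvg_id.
have : f 0 <= 0.
  have cf0 : f x @[x --> 0^'+] --> f 0 by apply: cvg_at_right_filter; exact: cf.
  apply: (@cvgr_to_le R (0^'+) _ R f _ _ cf0); near=> t; apply: f_le; near: t; exact: nbhs_right_gt.
rewrite /f scale0r subr0 -/D -sqr_enorm => D0.
apply/eqP; rewrite -enorm_eq0 -sqrf_eq0 eq_le D0; exact: sqr_ge0.
Unshelve. all: by end_near. Qed.

Definition ellr (a : R) : R := a * ln a - a + 1.

Lemma cost_fin (rbar c : 'rV[int]_N -> R) : (forall v, v \in V -> 0 <= c v) ->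
  (\sum_(v <- V) (rbar v)%:E * ell (c v))%E = (\sum_(v <- V) rbar v * ellr (c v))%:E.
Proof.
move=> c0; rewrite -sumEFin; apply: eq_big_seq => v vV.
by rewrite /ell ltNge c0 // -EFinM.
Qed.

(** The critical equation says that the normalised weights and the tilts
    exp (a, v) form an admissible system; its cost is (a, beta) minus a weighted
    mean of the hamI I a, which is close to their maximum when k is large. *)
Lemma dual_system : exists alpha Lam0 rho rbar c,
  [/\ admissible K V r rho rbar c beta, (forall I, hamI I alpha <= Lam0) &
      \sum_(v <- V) rbar v * ellr (c v) <=
        dot alpha beta - Lam0 + #|{: {set 'I_N}}|%:R / k].
Proof.
have [a Da] := softmax_critical; exists a.
pose Im := [arg max_(I > finset.set0 | I \subset K) hamI I a]%O.
have [ImK ImP] : Im \subset K /\ forall I : {set 'I_N}, I \subset K -> hamI I a <= hamI Im a.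
  by rewrite /Im; case: arg_maxP; rewrite ?finset.sub0set // => I IK IP; split.
pose E I := expR (k * excess I a).
pose S := softmax a.
have ES : E Im <= S.
  rewrite /S /softmax (bigD1 Im) //=; apply: ler_wpDr => //.
  by apply: sumr_ge0 => I _; exact: expR_ge0.
have S0 : 0 < S by apply: lt_le_trans ES; exact: expR_gt0.
pose rho I := E I / S.
pose rbar v := \sum_(I : {set 'I_N} | I \subset K) rho I * fr I v.
pose c (v : 'rV[int]_N) := expR (dot a (toR R v)).
have rho1 : \sum_(I : {set 'I_N} | I \subset K) rho I = 1.
  by rewrite -mulr_suml divff // gt_eqF.
have rho0 I : 0 <= rho I by rewrite divr_ge0 ?expR_ge0 // ltW.
have betaE : \sum_(v <- V) (rbar v * c v) *: toR R v = beta.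
  have : S^-1 *: softmax_grad a = 0 by rewrite Da scaler0.
  rewrite /softmax_grad scaler_sumr /excess_grad.
  under eq_bigr do rewrite scalerA mulrC -/(rho _) scalerBr.
  rewrite sumrB -scaler_suml rho1 scale1r => /eqP; rewrite subr_eq0 => /eqP <-.
  under [RHS]eq_bigr do rewrite scaler_sumr.
  rewrite exchange_big /=; apply: eq_bigr => v _.
  rewrite /rbar mulr_suml scaler_suml; apply: eq_bigr => I _.
  by rewrite scalerA mulrA.
exists (hamI Im a), rho, rbar, c; split.
- by split=> // v _; exact: expR_ge0.
- move=> I; rewrite (_ : hamI I a = hamI (I :&: K) a); last first.
    by apply: eq_bigr => v _; rewrite facet_rateI.
  by apply: ImP; exact: finset.subsetIr.
have costE : \sum_(v <- V) rbar v * ellr (c v) = dot a beta -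
    \sum_(I : {set 'I_N} | I \subset K) rho I * hamI I a.
  rewrite -[in RHS]betaE dot_sumr.
  have -> : \sum_(I : {set 'I_N} | I \subset K) rho I * hamI I a =
      \sum_(v <- V) rbar v * (c v - 1).
    under eq_bigr do rewrite mulr_sumr.
    rewrite exchange_big /=; apply: eq_bigr => v _.
    by rewrite mulr_suml; apply: eq_bigr => I _; rewrite mulrA.
  rewrite -sumrB; apply: eq_bigr => v _.
  by rewrite /ellr /c expRK dotZr; ring.
have -> : \sum_(v <- V) rbar v * ellr (c v) = dot a beta - hamI Im a +
    \sum_(I : {set 'I_N} | I \subset K) rho I * (hamI Im a - hamI I a).
  under [X in _ + X]eq_bigr do rewrite mulrBr.
  rewrite costE sumrB -mulr_suml rho1 mul1r; ring.
rewrite lerD2l.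
apply: (@le_trans _ _ (\sum_(I : {set 'I_N} | I \subset K) k^-1)); last first.
  rewrite sumr_const -[leLHS]mulr_natl ler_wpM2r ?invr_ge0 ?(ltW k0) //.
  by rewrite ler_nat; exact: max_card.
apply: ler_sum => I IK; set D := hamI Im a - hamI I a.
have D0 : 0 <= D by rewrite subr_ge0; exact: ImP.
have EI : E I = E Im * expR (- (k * D)).
  by rewrite /E -expRD; congr expR; rewrite /excess /D; ring.
have kD : k * D * expR (- (k * D)) <= 1.
  rewrite expRN ler_pdivrMr ?expR_gt0 // mul1r.
  by apply: le_trans (expR_ge1Dx _); rewrite lerDr.
rewrite -(ler_pM2l k0) divff ?gt_eqF //.
have -> : k * (rho I * D) = (k * D * expR (- (k * D))) * (E Im / S).
  by rewrite /rho EI; ring.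
rewrite mulr_ile1 // ?mulr_ge0 ?expR_ge0 ?(ltW k0) ?invr_ge0 ?(ltW S0) //.
by rewrite ler_pdivrMr // mul1r.
Qed.

End duality.

(** * Purely atomic measures *)

Section atoms.
Variables (R : realType) (M : nat) (a : nat -> R) (a0 : forall i, 0 <= a i).
Variable s : nat -> R.

Definition atom (i : nat) : {measure set (measurableTypeR R) -> \bar R} :=
  mscale (NngNum (a0 i)) (dirac (s i : measurableTypeR R)).

Definition atoms := msum atom M.

HB.instance Definition _ := Measure.on atoms.

Lemma atomsE (A : set (measurableTypeR R)) :
  atoms A = (\sum_(i < M) a i * \1_A (s i))%:E.
Proof.
by rewrite /atoms /msum -sumEFin; apply: eq_bigr.
Qed.

Let atoms_finite : fin_num_fun atoms.
Proof. by move=> A mA; rewrite atomsE. Qed.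

HB.instance Definition _ := Measure_isFinite.Build _ _ _ atoms atoms_finite.

Lemma ge0_integral_atoms (D : set (measurableTypeR R)) (f : measurableTypeR R -> \bar R) :
  measurable D -> measurable_fun D f -> (forall x, D x -> (0 <= f x)%E) ->
  (\int[atoms]_(x in D) f x = \sum_(i < M) (a i * \1_D (s i))%:E * f (s i))%E.
Proof.
move=> mD mf f0; rewrite ge0_integral_measure_sum //.
apply: eq_bigr => i _; rewrite ge0_integral_mscale // integral_dirac //.
by rewrite muleA EFinM.
Qed.

Lemma integral_atoms (D : set (measurableTypeR R)) (f : measurableTypeR R -> R) :
  measurable D -> measurable_fun D f ->
  (\int[atoms]_(x in D) (f x)%:E = (\sum_(i < M) a i * \1_D (s i) * f (s i))%:E)%E.
Proof.
move=> mD mf; have mfE : measurable_fun D (fun x => (f x)%:E).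
  exact/measurable_EFinP.
rewrite integralE !ge0_integral_atoms //; [|exact: measurable_funeneg|exact: measurable_funepos].
have -> : (\sum_(i < M) (a i * \1_D (s i))%:E * (fun x => (f x)%:E)^\+%E (s i) =
    (\sum_(i < M) a i * \1_D (s i) * Num.max (f (s i)) 0)%:E)%E.
  by rewrite -sumEFin; apply: eq_bigr => i _; rewrite EFinM funeposE -EFin_max.
have -> : (\sum_(i < M) (a i * \1_D (s i))%:E * (fun x => (f x)%:E)^\-%E (s i) =
    (\sum_(i < M) a i * \1_D (s i) * Num.max (- f (s i)) 0)%:E)%E.
  by rewrite -sumEFin; apply: eq_bigr => i _; rewrite EFinM funenegE -EFin_max.
rewrite -EFinB -sumrB; congr _%:E; apply: eq_bigr => i _; rewrite -mulrBr; congr (_ * _).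
have [h|h] := leP 0 (f (s i)).
  by rewrite max_r ?oppr_le0 // subr0.
by rewrite max_l ?oppr_ge0 ?(ltW h) // sub0r opprK.
Qed.

End atoms.

(** * Step paths *)

Section step.
Variables (R : realType) (M : nat) (M0 : (0 < M)%N).

(** The number of grid points i / M, 1 <= i <= M, up to time t. *)
Definition idx (t : R) : nat := minn M (Num.truncn (t * M%:R)).

Let Mp : 0 < M%:R :> R. Proof. by rewrite ltr0n. Qed.

Lemma idx_ge (t : R) i : (0 < i <= M)%N -> (i <= idx t)%N = (i%:R / M%:R <= t).
Proof.
move=> /andP[i0 iM]; rewrite /idx leq_min iM /= ler_pdivrMr //.
by case: i i0 iM => // i _ _; rewrite truncn_gt_nat.
Qed.

Lemma idx_le_mono (t u : R) : t <= u -> (idx t <= idx u)%N.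
Proof.
move=> tu; have [->//|it] := posnP (idx t).
have h : (0 < idx t <= M)%N by rewrite it geq_minl.
by rewrite idx_ge // (le_trans _ tu) // -idx_ge.
Qed.

Lemma idx_M (t : R) : (idx t <= M)%N. Proof. exact: geq_minl. Qed.

Lemma idx_grid l : (l <= M)%N -> idx (l%:R / M%:R) = l.
Proof.
by move=> lM; rewrite /idx divfK ?gt_eqF // natrK; exact/minn_idPr.
Qed.

Lemma idx0 : idx 0 = 0%N.
Proof. by have := idx_grid (leq0n M); rewrite mul0r. Qed.

Lemma idx_eq (t : R) l : (l < M)%N -> l%:R / M%:R <= t < l.+1%:R / M%:R -> idx t = l.
Proof.
move=> lM /andP[lt tl]; apply/eqP; rewrite eqn_leq; apply/andP; split.
  by rewrite leqNgt idx_ge // -ltNge.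
by case: l lM lt tl => // l lM lt _; rewrite idx_ge // (ltnW lM).
Qed.

Lemma measurable_idx (Q : nat -> Prop) :
  measurable ([set u | Q (idx u)] : set (measurableTypeR R)).
Proof.
have mge l : measurable ([set u | (l <= idx u)%N] : set (measurableTypeR R)).
  case: l => [|l].
    by rewrite (_ : [set u | _] = setT) //; apply/seteqP; split.
  have [lM|Ml] := ltnP l M.
    rewrite (_ : [set u | _] = `[l.+1%:R / M%:R, +oo[%classic) //.
    by apply/seteqP; split=> u /=; rewrite in_itv /= andbT idx_ge.
  rewrite (_ : [set u | _] = set0) //; apply/seteqP; split=> // u /=.
  by move=> /leq_trans/(_ (idx_M u)); rewrite ltnNge Ml.
have -> : [set u | Q (idx u)] = \bigcup_(l in [set l | Q l])
    ([set u | (l <= idx u)%N] `\` [set u | (l.+1 <= idx u)%N]).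
  apply/seteqP; split=> u /=.
    by move=> Qu; exists (idx u) => //; split=> /=; [exact: leqnn|rewrite ltnn].
  move=> [l /= Ql [h1 /negP]]; rewrite -leqNgt => h2.
  by rewrite (_ : idx u = l) //; apply/eqP; rewrite eqn_leq h1 h2.
by apply: bigcup_measurable => l _; apply: measurableD.
Qed.

Variables (N : nat) (y : nat -> 'rV[R]_N).

Definition step (t : R) : 'rV[R]_N := y (idx t).

Lemma cadlag_step : cadlag01 step.
Proof.
split=> t /andP[t0 t1].
  pose l := idx t.
  have lM : (l < M)%N.
    by rewrite ltnNge; apply/negP => Ml; move: t1; rewrite ltNge => /negP; apply;
      rewrite -[leLHS](@divff _ M%:R) ?gt_eqF // -idx_ge ?M0 ?leqnn.
  have tl : t < l.+1%:R / M%:R by rewrite ltNge -idx_ge // ltnn.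
  apply: (@cvg_trans _ ((fun=> step t) @ t^'+)); last exact: cvg_cst.
  apply: near_eq_cvg; near=> u; rewrite /step (@idx_eq u l) //.
  have tu : t < u by near: u; exact: nbhs_right_gt.
  have -> : u < l.+1%:R / M%:R by near: u; exact: nbhs_right_lt.
  rewrite andbT (le_trans _ (ltW tu)) //.
  have [->|lp] := posnP l; first by rewrite mul0r.
  by rewrite -idx_ge // lp ltnW.
have ex : exists l, t <= l%:R / M%:R.
  by exists M; rewrite divff // gt_eqF.
have [] := ex_minnP ex => -[|l] tl lmin; first by move: tl; rewrite mul0r leNgt t0.
have lt : l%:R / M%:R < t.
  by rewrite ltNge; apply/negP => /lmin; rewrite ltnn.
have lM : (l < M)%N by apply: lmin; rewrite divff // gt_eqF.
apply/cvg_ex; exists (y l).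
apply: (@cvg_trans _ ((fun=> y l) @ t^'-)); last exact: cvg_cst.
apply: near_eq_cvg; near=> u; rewrite /step (@idx_eq u l) //.
have ut : u < t by near: u; exact: nbhs_left_lt.
rewrite (lt_le_trans ut) // andbT; near: u; exact: nbhs_left_ge.
Unshelve. all: by end_near. Qed.

(** The partial sums of b dominate the increments of the path, and they
    telescope along every partition. *)
Lemma step_variation_le (b : nat -> R) (t : R) : 0 <= t ->
  (forall i, (i < M)%N -> enorm (y i.+1 - y i) <= b i) ->
  (etotal_variation 0 t step <= (\sum_(i < idx t) b i)%:E)%E.
Proof.
move=> t0 yb; apply: ge_ereal_sup => _ [s [ps /eqP ls] <-]; rewrite lee_fin.
pose B (u : R) := \sum_(0 <= i < idx u) b i.
have stepB (u v : R) : u <= v -> enorm (step v - step u) <= B v - B u.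
  move=> uv; have iuv := idx_le_mono uv.
  rewrite /B (big_cat_nat (leq0n _) iuv) /= [leRHS]addrC addKr /step.
  rewrite -(telescope_sumr y iuv).
  rewrite (le_trans (enorm_sum _ _ _)) //.
  apply: ler_sum_nat => i /andP[_ iv]; apply: yb.
  exact: leq_trans (idx_M v).
rewrite /evariation; set F := nth t (0 :: s).
apply: (@le_trans _ _ (\sum_(0 <= i < size s) (B (F i.+1) - B (F i)))).
  apply: ler_sum_nat => i /andP[_ is_].
  apply: stepB; rewrite ltW //.
  by have /(pathP t)/(_ i is_) := ps.
rewrite (telescope_sumr (B \o F)) //= -(big_mkord xpredT) -/(B t).
have -> : F (size s) = t by rewrite /F -[size s]/(size (0 :: s)).-1 nth_last.
rewrite gerBl // /B.
by rewrite idx0 big_geq.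
Qed.

(** The partition by the grid points up to t sees every jump separately. *)
Lemma step_variation_ge (b : nat -> R) (t : R) : 0 <= t ->
  (forall i, (i < M)%N -> enorm (y i.+1 - y i) = b i) ->
  ((\sum_(i < idx t) b i)%:E <= etotal_variation 0 t step)%E.
Proof.
move=> t0 yb.
have evar_rcons (s : seq R) (u v : R) : last 0 s = u ->
    evariation 0 v step (rcons s v) = evariation 0 u step s + enorm (step v - step u).
  move=> su; rewrite /evariation size_rcons big_nat_recr //=; congr (_ + _).
    apply: eq_big_nat => i /andP[_ is_].
    rewrite /= nth_rcons is_ -rcons_cons nth_rcons /= ltnS ltnW //.
    by rewrite (set_nth_default u) // (set_nth_default u v) //= ltnS ltnW.
  rewrite nth_rcons ltnn eqxx -rcons_cons nth_rcons /= ltnSn -su.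
  by congr (enorm (_ - step _)); rewrite -[RHS](nth_last v (0 :: s)).
have grid l : (l <= M)%N -> exists s, itv_partition 0 (l%:R / M%:R) s /\
    evariation 0 (l%:R / M%:R) step s = \sum_(i < l) b i.
  elim: l => [_|l ih lM].
    exists [::]; split; first by split; rewrite //= mul0r.
    by rewrite /evariation big_geq // big_ord0.
  have [s [[ps /eqP ls] vs]] := ih (ltnW lM).
  exists (rcons s (l.+1%:R / M%:R)); split.
    split; last by rewrite last_rcons.
    by rewrite rcons_path ps ls /= ltr_pM2r ?invr_gt0 // ltr_nat.
  rewrite (evar_rcons _ _ _ ls) vs big_ord_recr /=; congr (_ + _).
  by rewrite /step !idx_grid // ?yb // ltnW.
have [s [[ps /eqP ls] vs]] := grid _ (idx_M t).
have : (idx t)%:R / M%:R <= t.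
  have [->|it] := posnP (idx t); first by rewrite mul0r.
  by rewrite -idx_ge // it idx_M.
rewrite le_eqVlt => /predU1P[it|it].
  apply: ereal_sup_ubound; exists s; first by rewrite -it; split=> //; rewrite ls.
  by rewrite -vs it.
apply: (@le_trans _ _ (evariation 0 t step (rcons s t))%:E).
  by rewrite lee_fin (evar_rcons _ _ _ ls) vs lerDl enorm_ge0.
apply: ereal_sup_ubound; exists (rcons s t) => //.
split; last by rewrite last_rcons.
by rewrite rcons_path ps ls.
Qed.

End step.

(** * The Skorokhod problem for step paths *)

Section discrete_skorokhod.
Variables (R : realType) (N q : nat) (n d : 'I_q -> 'rV[R]_N).
Local Notation G := (polyhedron n).

(** A solution of the Skorokhod problem in discrete time: on its arrival at
    x (i + 1) the path is pushed by a i along g i. *)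
Definition reflected (M : nat) (x : nat -> 'rV[R]_N) (a : nat -> R)
    (g : nat -> 'rV[R]_N) : Prop :=
  (forall l, (l <= M)%N -> G (x l)) /\
  forall i, 0 <= a i /\
    (0 < a i -> (i < M)%N -> bd G (x i.+1) /\ directions n d (x i.+1) (g i)).

Definition pushed (a : nat -> R) (g : nat -> 'rV[R]_N) (l : nat) : 'rV[R]_N :=
  \sum_(i < l) a i *: g i.

Lemma pushedS a g l : pushed a g l.+1 = pushed a g l + a l *: g l.
Proof. by rewrite /pushed big_ord_recr. Qed.

Section one.
Variables (M : nat) (M0 : (0 < M)%N).
Variables (x : nat -> 'rV[R]_N) (a : nat -> R) (g : nat -> 'rV[R]_N).
Hypothesis xag : reflected M x a g.

Let e := pushed a g.
Let a0 i : 0 <= a i. Proof. by have [_ /(_ i)[]] := xag. Qed.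
Let s (i : nat) : R := i.+1%:R / M%:R.
Let mu := atoms M a0 s.
Let phi := step M x.
Let eta := step M e.
Let psi := step M (fun l => x l - e l).

Let pushed_step i : (i < M)%N -> enorm (e i.+1 - e i) = a i.
Proof.
move=> iM; rewrite /e pushedS addrC addKr enormZ ger0_norm //.
have := a0 i; rewrite le_eqVlt => /predU1P[<-|ap]; first by rewrite mul0r.
by have [_ /(_ i)[_ /(_ ap iM)[_ [-> _]]]] := xag; rewrite mulr1.
Qed.

Let s_idx (t : R) (i : nat) : (i < M)%N -> 0 <= t ->
  (\1_(`[0, t]%classic : set R) (s i) : R) = (i < idx M t)%N%:R.
Proof.
move=> iM t0; rewrite indicE mem_setE in_itv /= idx_ge //.
by rewrite (_ : 0 <= s i) // divr_ge0.
Qed.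

Let sum_idx (t : R) (F : nat -> R) : 0 <= t ->
  \sum_(i < M) a i * \1_(`[0, t]%classic : set R) (s i) * F i =
  \sum_(i < idx M t) a i * F i.
Proof.
move=> t0; rewrite (big_ord_widen M (fun i => a i * F i) (idx_M M t)) [RHS]big_mkcond /=.
apply: eq_bigr => i _; rewrite s_idx //.
by case: ifP => _; rewrite ?mulr1 // mulr0 mul0r.
Qed.

Let variation_eta (t : R) : 0 <= t ->
  etotal_variation 0 t eta = (\sum_(i < idx M t) a i)%:E.
Proof.
move=> t0; apply/eqP; rewrite eq_le step_variation_le ?step_variation_ge //.
by move=> i iM; rewrite -pushed_step.
Qed.

Let mu_itv (t : R) : 0 <= t -> mu `[0, t]%classic = etotal_variation 0 t eta.
Proof.
move=> t0; rewrite variation_eta // /mu atomsE; congr _%:E.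
have := sum_idx (fun=> 1) t0.
by under eq_bigr do rewrite mulr1; under [RHS]eq_bigr do rewrite mulr1.
Qed.

Let phi_s i : (i < M)%N -> phi (s i) = x i.+1.
Proof. by move=> iM; rewrite /phi /step /s idx_grid. Qed.

Let s_inj i j : s i = s j -> i = j.
Proof.
move/mulIf; rewrite invr_eq0 pnatr_eq0 -lt0n M0 => /(_ isT)/eqP.
by rewrite eqr_nat => /eqP[].
Qed.

Let gamma (u : R) : 'rV[R]_N := \sum_(i < M) (\1_([set s i] : set R) u) *: g i.

Let gamma_s i : (i < M)%N -> gamma (s i) = g i.
Proof.
move=> iM; rewrite /gamma (bigD1 (Ordinal iM)) //= indicE mem_set // scale1r.
rewrite big1 ?addr0 // => j ji; rewrite indicE memNset ?scale0r //=.
by move=> /s_inj ij; move: ji; rewrite -val_eqE /= ij eqxx.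
Qed.

Let measurable_gamma (D : set (measurableTypeR R)) j :
  measurable_fun D (fun u => gamma u ord0 j).
Proof.
apply: measurable_funTS.
have -> : (fun u => gamma u ord0 j) = (fun u => \sum_(i < M) \1_([set s i] : set R) u * g i ord0 j).
  by apply/funext => u; rewrite /gamma summxE; apply: eq_bigr => i _; rewrite mxE.
by apply: measurable_sum => i; apply: measurable_funM.
Qed.

(** The measure d|eta| has the atom a i at the grid point s i = (i + 1) / M,
    where phi has just taken the value x (i + 1): for this reason reflected
    asks for the directions at the new point. *)
Lemma step_solution : SP_solution n d psi phi eta.
Proof.
split; first by rewrite /phi /psi /step idx0 // /e /pushed big_ord0 subr0.
split.
  move=> t /andP[t0 t1]; split.
  - by rewrite /phi /psi /eta /step subrK.
  - by have [xG _] := xag; apply: xG; exact: idx_M.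
  - by rewrite variation_eta // ltry.
exists mu.
  move=> t /andP[t0 t1]; split; first exact: mu_itv.
  rewrite integral_atoms //; last first.
    apply: measurable_funTS; apply: measurable_indic.
    exact: (measurable_idx M0 (fun l => bd G (x l))).
  rewrite variation_eta //; congr _%:E.
  rewrite (sum_idx (fun i => \1_(phi @^-1` bd G) (s i)) t0).
  apply: eq_bigr => i _; have iM : (i < M)%N by rewrite (leq_trans (ltn_ord i)) // idx_M.
  have := a0 i; rewrite le_eqVlt => /predU1P[<-|ap]; first by rewrite mul0r.
  rewrite indicE mem_set ?mulr1 //= phi_s //.
  by have [_ /(_ i)[_ /(_ ap iM)[]]] := xag.
exists gamma; split.
- by move=> j; exact: measurable_gamma.
- exists (~` [set u | exists2 i, (i < M)%N & u = s i /\ 0 < a i]); split.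
  + apply: measurableC.
    rewrite (_ : [set u | _] = \bigcup_(i in [set i | (i < M)%N /\ 0 < a i]) [set s i]).
      by apply: bigcup_measurable => i _; exact: measurable_set1.
    apply/seteqP; split=> u /=; first by move=> [i iM [-> ap]]; exists i.
    by move=> [i [iM ap] ->]; exists i.
  + rewrite [LHS]atomsE big1 // => i _.
    have := a0 i; rewrite le_eqVlt => /predU1P[<-|ap]; first by rewrite mul0r.
    rewrite indicE memNset ?mulr0 //= => h; apply: h; exists i => //.
  + move=> u /= nd [i iM [us ap]]; apply: nd => _.
    rewrite us phi_s // gamma_s //.
    by have [_ /(_ i)[_ /(_ ap iM)[]]] := xag.
- move=> t j /andP[t0 t1]; rewrite integral_atoms //.
  rewrite (sum_idx (fun i => gamma (s i) ord0 j) t0) /eta /step /e /pushed summxE.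
  congr _%:E; apply: eq_bigr => i _.
  by rewrite gamma_s ?mxE // (leq_trans (ltn_ord i)) // idx_M.
Qed.

Lemma step_path_in : paths_in G psi.
Proof.
split; first exact: cadlag_step.
rewrite /psi /step idx0 // /e /pushed big_ord0 subr0.
by have [xG _] := xag; exact: xG.
Qed.

Lemma step_bounded_variation : (etotal_variation 0 1 psi < +oo)%E.
Proof.
apply: le_lt_trans (ltry _).
exact: (@step_variation_le _ _ M0 _ _ (fun i => enorm ((x i.+1 - e i.+1) - (x i - e i)))).
Qed.

End one.

(** A regular Skorokhod map is Lipschitz on discrete solutions: these are the
    values at grid points of solutions for step paths. *)
Lemma discrete_lipschitz : SM_regular n d -> exists2 C : R, 0 <= C &
  forall M x a g x' a' g' eps, (0 < M)%N ->
  reflected M x a g -> reflected M x' a' g' ->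
  (forall l, (l <= M)%N ->
    enorm ((x l - pushed a g l) - (x' l - pushed a' g' l)) <= eps) ->
  forall l, (l <= M)%N -> enorm (x l - x' l) <= C * eps.
Proof.
move=> [D [_ Dbv Dmap [K1 Klip]]]; exists (Num.max 0 K1).
  by rewrite le_max lexx.
move=> M x a g x' a' g' eps M0 xag xag' close l lM.
have solve y b f (yP : reflected M y b f) : exists phi,
    [/\ D (step M (fun l => y l - pushed b f l)),
        skorokhod_map n d (step M (fun l => y l - pushed b f l)) phi &
        forall t, 0 <= t <= 1 -> phi t = step M y t].
  have Dy := Dbv _ (step_path_in M0 yP) (step_bounded_variation M0 _ _ _).
  have [phi hphi] := Dmap _ Dy; exists phi; split=> // t t01.
  have [eta _ uniq] := hphi.
  by have [] := uniq _ _ (step_solution M0 yP) t t01.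
have [phi [D1 S1 E1]] := solve _ _ _ xag.
have [phi' [D2 S2 E2]] := solve _ _ _ xag'.
have eps0 : 0 <= eps by apply: le_trans (close 0%N (leq0n _)); exact: enorm_ge0.
have lM01 : 0 <= (l%:R / M%:R : R) <= 1.
  by rewrite divr_ge0 //= ler_pdivrMr ?ltr0n // mul1r ler_nat.
rewrite -lee_fin; apply: (@le_trans _ _ (esup_dist phi phi')).
  apply: ereal_sup_ubound; exists (l%:R / M%:R : R); first by rewrite /= in_itv.
  by rewrite E1 // E2 // /step idx_grid.
apply: le_trans (Klip _ _ _ _ D1 D2 S1 S2) _; rewrite EFinM.
set E := esup_dist _ _.
have up : (E <= eps%:E)%E.
  apply: ge_ereal_sup => _ [t _ <-]; rewrite lee_fin; apply: close.
  exact: idx_M.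
have lo : (0 <= E)%E.
  apply: le_trans (ereal_sup_ubound _); last first.
    by exists 0; [rewrite /= in_itv /= lexx ler01|reflexivity].
  by rewrite lee_fin enorm_ge0.
apply: (@le_trans _ _ ((Num.max 0 K1)%:E * E)%E).
  by rewrite lee_wpmul2r // lee_fin le_max lexx orbT.
by rewrite lee_wpmul2l // lee_fin le_max lexx.
Qed.

End discrete_skorokhod.

(** * The tilted law of the words *)

Section wsum.
Variables (R : realType) (N : nat) (V : {fset 'rV[int]_N}).

Fixpoint wsum (f : word N -> option 'rV[int]_N -> R) (w : word N) : R :=
  if w is a :: u then wsum f u + f u a else 0.

Lemma eq_wsum f g w : (forall u a, f u a = g u a) -> wsum f w = wsum g w.
Proof. by move=> fg; elim: w => //= a u ->; rewrite fg. Qed.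

Lemma wsumD f g w : wsum (fun u a => f u a + g u a) w = wsum f w + wsum g w.
Proof. by elim: w => /= [|a u ->]; rewrite ?addr0 // addrACA. Qed.

Lemma wsumZ (k : R) f w : wsum (fun u a => k * f u a) w = k * wsum f w.
Proof. by elim: w => /= [|a u ->]; rewrite ?mulr0 // mulrDr. Qed.

Lemma wsum_sum (I : Type) (s : seq I) (F : I -> word N -> option 'rV[int]_N -> R) w :
  wsum (fun u a => \sum_(i <- s) F i u a) w = \sum_(i <- s) wsum (F i) w.
Proof. by elim: w => /= [|a u ->]; [rewrite big1|rewrite big_split]. Qed.

Lemma wprod_exp f w : wprod (fun u a => expR (f u a)) w = expR (wsum f w).
Proof. by elim: w => /= [|a u ->]; rewrite ?expR0 // expRD. Qed.

Lemma expR_upper2 (x : R) : x <= 1 / 2 -> expR x <= 1 + x + 2 * x ^+ 2.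
Proof.
move=> x2; have x1 : 0 < 1 - x by lra.
have e1 : expR x <= (1 - x)^-1.
  rewrite -[x in expR x]opprK expRN lef_pV2 ?posrE ?expR_gt0 //.
  exact: expR_ge1Dx.
apply: le_trans e1 _; rewrite -[leLHS]mul1r ler_pdivrMr //.
rewrite (_ : _ * (1 - x) = 1 + x ^+ 2 * (1 - 2 * x)); last by ring.
by rewrite lerDl mulr_ge0 ?sqr_ge0 //; lra.
Qed.

(** Azuma's bound for a sum of bounded centred increments. *)
Lemma word_chernoff (q xi : word N -> option 'rV[int]_N -> R) (th x : R) l :
  (forall u a, 0 <= q u a) -> (forall u, \sum_(a <- letters V) q u a = 1) ->
  (forall u, \sum_(a <- letters V) q u a * xi u a = 0) ->
  (forall u a, `|xi u a| <= 1) -> 0 <= th <= 1 / 2 ->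
  \sum_(w <- words V l) wprod q w * (x < wsum xi w)%R%:R <=
  expR (2 * th ^+ 2 * l%:R - th * x).
Proof.
move=> q0 q1 qxi xi1 /andP[th0 th2].
have step u : \sum_(a <- letters V) q u a * expR (th * xi u a) <= expR (2 * th ^+ 2).
  apply: (@le_trans _ _ (\sum_(a <- letters V)
      (q u a + th * (q u a * xi u a) + 2 * th ^+ 2 * q u a))).
    apply: ler_sum => a _.
    have /andP[xa1 xa2] : -1 <= xi u a <= 1 by rewrite -ler_norml.
    have sq : xi u a ^+ 2 <= 1 by nra.
    have tx : th * xi u a <= 1 / 2 by nra.
    apply: le_trans (ler_wpM2l (q0 u a) (expR_upper2 tx)) _.
    rewrite [leRHS](_ : _ = q u a * (1 + th * xi u a + 2 * th ^+ 2)); last by ring.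
    rewrite ler_wpM2l // lerD2l exprMn mulrA ler_piMr //.
    by rewrite mulr_ge0 // sqr_ge0.
  rewrite !big_split /= -!mulr_sumr q1 qxi mulr0 mulr1 addr0; exact: expR_ge1Dx.
have le := wprod_le l (fun u a => mulr_ge0 (q0 u a) (expR_ge0 _)) (expR_ge0 _) step.
apply: (@le_trans _ _ (expR (- (th * x)) * expR (2 * th ^+ 2) ^+ l)); last first.
  by rewrite -expRM_natl -expRD ler_expR mulr_natr mulr_natl addrC.
apply: le_trans (ler_wpM2l (expR_ge0 _) le).
rewrite mulr_sumr; apply: ler_sum => w _; rewrite wprodM wprod_exp wsumZ.
have wp := wprod_ge0 w q0.
rewrite mulrCA -expRD; case: ltP => xw; last by rewrite mulr0 mulr_ge0 ?expR_ge0.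
rewrite mulr1 ler_peMr // -[leLHS]expR0 ler_expR addrC subr_ge0.
by rewrite ler_wpM2l // ltW.
Qed.

End wsum.

Section tilt.
Variables (R : realType) (N : nat) (K : {set 'I_N}) (V : {fset 'rV[int]_N}).
Variable r : 'rV[int]_N -> 'rV[int]_N -> R.
Hypothesis hr : jump_rates K r.
Hypothesis hhom : facet_homogeneous K r.
Hypothesis hlam : forall I : {set 'I_N}, 0 < lamI K V r I.
Variable c : 'rV[int]_N -> R.
Hypothesis c0 : forall v, 0 < c v.
Variable H : nat.
Hypothesis H0 : (0 < H)%N.
Local Notation h := (H%:R^-1 : R).
Local Notation fr := (facet_rate K r).
Local Notation lam := (lam K V r).
Local Notation rt := (rt K r).

Let h0 : 0 < h. Proof. by rewrite invr_gt0 ltr0n. Qed.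

Definition lamc (I : {set 'I_N}) : R := \sum_(v <- V) c v * fr I v.
Definition lamc_sum : R := \sum_(I : {set 'I_N}) lamc I.

Hypothesis hsmall : h * lamc_sum <= 1.

Lemma lamc_ge0 I : 0 <= lamc I.
Proof. by apply: sumr_ge0 => v _; rewrite mulr_ge0 ?(facet_rate_ge0 hr) // ltW. Qed.

Lemma lamc_le I : lamc I <= lamc_sum.
Proof.
rewrite /lamc_sum (bigD1 I) //= lerDl; apply: sumr_ge0 => J _; exact: lamc_ge0.
Qed.

(** The tilted law: jump rates are multiplied by c, to first order in h. *)
Definition qstep (u : word N) (a : option 'rV[int]_N) : R :=
  if a is Some v then h * c v * rt (pos u) v else 1 - h * lamc (zset K (pos u)).

Lemma jump_le1 I v : v \in V -> h * c v * fr I v <= 1.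
Proof.
move=> vV; apply: le_trans hsmall; rewrite -mulrA ler_pM2l //.
apply: le_trans (lamc_le I).
rewrite /lamc (big_fsetD1 v vV) /= lerDl; apply: sumr_ge0 => w _.
by rewrite mulr_ge0 ?(facet_rate_ge0 hr) // ltW.
Qed.

Lemma qstep_ge0 u a : 0 <= qstep u a.
Proof.
case: a => [v|] /=; first by rewrite !mulr_ge0 ?(rt_ge0 hr) // ltW.
rewrite subr_ge0; apply: le_trans hsmall; rewrite ler_pM2l //; exact: lamc_le.
Qed.

Lemma qstep_sum1 u : \sum_(a <- letters V) qstep u a = 1.
Proof.
rewrite big_letters /qstep; under eq_bigr do rewrite -mulrA.
by rewrite -mulr_sumr -/(lamc (zset K (pos u))) subrK.
Qed.

Lemma qstep_lattice w : wprod qstep w != 0 -> lattice K (pos w).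
Proof. by apply: (wprod_lattice hr hhom) => u v _ uv; rewrite /qstep uv mulr0. Qed.

(** A bound for the logarithm of qstep over pstep.  The terms in lam and
    lamc are due to a slice without jump but are added in every slice;
    lamc_sum * h makes up for this in the slices with a jump. *)
Definition likelihood (u : word N) (a : option 'rV[int]_N) : R :=
  h * (lam (pos u) - lamc (zset K (pos u))) +
  (if a is Some v then ln (c v) + lamc_sum * h else 0).

(** Both bounds come from 1 + y <= exp y: for a slice without jump with
    y = - h lamc, for a jump with y = lam h, which gives
    1 - exp (- lam h) >= lam h exp (- lam h). *)
Lemma qstep_le u a : qstep u a <= pstep K V r h u a * expR (likelihood u a).
Proof.
rewrite /qstep /pstep /likelihood; set l := lam (pos u); set lc := lamc _.
have l0 : 0 < l by exact: hlam.
case: a => [v|]; last first.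
  rewrite addr0 -expRD (_ : - _ + _ = - (h * lc)); last by ring.
  exact: expR_ge1Dx.
have x0 : 0 <= l * h by rewrite mulr_ge0 // ltW.
have le : l * h * expR (- (l * h)) <= 1 - expR (- (l * h)).
  rewrite lerBrDl -[X in X + _]mul1r -mulrDl expRN ler_pdivrMr ?expR_gt0 // mul1r.
  exact: expR_ge1Dx.
have rv : 0 <= rt (pos u) v / l by rewrite divr_ge0 ?(rt_ge0 hr) // ltW.
apply: le_trans (ler_wpM2r (expR_ge0 _) (ler_wpM2r rv le)).
have -> : h * (l - lc) + (ln (c v) + lamc_sum * h) =
  l * h + (h * (lamc_sum - lc) + ln (c v)) by ring.
rewrite expRD [expR (_ + ln _)]expRD lnK ?posrE //.
set E := expR (h * _).
have -> : l * h * expR (- (l * h)) * (rt (pos u) v / l) * (expR (l * h) * (E * c v))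
   = (expR (- (l * h)) * expR (l * h)) * (h * c v * rt (pos u) v * E).
  by field; rewrite pnatr_eq0 -lt0n H0 gt_eqF.
rewrite -expRD addNr expR0 mul1r ler_peMr //.
  by rewrite !mulr_ge0 ?(rt_ge0 hr) // ltW.
rewrite -[leLHS]expR0 ler_expR mulr_ge0 ?(ltW h0) // subr_ge0; exact: lamc_le.
Qed.

Lemma wprod_q_le w :
  wprod qstep w <= wprod (pstep K V r h) w * expR (wsum likelihood w).
Proof.
rewrite -wprod_exp -wprodM; elim: w => //= a u ih.
by apply: ler_pM ih (qstep_le u a); [apply: wprod_ge0|]; exact: qstep_ge0.
Qed.

(** * Occupation of facets and counts of jumps *)

Definition occ (I : {set 'I_N}) : word N -> R :=
  wsum (fun u _ => (zset K (pos u) == I)%:R).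

Definition dev_step (I : {set 'I_N}) (v : 'rV[int]_N) (u : word N)
    (a : option 'rV[int]_N) : R :=
  (zset K (pos u) == I)%:R * ((a == Some v)%:R - h * c v * fr I v).

(** A martingale under the tilted law. *)
Definition dev I v : word N -> R := wsum (dev_step I v).

Lemma dev_step_centred I v u : v \in V ->
  \sum_(a <- letters V) qstep u a * dev_step I v u a = 0.
Proof.
move=> vV; rewrite /dev_step; have [zI|_] := eqVneq (zset K (pos u)) I; last first.
  by rewrite big1 // => a _; rewrite mul0r mulr0.
under eq_bigr do rewrite mul1r mulrBr.
rewrite sumrB -mulr_suml qstep_sum1 mul1r big_letters /= mulr0 add0r.
rewrite (big_fsetD1 v vV) /= eqxx mulr1 big1_seq ?addr0; last first.
  move=> w /andP[_]; rewrite in_fsetD1 => /andP[wv _].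
  by rewrite (_ : (Some w == Some v) = false) ?mulr0 //; exact/negbTE.
by rewrite (rt_facet _ _ zI) subrr.
Qed.

Lemma dev_step_le1 I v u a : v \in V -> `|dev_step I v u a| <= 1.
Proof.
move=> vV; have := jump_le1 I vV.
have : 0 <= h * c v * fr I v by rewrite !mulr_ge0 ?(facet_rate_ge0 hr) // ltW.
rewrite /dev_step ler_norml; case: eqP => _; case: eqP => _ /=; lra.
Qed.

Definition good (x : R) (w : word N) : Prop :=
  forall k I v, v \in V -> `|dev I v (drop k w)| <= x.

(** A union bound over the prefixes, the facets, the jumps and the two
    signs. *)
Lemma bad_words_mass (x th : R) M : 0 <= th <= 1 / 2 ->
  \sum_(w <- words V M) wprod qstep w * (~~ `[< good x w >])%:R <=
  M.+1%:R * (2 * #|{: {set 'I_N}}|%:R * (size V)%:R) *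
  expR (2 * th ^+ 2 * M%:R - th * x).
Proof.
move=> thP; set E := expR _.
have E0 : 0 <= E by exact: expR_ge0.
pose ind k I v w : R :=
  (x < dev I v (drop k w))%R%:R + (x < - dev I v (drop k w))%R%:R.
have ind0 k I v w : 0 <= ind k I v w by rewrite addr_ge0.
have q0 w : 0 <= wprod qstep w by apply: wprod_ge0; exact: qstep_ge0.
have bad w : w \in words V M -> ((~~ `[< good x w >])%:R : R) <=
    \sum_(0 <= k < M.+1) \sum_(I : {set 'I_N}) \sum_(v <- V) ind k I v w.
  move=> wM; case: asboolP => [_|nb] /=.
    by apply: sumr_ge0 => k _; apply: sumr_ge0 => I _; exact: sumr_ge0.
  have [k0 [I [v [vV bad]]]] : exists k0 I v, v \in V /\ ~ `|dev I v (drop k0 w)| <= x.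
    apply: contrapT => nex; apply: nb => k0 I v vV; apply: contrapT => b.
    by apply: nex; exists k0, I, v.
  pose k := minn k0 M.
  have dk : drop k w = drop k0 w.
    rewrite /k; have [//|Mk] := leqP k0 M.
    by rewrite !drop_oversize // ?(words_size wM) // ltnW.
  have kM : (k < M.+1)%N by rewrite ltnS geq_minr.
  have : 1 <= ind k I v w.
    rewrite /ind dk; move: bad; case: ltP => [|h1]; first by rewrite lerDl.
    case: ltP => [|h2 []]; first by rewrite add0r.
    by rewrite ler_norml h1 andbT lerNl.
  move/le_trans; apply; rewrite big_mkord (bigD1 (Ordinal kM)) //=.
  apply: ler_wpDr; first by apply: sumr_ge0 => j _; apply: sumr_ge0 => J _; exact: sumr_ge0.
  rewrite (bigD1 I) //=; apply: ler_wpDr; first by apply: sumr_ge0 => J _; exact: sumr_ge0.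
  by rewrite (big_fsetD1 v vV) /=; apply: ler_wpDr => //; exact: sumr_ge0.
apply: (@le_trans _ _ (\sum_(w <- words V M) wprod qstep w *
    \sum_(0 <= k < M.+1) \sum_(I : {set 'I_N}) \sum_(v <- V) ind k I v w)).
  rewrite big_seq [leRHS]big_seq; apply: ler_sum => w wM.
  by rewrite ler_wpM2l // bad.
under eq_bigr do rewrite mulr_sumr.
rewrite exchange_big /=.
apply: (@le_trans _ _ (\sum_(0 <= k < M.+1)
   (2 * #|{: {set 'I_N}}|%:R * (size V)%:R) * E)); last first.
  by rewrite sumr_const_nat subn0 -[leLHS]mulr_natl mulrA.
apply: ler_sum_nat => k /andP[_ kM]; rewrite ltnS in kM.
under eq_bigr do rewrite mulr_sumr.
rewrite exchange_big /=.
apply: (@le_trans _ _ (\sum_(I : {set 'I_N}) (2 * (size V)%:R * E))); last first.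
  rewrite sumr_const -[X in X <= _]mulr_natl le_eqVlt; apply/orP; left; apply/eqP.
  by ring.
apply: ler_sum => I _.
under eq_bigr do rewrite mulr_sumr.
rewrite exchange_big /=.
apply: (@le_trans _ _ (\sum_(v <- V) (2 * E))); last first.
  rewrite big_const_seq count_predT iter_addr_0 -[X in X <= _]mulr_natl le_eqVlt.
  by apply/orP; left; apply/eqP; ring.
rewrite big_seq [leRHS]big_seq; apply: ler_sum => v vV.
under eq_bigr do rewrite mulrDr.
rewrite big_split /= mulr_natl mulr2n.
have EM l : (l <= M)%N -> expR (2 * th ^+ 2 * l%:R - th * x) <= E.
  move=> lM; rewrite ler_expR lerD2r ler_wpM2l ?ler_nat //.
  by rewrite mulr_ge0 // sqr_ge0.
have wM : (M - k + k = M)%N by rewrite subnK.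
apply: lerD.
  have := wprod_marginal (f := qstep) (fun u => (x < dev I v u)%R%:R : R) (M - k) k qstep_sum1.
  rewrite wM => ->; apply: le_trans (EM _ (leq_subr k M)).
  apply: word_chernoff => //; [exact: qstep_ge0|exact: qstep_sum1| |].
    by move=> u; exact: dev_step_centred.
  by move=> u a; exact: dev_step_le1.
have := wprod_marginal (f := qstep) (fun u => (x < - dev I v u)%R%:R : R) (M - k) k qstep_sum1.
rewrite wM => ->; apply: le_trans (EM _ (leq_subr k M)).
under eq_bigr do rewrite -mulN1r -wsumZ.
apply: word_chernoff => //; [exact: qstep_ge0|exact: qstep_sum1| |].
  move=> u; under eq_bigr do rewrite mulrCA.
  by rewrite -mulr_sumr dev_step_centred ?mulr0.
by move=> u a; rewrite normrM normrN1 mul1r; exact: dev_step_le1.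
Qed.

End tilt.

(** * Good words *)

Section good_words.
Variables (R : realType) (N : nat) (K : {set 'I_N}) (V : {fset 'rV[int]_N}).
Variable r : 'rV[int]_N -> 'rV[int]_N -> R.
Variable c : 'rV[int]_N -> R.
Variable H : nat.
Local Notation h := (H%:R^-1 : R).
Local Notation fr := (facet_rate K r).
Local Notation lamc := (lamc K V r c).
Local Notation lamc_sum := (lamc_sum K V r c).
Local Notation occ := (@occ R N K).
Local Notation dev := (dev K r c H).
Local Notation good := (good K V r c H).

Lemma eq_wsum_words (f g : word N -> option 'rV[int]_N -> R) l w : w \in words V l ->
  (forall u a, a \in letters V -> f u a = g u a) -> wsum f w = wsum g w.
Proof.
move=> + fg; elim: l w => [|l ih] w; first by rewrite inE => /eqP ->.
by move=> /mem_wordsS[u [a [ul al ->]]] /=; rewrite (ih u) // fg.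
Qed.

Lemma occ_ge0 I w : 0 <= occ I w.
Proof. by elim: w => //= a u ih; rewrite addr_ge0. Qed.

Lemma sum_zset (F : {set 'I_N} -> R) (I0 : {set 'I_N}) :
  \sum_(I : {set 'I_N}) (I0 == I)%:R * F I = F I0.
Proof.
rewrite (bigD1 I0) //= eqxx mul1r big1 ?addr0 // => I.
by rewrite eq_sym => /negbTE ->; rewrite mul0r.
Qed.

Lemma occ_sum w : \sum_(I : {set 'I_N}) occ I w = (size w)%:R.
Proof.
rewrite -wsum_sum; elim: w => //= a u ->.
rewrite -natr1; congr (_ + _).
by under eq_bigr do rewrite -[_%:R]mulr1; rewrite (sum_zset (fun=> 1)).
Qed.

Lemma occ_outside (I : {set 'I_N}) w : ~~ (I \subset K) -> occ I w = 0.
Proof.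
move=> IK; elim: w => //= a u ih.
rewrite -[LHS]/(occ I u + (zset K (pos u) == I)%:R) ih add0r.
by case: eqP => // zI; move: IK; rewrite -zI zset_sub.
Qed.

(** A functional of the jumps equals its compensator, carried by the
    occupation of the facets, plus a combination of the deviations. *)
Lemma jump_functional (F : {set 'I_N} -> 'rV[int]_N -> R) l w : w \in words V l ->
  wsum (fun u a => if a is Some v then F (zset K (pos u)) v else 0) w =
  h * (\sum_(I : {set 'I_N}) occ I w * \sum_(v <- V) c v * fr I v * F I v) +
  \sum_(I : {set 'I_N}) \sum_(v <- V) F I v * dev I v w.
Proof.
move=> wl; under [X in _ + X]eq_bigr do under eq_bigr do rewrite -wsumZ.
under [X in _ + X]eq_bigr do rewrite -wsum_sum.
rewrite -wsum_sum.
under [X in h * X]eq_bigr do rewrite mulrC -wsumZ.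
rewrite -wsum_sum -wsumZ -wsumD; apply: (eq_wsum_words wl) => u a al.
set z := zset K (pos u).
have -> : \sum_(I : {set 'I_N}) (\sum_(v <- V) c v * fr I v * F I v) * (z == I)%:R =
    \sum_(v <- V) c v * fr z v * F z v.
  by under eq_bigr do rewrite mulrC; rewrite (sum_zset (fun I => \sum_(v <- V) c v * fr I v * F I v)).
have -> : \sum_(I : {set 'I_N}) \sum_(v <- V) F I v * dev_step K r c H I v u a =
    \sum_(v <- V) F z v * ((a == Some v)%:R - h * c v * fr z v).
  rewrite -(sum_zset (fun I => \sum_(v <- V) F I v * ((a == Some v)%:R - h * c v * fr I v))).
  apply: eq_bigr => I _; rewrite mulr_sumr; apply: eq_bigr => v _.
  by rewrite /dev_step mulrCA.
rewrite mulr_sumr -big_split /=.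
rewrite (eq_bigr (fun v => F z v * (a == Some v)%:R)); last by move=> v _; ring.
case: a al => [v|] al; last by rewrite big1 // => v _; rewrite mulr0.
have vV : v \in V by move: al; rewrite inE /= mem_map // => x y [].
rewrite (big_fsetD1 v vV) /= eqxx mulr1 big1_seq ?addr0 // => x /andP[_].
rewrite in_fsetD1 => /andP[xv _].
by rewrite (_ : (Some v == Some x) = false) ?mulr0 //; apply/negbTE; rewrite eq_sym.
Qed.

Lemma njumpsE (w : word N) : (njumps w)%:R =
  wsum (fun _ a => if a is Some v then 1 else 0 : R) w.
Proof. by elim: w => [|[v|] w ih] //=; rewrite -?natr1 ih ?addr0. Qed.

Lemma pos_coordE (w : word N) j : (toR R (pos w)) ord0 j =
  wsum (fun _ a => if a is Some v then (toR R v) ord0 j else 0 : R) w.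
Proof.
elim: w => [|[v|] w ih] /=; first by rewrite toR0 mxE.
- by rewrite toRD -ih [LHS]mxE.
- by rewrite ih addr0.
Qed.

Definition drift (I : {set 'I_N}) : 'rV[R]_N := \sum_(v <- V) (c v * fr I v) *: toR R v.

Definition jump_size : R := \sum_(I : {set 'I_N}) \sum_(v <- V) enorm (toR R v).
Definition jump_log : R := \sum_(I : {set 'I_N}) \sum_(v <- V) `|ln (c v)|.
Definition jump_count : R := \sum_(I : {set 'I_N}) \sum_(v <- V) 1.

Lemma good_sum x (F : {set 'I_N} -> 'rV[int]_N -> R) w : good x w ->
  \sum_(I : {set 'I_N}) \sum_(v <- V) F I v * dev I v w <=
  x * \sum_(I : {set 'I_N}) \sum_(v <- V) `|F I v|.
Proof.
move=> gw; rewrite mulr_sumr; apply: ler_sum => I _; rewrite mulr_sumr.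
rewrite big_seq [leRHS]big_seq; apply: ler_sum => v vV.
rewrite (le_trans (ler_norm _)) // normrM mulrC ler_wpM2r //.
by have := gw 0%N I v vV; rewrite drop0.
Qed.

Lemma good_drop x k w : good x w -> good x (drop k w).
Proof. by move=> gw j I v vV; rewrite drop_drop; exact: gw. Qed.

Lemma good_pos x l w : w \in words V l -> good x w ->
  enorm (toR R (pos w) - h *: \sum_(I : {set 'I_N}) occ I w *: drift I) <= x * jump_size.
Proof.
move=> wl gw.
have -> : toR R (pos w) - h *: \sum_(I : {set 'I_N}) occ I w *: drift I =
    \sum_(I : {set 'I_N}) \sum_(v <- V) dev I v w *: toR R v.
  apply/eqP; rewrite subr_eq addrC; apply/eqP/rowP => j.
  rewrite pos_coordE (jump_functional (fun _ v => (toR R v) ord0 j) wl).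
  rewrite !mxE !summxE; congr (_ * _ + _).
    apply: eq_bigr => I _; rewrite mxE /drift summxE; congr (_ * _).
    by apply: eq_bigr => v _; rewrite [RHS]mxE.
  by apply: eq_bigr => I _; rewrite summxE; apply: eq_bigr => v _; rewrite [RHS]mxE mulrC.
rewrite (le_trans (enorm_sum _ _ _)) // mulr_sumr; apply: ler_sum => I _.
rewrite (le_trans (enorm_sum _ _ _)) // mulr_sumr.
rewrite big_seq [leRHS]big_seq; apply: ler_sum => v vV.
rewrite enormZ ler_wpM2r ?enorm_ge0 //.
by have := gw 0%N I v vV; rewrite drop0.
Qed.

Hypothesis h0 : 0 <= h.
Hypothesis c0 : forall v, 0 < c v.
Hypothesis hr : jump_rates K r.

Lemma good_njumps x l w : w \in words V l -> good x w ->
  (njumps w)%:R <= h * l%:R * lamc_sum + x * jump_count.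
Proof.
move=> wl gw; rewrite njumpsE (jump_functional (fun _ _ => 1) wl); apply: lerD.
  rewrite -mulrA ler_wpM2l // -(words_size wl) -occ_sum mulr_suml.
  apply: ler_sum => I _; rewrite ler_wpM2l ?occ_ge0 //.
  under eq_bigr do rewrite mulr1; exact: lamc_le.
apply: le_trans (good_sum _ gw) _.
by under eq_bigr do under eq_bigr do rewrite normr1.
Qed.

Definition facet_cost (I : {set 'I_N}) : R := \sum_(v <- V) fr I v * ellr (c v).

Lemma good_likelihood x l w : w \in words V l -> good x w ->
  wsum (likelihood K V r c H) w <=
  h * (\sum_(I : {set 'I_N}) occ I w * facet_cost I) + x * jump_log +
  lamc_sum * h * (njumps w)%:R.
Proof.
move=> wl gw.
have -> : wsum (likelihood K V r c H) w =
    h * (\sum_(I : {set 'I_N}) occ I w * (lamI K V r I - lamc I)) +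
    (wsum (fun u a => if a is Some v then ln (c v) else 0) w +
     lamc_sum * h * (njumps w)%:R).
  rewrite njumpsE -wsumZ -wsumD.
  under [X in h * X]eq_bigr do rewrite mulrC -wsumZ.
  rewrite -wsum_sum -wsumZ -wsumD; apply: eq_wsum => u a; rewrite /likelihood.
  congr (_ + _); last by case: a => [v|]; rewrite ?mulr1 ?mulr0 ?addr0.
  congr (_ * _); under [RHS]eq_bigr do rewrite mulrC.
  by rewrite (sum_zset (fun I => lamI K V r I - lamc I)).
rewrite (jump_functional (fun _ v => ln (c v)) wl) addrA lerD2r addrA.
apply: lerD; last exact: good_sum.
rewrite -mulrDr ler_wpM2l // -big_split /= le_eqVlt; apply/orP; left; apply/eqP.
apply: eq_bigr => I _; rewrite -mulrDr; congr (_ * _).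
rewrite /facet_cost /lamI -[lamc I]/(\sum_(v <- V) c v * fr I v) -sumrB -big_split /=; apply: eq_bigr => v _.
by rewrite /ellr; ring.
Qed.

End good_words.

(** * Good words follow the straight line *)

Section straight.
Variables (R : realType) (N : nat) (K : {set 'I_N}) (V : {fset 'rV[int]_N}).
Variable r : 'rV[int]_N -> 'rV[int]_N -> R.
Hypothesis hr : jump_rates K r.
Hypothesis hhom : facet_homogeneous K r.
Variable c : 'rV[int]_N -> R.
Variables (q : nat) (nn dd : 'I_q -> 'rV[R]_N).
Local Notation fr := (facet_rate K r).
Local Notation driftI := (drift K V r c).

(** The excess w_I of the drift on the facet I over the interior drift, which
    acts as the reflection there. *)
Definition push (I : {set 'I_N}) : 'rV[R]_N :=
  \sum_(v <- V) (c v * (fr I v - fr finset.set0 v)) *: toR R v.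

Hypothesis hG : @orthant R N K = polyhedron nn.
Hypothesis hreg : SM_regular nn dd.
Hypothesis hdir : forall I : {set 'I_N}, I != finset.set0 -> I \subset K ->
  push I != 0 -> forall x, facet K I x -> directions nn dd x ((enorm (push I))^-1 *: push I).

Lemma pushE I : push I = driftI I - driftI finset.set0.
Proof.
rewrite /push /drift -sumrB; apply: eq_bigr => v _.
by rewrite -scalerBl mulrBr.
Qed.

Lemma push0 : push finset.set0 = 0. Proof. by rewrite pushE subrr. Qed.

Lemma facet_scale I (t : R) x : 0 < t -> facet K I x -> facet K I (t *: x).
Proof.
move=> t0 [x1 x2]; split=> i iI; first by rewrite mxE x1 ?mulr0.
by rewrite mxE mulr_gt0 // x2.
Qed.

Lemma bd_orthant x j : orthant K x -> j \in K -> x ord0 j = 0 -> bd (polyhedron nn) x.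
Proof.
rewrite -hG => xK jK xj; split; first exact: subset_closure.
rewrite /interior /= => /nbhs_ballP[e /= e0 eG].
pose y : 'rV[R]_N := x - (e / 2) *: delta_mx ord0 j.
have /eG : ball x e y.
  split=> // i k; suff : `|x i k - y i k| < e by [].
  rewrite /y !mxE opprB addrC subrK.
  rewrite normrM gtr0_norm ?divr_gt0 //.
  by case: (_ && _); rewrite /= ?normr1 ?normr0 ?mulr1 ?mulr0 //; lra.
move=> /(_ j jK); rewrite /y !mxE xj !eqxx /= mulr1 sub0r oppr_ge0 leNgt.
by rewrite divr_gt0.
Qed.

Variables (rho : {set 'I_N} -> R) (rbar : 'rV[int]_N -> R) (beta : 'rV[R]_N).
Hypothesis adm : admissible K V r rho rbar c beta.
Hypothesis hbeta : facet K K beta.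

Lemma betaE_drift : beta = \sum_(I : {set 'I_N} | I \subset K) rho I *: driftI I.
Proof.
have [_ _ rb _ <-] := adm.
under [RHS]eq_bigr do rewrite scaler_sumr.
rewrite exchange_big /=; apply: eq_big_seq => v vV.
rewrite rb // mulr_suml scaler_suml; apply: eq_bigr => I _.
by rewrite scalerA mulrA mulrAC -mulrA [c v * _]mulrC mulrA.
Qed.

Definition mean_push : 'rV[R]_N := \sum_(I : {set 'I_N} | I \subset K) rho I *: push I.

Lemma betaE_push : beta = driftI finset.set0 + mean_push.
Proof.
rewrite betaE_drift /mean_push; under [X in _ + X]eq_bigr do rewrite pushE scalerBr.
rewrite sumrB -scaler_suml; have [_ -> _ _ _] := adm.
by rewrite scale1r addrC subrK.
Qed.

(** Every normal is orthogonal to the linear facet of the vertex, so that all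
    reflection directions are available there. *)
Lemma vertex_normal x i : facet K K x -> dot x (nn i) = 0.
Proof.
move=> [x0 _].
have pos (y : 'rV[R]_N) : (forall j, j \in K -> y ord0 j = 0) -> 0 <= dot y (nn i).
  move=> y0; have : orthant K y by move=> j jK; rewrite y0.
  by rewrite hG; exact.
apply/eqP; rewrite eq_le pos // andbT -oppr_ge0 -dotNl; apply: pos => j jK.
by rewrite mxE x0 // oppr0.
Qed.

Lemma mean_push_directions x : mean_push != 0 -> facet K K x ->
  bd (polyhedron nn) x /\
  directions nn dd x ((enorm mean_push)^-1 *: mean_push).
Proof.
move=> wN0 xK.
have ex (I : {set 'I_N}) : exists al : 'I_q -> R, (forall i, 0 <= al i) /\
    (I \subset K -> push I = \sum_i al i *: dd i).
  have [IK|_] := boolP (I \subset K); last by exists (fun=> 0).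
  have [->|wI] := eqVneq (push I) 0.
    by exists (fun=> 0); split=> // _; rewrite big1 // => i _; rewrite scale0r.
  have I0 : I != finset.set0 by apply: contraNneq wI => ->; rewrite push0.
  have [_ [a a0 E]] := hdir I0 IK wI (facet_facet_point R IK).
  pose y := toR R (facet_point K I).
  exists (fun i => if dot y (nn i) == 0 then enorm (push I) * a i else 0); split.
    by move=> i; case: ifP => // _; rewrite mulr_ge0 ?enorm_ge0.
  (* the sum in directions is restricted to the active normals *)
  move=> _; rewrite (eq_bigr (fun i => if dot y (nn i) == 0 then
      enorm (push I) *: (a i *: dd i) else 0)); last first.
    by move=> i _; case: ifP => _; rewrite ?scalerA ?scale0r.
  rewrite -big_mkcond /= -scaler_sumr -E scalerA divff ?scale1r //.
  by rewrite enorm_eq0.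
have [al al_P] := choice ex.
have jP : exists2 j, j \in K & x ord0 j = 0.
  have [K0|[j jK]] := set_0Vmem K; last by exists j => //; have [x0 _] := xK; exact: x0.
  exfalso; move/eqP: wN0; apply; rewrite /mean_push big1 // => I.
  by rewrite K0 finset.subset0 => /eqP ->; rewrite push0 scaler0.
have [j jK xj] := jP.
have xO : orthant K x by move=> i iK; have [x0 _] := xK; rewrite x0.
split; first exact: bd_orthant xO jK xj.
have e0 : enorm mean_push != 0 by rewrite enorm_eq0.
split; first by rewrite enormZ ger0_norm ?invr_ge0 ?enorm_ge0 // mulVf.
exists (fun i => (enorm mean_push)^-1 * \sum_(I : {set 'I_N} | I \subset K) rho I * al I i).
  move=> i; rewrite mulr_ge0 ?invr_ge0 ?enorm_ge0 //; apply: sumr_ge0 => I IK.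
  by rewrite mulr_ge0 ?(proj1 (al_P I)) //; have [r0 _ _ _ _] := adm; exact: r0.
rewrite (eq_bigl xpredT); last by move=> i; rewrite vertex_normal // eqxx.
under [RHS]eq_bigr do rewrite -scalerA.
rewrite -scaler_sumr; congr (_ *: _).
under [RHS]eq_bigr do rewrite scaler_suml.
rewrite exchange_big /=; apply: eq_bigr => I IK.
rewrite (proj2 (al_P I) IK) scaler_sumr; apply: eq_bigr => i _.
by rewrite scalerA.
Qed.

Definition push_size : R := \sum_(I : {set 'I_N}) enorm (push I).

Lemma push_le I : enorm (push I) <= push_size.
Proof. by rewrite /push_size (bigD1 I) //= lerDl sumr_ge0 // => J _; exact: enorm_ge0. Qed.

Lemma wprod_drop_neq0 (f : word N -> option 'rV[int]_N -> R) w k :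
  wprod f w != 0 -> wprod f (drop k w) != 0.
Proof.
elim: w k => [|a w ih] [|k] //=.
by rewrite mulf_eq0 negb_or => /andP[/ih].
Qed.

Lemma occ_prefix (F : {set 'I_N} -> 'rV[R]_N) (w : word N) l : (l <= size w)%N ->
  \sum_(I : {set 'I_N}) occ R K I (drop (size w - l) w) *: F I =
  \sum_(i < l) F (zset K (pos (drop (size w - i) w))).
Proof.
have occ_cons a u : \sum_(I : {set 'I_N}) occ R K I (a :: u) *: F I =
    \sum_(I : {set 'I_N}) occ R K I u *: F I + F (zset K (pos u)).
  under eq_bigr do rewrite /occ /= scalerDl.
  rewrite big_split /=; congr (_ + _).
  rewrite (bigD1 (zset K (pos u))) //= eqxx scale1r big1 ?addr0 // => I.
  by rewrite eq_sym => /negbTE ->; rewrite scale0r.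
elim: l => [|l ih] lw.
  rewrite big_ord0 subn0 drop_size big1 // => I _.
  by rewrite /occ /= scale0r.
have lt : (size w - l.+1 < size w)%N by rewrite ltn_subrL (leq_ltn_trans _ lw).
have -> : drop (size w - l.+1) w = nth None w (size w - l.+1) :: drop (size w - l) w.
  by rewrite (drop_nth None lt) -subSn // subSS.
by rewrite occ_cons (ih (ltnW lw)) big_ord_recr.
Qed.

(** The position after l slices is h times the sum of the drifts of the facets
    visited, up to the noise.  Splitting each drift into the interior one and
    the push displays the path as a discrete solution; the straight line is
    another one, pushed along mean_push, with the same free motion.  The push
    is charged to the point of arrival instead of the point of departure, which
    costs the two boundary terms bounded by push_size. *)
Lemma path_close : exists2 C : R, 0 <= C & forall H m M x w,
  (0 < m)%N -> (0 < M)%N ->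
  w \in words V M -> wprod (qstep K V r c H) w != 0 -> good K V r c H x w ->
  forall k, enorm (m%:R^-1 *: toR R (pos (drop k w)) -
                   (H%:R^-1 * (size (drop k w))%:R / m%:R) *: beta) <=
    C * ((x * jump_size R V + 2 * H%:R^-1 * push_size) / m%:R).
Proof.
have [C C0 lip] := discrete_lipschitz hreg; exists C => // H m M x w m0 M0 wM wN gw k.
set h : R := H%:R^-1.
have sw := words_size wM.
have mp : 0 < m%:R^-1 :> R by rewrite invr_gt0 ltr0n.
have h00 : 0 <= h by rewrite invr_ge0.
pose u l := drop (M - l) w.
pose z l := zset K (pos (u l)).
have uK l : lattice K (pos (u l)).
  by apply: (qstep_lattice hr hhom); exact: wprod_drop_neq0 wN.
pose X l := m%:R^-1 *: toR R (pos (u l)).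
pose a i := h / m%:R * enorm (push (z i.+1)).
pose g i := (enorm (push (z i.+1)))^-1 *: push (z i.+1).
pose X' l := (h * l%:R / m%:R) *: beta.
pose a' (i : nat) := h / m%:R * enorm mean_push.
pose g' (i : nat) := (enorm mean_push)^-1 *: mean_push.
have hm0 : 0 <= h / m%:R by rewrite mulr_ge0 // ltW.
have XR : reflected nn dd M X a g.
  split=> [l _|i].
    rewrite -hG => i iK; rewrite mxE mulr_ge0 ?(ltW mp) // mxE ler0z.
    exact: uK.
  split; first by rewrite mulr_ge0 ?enorm_ge0.
  rewrite /a => ap _.
  have pN : push (z i.+1) != 0.
    by apply: contraTneq ap => ->; rewrite enorm0 mulr0 ltxx.
  have zN : z i.+1 != finset.set0 by apply: contraNneq pN => ->; rewrite push0.
  have zF := facet_scale mp (facet_zset R (uK i.+1)).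
  split; last exact: hdir zN (zset_sub _ _) pN _ zF.
  have /set0Pn[j jz] := zN.
  apply: (@bd_orthant _ j).
  - move=> i' iK; rewrite mxE mulr_ge0 ?(ltW mp) // mxE ler0z; exact: uK.
  - by move: jz; rewrite inE => /andP[].
  - by have [zF1 _] := zF; exact: zF1.
have XR' : reflected nn dd M X' a' g'.
  have X'K l : facet K K (X' l).
    have [b0 _] := hbeta; split=> i iK; first by rewrite mxE b0 ?mulr0.
    by move: iK; rewrite finset.setDv inE.
  split=> [l _|i].
    by rewrite -hG => i iK; have [X0 _] := X'K l; rewrite X0.
  split; first by rewrite mulr_ge0 ?enorm_ge0.
  rewrite /a' => ap _; apply: mean_push_directions => //.
  by apply: contraTneq ap => ->; rewrite enorm0 mulr0 ltxx.
have unit (p : 'rV[R]_N) : enorm p *: ((enorm p)^-1 *: p) = p.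
  have [->|pN] := eqVneq p 0; first by rewrite !scaler0.
  by rewrite scalerA divff ?scale1r // enorm_eq0.
have pushX l : pushed a g l = (h / m%:R) *: \sum_(i < l) push (z i.+1).
  rewrite /pushed scaler_sumr; apply: eq_bigr => i _.
  by rewrite /a /g -scalerA unit.
have pushX' l : pushed a' g' l = (h * l%:R / m%:R) *: mean_push.
  rewrite /pushed /a' /g' sumr_const card_ord -scalerA unit -scaler_nat scalerA.
  by congr (_ *: _); ring.
have close l : (l <= M)%N -> enorm ((X l - pushed a g l) - (X' l - pushed a' g' l)) <=
    (x * jump_size R V + 2 * h * push_size) / m%:R.
  move=> lM.
  pose noise := toR R (pos (u l)) - h *: \sum_(I : {set 'I_N}) occ R K I (u l) *: driftI I.
  have noise_le : enorm noise <= x * jump_size R V.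
    have ul : u l \in words V (M - (M - l)) by exact: words_drop.
    by apply: (good_pos ul); exact: good_drop.
  have occE : \sum_(I : {set 'I_N}) occ R K I (u l) *: driftI I =
      l%:R *: driftI finset.set0 + \sum_(i < l) push (z i).
    rewrite /u -sw occ_prefix ?sw //.
    rewrite (eq_bigr (fun i : 'I_l => driftI finset.set0 + push (z i))); last first.
      by move=> i _; rewrite pushE addrC subrK.
    by rewrite big_split /= sumr_const card_ord scaler_nat.
  have tele : \sum_(i < l) push (z i) - \sum_(i < l) push (z i.+1) = push (z 0%N) - push (z l).
    rewrite -sumrB -[RHS]opprB -(telescope_sumr (fun i => push (z i)) (leq0n l)) big_mkord.
    by rewrite -sumrN; apply: eq_bigr => i _; rewrite opprB.
  have -> : (X l - pushed a g l) - (X' l - pushed a' g' l) =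
      m%:R^-1 *: (noise + h *: (push (z 0%N) - push (z l))).
    rewrite pushX pushX' /X /X' [in X in _ - X]betaE_push -tele /noise occE.
    apply/rowP => j; rewrite !mxE.
    set S1 := (\sum_(i < l) push (z i)) _ _; set S2 := (\sum_(i < l) push (z i.+1)) _ _.
    ring.
  rewrite enormZ gtr0_norm // mulrC ler_wpM2r ?(ltW mp) //.
  rewrite (le_trans (enormD _ _)) // lerD // enormZ ger0_norm //.
  rewrite [2 * h]mulrC -mulrA ler_wpM2l // (le_trans (enormB _ _)) //.
  by rewrite mulr2n mulrDl mul1r lerD // push_le.
have := lip M X a g X' a' g' _ M0 XR XR' close (M - k)%N (leq_subr _ _).
have [kM|Mk] := leqP k M.
  by rewrite /X /X' /u subKn // size_drop sw.
have -> : drop k w = [::] by rewrite drop_oversize // sw ltnW.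
rewrite /X /X' /u /=.
have -> : (M - k = 0)%N by apply/eqP; rewrite subn_eq0 ltnW.
by rewrite subn0 drop_oversize ?sw.
Qed.

End straight.

(** * Stability of the cost *)

Section stability.
Variables (R : realType) (N : nat) (K : {set 'I_N}) (V : {fset 'rV[int]_N}).
Variable r : 'rV[int]_N -> 'rV[int]_N -> R.
Variable c : 'rV[int]_N -> R.
Hypothesis c0 : forall v, 0 < c v.
Variables (rbar : 'rV[int]_N -> R) (beta : 'rV[R]_N).
Hypothesis uniq_rbar : forall rho rb, admissible K V r rho rb c beta ->
  forall v, v \in V -> rb v = rbar v.

Local Notation drift := (drift K V r c).
Local Notation fcost := (facet_cost K V r c).
Local Notation cost := (\sum_(v <- V) rbar v * ellr (c v)).

(** The penalty of y vanishes exactly if y is a probability on the subsets of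
    K whose drift is beta and whose cost exceeds the given one by eps; by
    uniqueness of the mean rates there is no such y, so the penalty is bounded
    away from 0 on the compact unit cube. *)
Lemma near_cost eps : 0 < eps -> exists2 zeta, 0 < zeta &
  forall rho : {set 'I_N} -> R, (forall I, 0 <= rho I) ->
  (forall I : {set 'I_N}, ~~ (I \subset K) -> rho I = 0) ->
  \sum_(I : {set 'I_N}) rho I = 1 ->
  enorm (\sum_(I : {set 'I_N}) rho I *: drift I - beta) <= zeta ->
  \sum_(I : {set 'I_N}) rho I * fcost I <= cost + eps.
Proof.
move=> eps0; pose m := #|{: {set 'I_N}}|.
pose P (y : 'rV[R]_m) (I : {set 'I_N}) : R := y ord0 (enum_rank I).
pose S y := \sum_(I : {set 'I_N}) P y I - 1.
pose O y := \sum_(I : {set 'I_N} | ~~ (I \subset K)) P y I.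
pose Z y := \sum_(I : {set 'I_N}) P y I *: drift I - beta.
pose E y := \sum_(I : {set 'I_N}) P y I * fcost I - (cost + eps).
pose pen y := S y * S y + O y + dot (Z y) (Z y) + (`|E y| - E y).
have cP I : continuous (P^~ I) by exact: coord_continuous.
have cE : continuous E.
  apply: continuous_add; last exact: continuous_const.
  by apply: continuous_sum => I; apply: continuous_mul => //; exact: continuous_const.
have cZ j : continuous (fun y => (Z y) ord0 j).
  under eq_fun do rewrite /Z mxE summxE.
  apply: continuous_add; last exact: continuous_const.
  apply: continuous_sum => I; under eq_fun do rewrite mxE.
  by apply: continuous_mul => //; exact: continuous_const.
have cS : continuous S.
  by apply: continuous_add; [exact: continuous_sum|exact: continuous_const].
have cpen : continuous pen.
  apply: continuous_add; first apply: continuous_add; first apply: continuous_add.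
  - exact: continuous_mul.
  - exact: continuous_sum.
  - by apply: continuous_sum => j; exact: continuous_mul.
  - under eq_fun do rewrite -mulN1r.
    apply: continuous_add; first exact: continuous_abs.
    by apply: continuous_mul => //; exact: continuous_const.
pose cube := [set y : 'rV[R]_m | forall i, `[0, 1]%classic (y ord0 i)].
have cube_compact : compact cube.
  by apply: (@rV_compact R m (fun=> `[0, 1]%classic)) => i; exact: segment_compact.
have cube0 : cube 0 by move=> i /=; rewrite in_itv /= mxE lexx ler01.
have [y0 y0c ymin] := EVT_min_rV (ex_intro _ _ cube0) cube_compact
  (continuous_subspaceT cpen).
have parts y : cube y -> [/\ 0 <= S y * S y, 0 <= O y, 0 <= dot (Z y) (Z y) &
    0 <= `|E y| - E y].
  move=> yc; split; [by rewrite -expr2 sqr_ge0| |exact: dot_ge0|].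
    by apply: sumr_ge0 => I _; have := yc (enum_rank I); rewrite /= in_itv => /andP[].
  by rewrite subr_ge0 ler_norm.
have y0c' : cube y0 by move: y0c; rewrite inE.
have pen0 : 0 < pen y0.
  have [p1 p2 p3 p4] := parts _ y0c'.
  have p0 : 0 <= pen y0 by rewrite /pen; lra.
  rewrite lt_def p0 andbT; apply/negP => /eqP pe.
  have S0 : S y0 = 0 by apply/eqP; rewrite -sqrf_eq0 expr2; apply/eqP; rewrite /pen in pe; lra.
  have O0 : O y0 = 0 by rewrite /pen in pe; lra.
  have Z0 : Z y0 = 0.
    apply/eqP; rewrite -enorm_eq0 -sqrf_eq0 sqr_enorm; apply/eqP.
    by rewrite /pen in pe; lra.
  have E0 : 0 <= E y0 by have := normr_ge0 (E y0); rewrite /pen in pe; lra.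
  have P0 I : 0 <= P y0 I by have := y0c' (enum_rank I); rewrite /= in_itv => /andP[].
  have Pout (I : {set 'I_N}) : ~~ (I \subset K) -> P y0 I = 0.
    move=> IK; apply/eqP; rewrite eq_le P0 andbT -O0 /O (bigD1 I) //= lerDl.
    by apply: sumr_ge0.
  have inK (U : lmodType R) (F : {set 'I_N} -> U) : \sum_(I : {set 'I_N}) P y0 I *: F I =
      \sum_(I : {set 'I_N} | I \subset K) P y0 I *: F I.
    rewrite [RHS]big_mkcond; apply: eq_bigr => I _; case: ifPn => // IK.
    by rewrite Pout // scale0r.
  have inKR (F : {set 'I_N} -> R) : \sum_(I : {set 'I_N}) P y0 I * F I =
      \sum_(I : {set 'I_N} | I \subset K) P y0 I * F I.
    exact: (inK R^o).
  pose rb v := \sum_(I : {set 'I_N} | I \subset K) P y0 I * facet_rate K r I v.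
  have adm : admissible K V r (P y0) rb c beta.
    split=> //.
    - move/eqP: S0; rewrite subr_eq0 => /eqP S1.
      rewrite -[RHS]S1; have := inKR (fun=> 1).
      by under eq_bigr do rewrite mulr1; under [RHS]eq_bigr do rewrite mulr1.
    - by move=> v _; rewrite ltW.
    - move/eqP: Z0; rewrite subr_eq0 => /eqP <-.
      rewrite inK; under [RHS]eq_bigr do rewrite scaler_sumr.
      rewrite exchange_big /=; apply: eq_bigr => v _.
      rewrite mulr_suml scaler_suml; apply: eq_bigr => I _.
      by rewrite scalerA mulrA mulrAC -mulrA [c v * _]mulrC mulrA.
  have := uniq_rbar adm => rbE.
  have costE : \sum_(I : {set 'I_N}) P y0 I * fcost I = cost.
    rewrite inKR /facet_cost; under eq_bigr do rewrite mulr_sumr.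
    rewrite exchange_big /=; apply: eq_big_seq => v vV.
    rewrite -rbE // mulr_suml; apply: eq_bigr => I _; by rewrite mulrA.
  by move: E0; rewrite /E costE; lra.
pose zeta := Num.min 1 (pen y0) / 2.
have min0 : 0 < Num.min 1 (pen y0) by rewrite lt_min ltr01.
exists zeta; first by rewrite divr_gt0.
move=> rho rho0 rhoK rho1 rhoZ; rewrite leNgt; apply/negP => lt.
pose y : 'rV[R]_m := \row_i rho (enum_val i).
have Py I : P y I = rho I by rewrite /P mxE enum_rankK.
have yc : cube y.
  move=> i /=; rewrite in_itv /= mxE rho0 /= -rho1 (bigD1 (enum_val i)) //= lerDl.
  by apply: sumr_ge0.
have : pen y0 <= pen y by apply: ymin; rewrite inE.
have -> : pen y = enorm (Z y) ^+ 2.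
  have Sy : S y = 0 by rewrite /S (eq_bigr rho) ?rho1 ?subrr.
  have Oy : O y = 0 by rewrite /O big1 // => I IK; rewrite Py rhoK.
  have Ey : 0 <= E y.
    by rewrite /E (eq_bigr (fun I => rho I * fcost I)) ?subr_ge0 ?ltW // => I _; rewrite Py.
  by rewrite /pen Sy Oy (ger0_norm Ey) subrr mulr0 !add0r addr0 sqr_enorm.
have Zy : enorm (Z y) <= zeta.
  rewrite /Z (eq_bigr (fun I => rho I *: drift I)) // => I _; by rewrite Py.
have z1 : zeta <= 1 / 2 by rewrite ler_pM2r ?invr_gt0 // ge_min lexx.
have z2 : zeta <= pen y0 / 2 by rewrite ler_pM2r ?invr_gt0 // ge_min lexx orbT.
have := enorm_ge0 (Z y); have z0 : 0 < zeta by rewrite divr_gt0.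
clear -Zy z1 z2 z0 pen0; nra.
Qed.

End stability.

(** * An exponential lower bound for the probability of a tube *)

Section lower.
Variables (R : realType) (N : nat) (K : {set 'I_N}) (V : {fset 'rV[int]_N}).
Variable r : 'rV[int]_N -> 'rV[int]_N -> R.
Hypothesis hr : jump_rates K r.
Hypothesis hhom : facet_homogeneous K r.
Hypothesis hlam : forall I : {set 'I_N}, 0 < lamI K V r I.
Variables (d : measure_display) (Omega : measurableType d).
Variables (P0 : probability Omega R).
Variables (X : R -> Omega -> 'rV[int]_N).
Variables (Y : nat -> Omega -> 'rV[int]_N) (T : nat -> Omega -> \bar R).
Hypothesis mY : forall k z, measurable [set w | Y k w = z].
Hypothesis mT : forall k, measurable_fun setT (T k).
Hypothesis hlaw : chain_law V r P0 Y T.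
Hypothesis Tdiv : forall w, (\sum_(i < k) T i w)%E @[k --> \oo] --> +oo%E.
Hypothesis XY : sample_path X Y T.
Variable c : 'rV[int]_N -> R.
Hypothesis c0 : forall v, 0 < c v.

Variables (H n g : nat).
Hypotheses (H0 : (0 < H)%N) (n0 : (0 < n)%N).
Local Notation h := (H%:R^-1 : R).
Local Notation M := (n * (H + g))%N.
Hypothesis hsmall : h * lamc_sum K V r c <= 1.
Local Notation qs := (qstep K V r c H).
Local Notation ev := (ev Y T h).
Variables (x D B e : R) (beta beta' : 'rV[R]_N).
Hypothesis hgood : forall w, w \in words V M -> wprod qs w != 0 ->
  good K V r c H x w ->
  [/\ ((njumps w).+1 <= g * n)%N,
      wsum (likelihood K V r c H) w <= B &
      forall k, enorm (n%:R^-1 *: toR R (pos (drop k w)) -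
        (h * (size (drop k w))%:R / n%:R) *: beta') <= D].
Hypothesis hbad :
  \sum_(w <- words V M) wprod qs w * (~~ `[< good K V r c H x w >])%:R <= 1 / 2.
Hypothesis hD : D + h * g%:R * enorm beta' + enorm (beta' - beta) < e.

Lemma njumps_drop k (w : word N) : (njumps (drop k w) <= njumps w)%N.
Proof.
by elim: w k => [|[v|] w ih] [|k] //=; exact: leqW.
Qed.

(** Good words force the path into the tube: X at the time n t is the position
    of a prefix whose length times h differs from n t by at most h (njumps + 1),
    hence by at most h g n. *)
Lemma tube_lower : ((1 / 2 * expR (- B))%:E <= P0 (tube X n beta e))%E.
Proof.
have np : 0 < n%:R :> R by rewrite ltr0n.
have h0 : 0 < h by rewrite invr_gt0 ltr0n.
have Hp : 0 < H%:R :> R by rewrite ltr0n.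
pose s := [seq w <- words V M | `[< good K V r c H x w >] && (wprod qs w != 0)].
have us : uniq s by rewrite filter_uniq // words_uniq.
have ss : {subset s <= words V M} by move=> w; rewrite mem_filter => /andP[].
have sP w : w \in s -> [/\ w \in words V M, wprod qs w != 0 & good K V r c H x w].
  by rewrite mem_filter => /andP[/andP[/asboolP gw wN] wM].
have q0 w : 0 <= wprod qs w by apply: wprod_ge0; exact: (qstep_ge0 hr c0 H0 hsmall).
have mass : 1 / 2 * expR (- B) <= \sum_(w <- s) wprod (pstep K V r h) w.
  apply: (@le_trans _ _ (\sum_(w <- s) wprod qs w * expR (- B))).
    rewrite -mulr_suml ler_wpM2r ?expR_ge0 //.
    have : \sum_(w <- words V M) wprod qs w = 1.
      by apply: wprod_eq1 => u; exact: qstep_sum1.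
    have -> : \sum_(w <- s) wprod qs w = \sum_(w <- words V M) wprod qs w -
        \sum_(w <- words V M) wprod qs w * (~~ `[< good K V r c H x w >])%:R.
      rewrite -sumrB /s big_filter big_mkcond; apply: eq_bigr => w _.
      have [->|_] := eqVneq (wprod qs w) 0; first by rewrite andbF mul0r subrr.
      by rewrite andbT; case: `[< _ >]; rewrite ?mulr0 ?mulr1 ?subr0 ?subrr.
    by move=> ->; have := hbad; lra.
  rewrite big_seq [leRHS]big_seq; apply: ler_sum => w /sP[wM wN gw].
  have [_ lB _] := hgood wM wN gw.
  rewrite expRN ler_pdivrMr ?expR_gt0 //.
  apply: le_trans (wprod_q_le hr hlam c0 H0 hsmall w) _.
  rewrite ler_wpM2l ?ler_expR //.
  by apply: wprod_ge0 => u a; exact: (pstep_ge0 hr hlam _ _ (ltW h0)).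
have cm := cells_mass hr hhom hlam mY mT hlaw h0 us ss.
apply: (@le_trans _ _ (P0 (\bigcup_(w in [set` s]) ev w))).
  by rewrite [leRHS]cm lee_fin.
have sub : \bigcup_(w in [set` s]) ev w `<=` tube X n beta e.
  move=> o [w /= ws wo]; have [wM wN gw] := sP _ ws.
  have [nj _ dev_le] := hgood wM wN gw.
  rewrite /tube /=; apply: (@le_lt_trans _ _ (D + h * g%:R * enorm beta' + enorm (beta' - beta))%:E);
    last by rewrite lte_fin.
  apply: ge_ereal_sup => _ [t /= + <-]; rewrite in_itv /= => /andP[t0 t1].
  rewrite lee_fin.
  have nt0 : 0 <= n%:R * t by rewrite mulr_ge0.
  have njR : (njumps w)%:R + 1 <= g%:R * n%:R :> R by rewrite natr1 -natrM ler_nat.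
  have ntw : ((n%:R * t)%:E < elapsed T h w o)%E.
    have [lo _] := elapsed_bounds h0 wo.
    apply: lt_le_trans lo; rewrite lte_fin ltr_pdivlMr // (words_size wM).
    rewrite natrM natrD.
    have : n%:R * t * H%:R <= n%:R * H%:R by rewrite ler_pM2r // ler_piMr // ltW.
    lra.
  have [k] := path_slice XY h0 wo nt0 ntw.
  set u := drop k w => -[_ u1 u2 u3]; rewrite u3.
  have nju : (njumps u)%:R <= (njumps w)%:R :> R by rewrite ler_nat njumps_drop.
  pose tu : R := h * (size u)%:R / n%:R.
  have tu_t : `|tu - t| <= h * g%:R.
    have E1 : `|tu - t| = `|h * (size u)%:R - n%:R * t| / n%:R.
      rewrite -[X in _ = _ / X]gtr0_norm // -normf_div; congr `|_|; rewrite /tu.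
      by field; rewrite gt_eqF //= pnatr_eq0 -lt0n.
    rewrite E1 ler_pdivrMr // -mulrA.
    have u2' : n%:R * t <= h * (size u)%:R + h.
      by rewrite (le_trans (ltW u2)) // -natr1 mulrDl mul1r mulrC.
    have u1' : h * (size u)%:R - h * (njumps u)%:R <= n%:R * t by rewrite -mulrBr mulrC.
    have b1 : h * (njumps u)%:R + h <= h * (g%:R * n%:R).
      by rewrite -[X in _ + X]mulr1 -mulrDr ler_pM2l //; lra.
    have b2 : 0 <= h * (njumps u)%:R by rewrite mulr_ge0 // ltW.
    rewrite ler_norml; apply/andP; split; lra.
  rewrite (_ : _ - t *: beta = (n%:R^-1 *: toR R (pos u) - tu *: beta') +
     ((tu - t) *: beta' + t *: (beta' - beta))); last first.
    by apply/rowP => j; rewrite !mxE; ring.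
  rewrite (le_trans (enormD _ _)) // -addrA lerD //; first exact: dev_le.
  rewrite (le_trans (enormD _ _)) // lerD // !enormZ.
    by rewrite ler_wpM2r // enorm_ge0.
  by rewrite ger0_norm // ler_piMl // enorm_ge0.
rewrite le_measure ?inE //.
- exact: (measurable_cells mY mT h0).
- exact: (measurable_tube mY mT Tdiv XY beta n0 e).
Qed.

End lower.

(** * Continuity of the cost *)

Section cost_continuity.
Variable R : realType.
Implicit Types a b eps eta : R.

Lemma ln_le_sub1 a : 0 < a -> ln a <= a - 1.
Proof.
move=> a0; have /le_ln1Dx : -1 < a - 1 by rewrite ltrBrDl addrN.
by rewrite addrC subrK.
Qed.

Lemma ellr0 : ellr (0 : R) = 1.
Proof. by rewrite /ellr mul0r subr0 add0r. Qed.

Lemma ellr_ge0 a : 0 <= a -> 0 <= ellr a.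
Proof.
rewrite le_eqVlt => /predU1P[<-|a0]; first by rewrite ellr0.
have : ln a^-1 <= a^-1 - 1 by apply: ln_le_sub1; rewrite invr_gt0.
rewrite lnV ?posrE // -(ler_pM2l a0) mulrN mulrBr divff ?gt_eqF // mulr1.
rewrite /ellr; lra.
Qed.

Lemma ellr_le_sqr a : 0 < a -> ellr a <= (a - 1) ^+ 2.
Proof.
move=> a0; have := ln_le_sub1 a0; rewrite -(ler_pM2l a0) /ellr.
rewrite (_ : (a - 1) ^+ 2 = a * (a - 1) - a + 1); last by ring.
lra.
Qed.

(** Convexity: the tangent at b lies below the graph. *)
Lemma ellr_tangent a b : 0 <= a -> 0 < b -> ellr b <= ellr a + (b - a) * ln b.
Proof.
rewrite le_eqVlt => /predU1P[<- b0|a0 b0].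
  by rewrite ellr0 /ellr; lra.
have ab : 0 < a / b by rewrite divr_gt0.
have := ellr_ge0 (ltW ab); rewrite -(pmulr_rge0 _ b0) /ellr ln_div ?posrE //.
rewrite (_ : b * (_ + 1) = a * (ln a - ln b) - a + b); last by field; rewrite gt_eqF.
lra.
Qed.

(** At a = 0 only semicontinuity from above is needed, where a ln a <= 0
    helps. *)
Lemma ellr_usc a eta : 0 <= a -> 0 < eta -> exists2 eps, 0 < eps &
  forall b, 0 < b -> `|a - b| < eps -> ellr b <= ellr a + eta.
Proof.
rewrite le_eqVlt => /predU1P[<- eta0|a0 eta0].
  exists 1 => // b b0; rewrite sub0r normrN gtr0_norm // => b1.
  have : ln b <= 0 by rewrite ln_le0 // ltW.
  have := ellr_tangent (lexx 0) b0; rewrite subr0; nra.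
pose B := `|ln (a / 2)| + `|ln (2 * a)| + 1.
have B0 : 0 < B by rewrite ltr_wpDl // addr_ge0.
exists (Num.min (a / 2) (eta / B)).
  by rewrite lt_min !divr_gt0.
move=> b b0; rewrite lt_min => /andP[ab1 ab2].
apply: le_trans (ellr_tangent (ltW a0) b0) _; rewrite lerD2l.
apply: le_trans (ler_norm _) _; rewrite normrM distrC.
apply: (@le_trans _ _ (eta / B * B)); last by rewrite divfK // gt_eqF.
apply: ler_pM; rewrite ?normr_ge0 // ?ltW //.
move: ab1; rewrite ltr_norml => /andP[h1 h2].
have b1 : a / 2 < b by lra.
have b2 : b < 2 * a by lra.
have l1 : ln (a / 2) <= ln b by rewrite ler_ln ?posrE ?divr_gt0 // ltW.
have l2 : ln b <= ln (2 * a) by rewrite ler_ln ?posrE ?mulr_gt0 // ltW.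
have n1 := ler_norm (ln (2 * a)); have n2 := ler_norm (- ln (a / 2)).
have n3 := normr_ge0 (ln (2 * a)); have n4 := normr_ge0 (ln (a / 2)).
rewrite normrN in n2.
by rewrite /B ltr_norml; apply/andP; split; lra.
Qed.

Lemma cost_term_usc s a m eta : 0 <= s -> 0 <= a -> 0 < eta ->
  exists2 eps, 0 < eps & forall s' b, 0 <= s' -> 0 < b -> `|s - s'| < eps ->
    (s != 0 -> `|a - b| < eps) -> (s = 0 -> b <= m) ->
    s' * ellr b <= s * ellr a + eta.
Proof.
move=> s0 a0 eta0; have [sz|sN] := eqVneq s 0.
  have m0 : 0 < m ^+ 2 + 1 by rewrite ltr_wpDl // sqr_ge0.
  exists (eta / (m ^+ 2 + 1)); first by rewrite divr_gt0.
  move=> s' b s'0 b0; rewrite sz sub0r normrN ger0_norm // => s'e _ /(_ erefl) bm.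
  rewrite mul0r add0r.
  apply: (@le_trans _ _ (eta / (m ^+ 2 + 1) * (m ^+ 2 + 1))); last first.
    by rewrite divfK // gt_eqF.
  apply: ler_pM => //; [exact: ellr_ge0 (ltW b0)|exact: ltW|].
  apply: le_trans (ellr_le_sqr b0) _; nra.
have sp : 0 < s by rewrite lt_def sN.
have la := ellr_ge0 a0.
pose eta1 := eta / (2 * (s + 1)).
have eta10 : 0 < eta1 by rewrite divr_gt0 // mulr_gt0 // ltr_wpDl.
have [eps1 eps10 usc] := ellr_usc a0 eta10.
pose D := ellr a + eta1.
have D0 : 0 < D by rewrite ltr_wpDl.
exists (Num.min eps1 (eta / (2 * D))).
  by rewrite lt_min eps10 divr_gt0 // mulr_gt0.
move=> s' b s'0 b0; rewrite lt_min => /andP[_ ss'] /(_ isT).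
rewrite lt_min => /andP[ab _] _.
have lb : ellr b <= D by exact: usc.
apply: (@le_trans _ _ (s' * D)); first by rewrite ler_wpM2l.
have e1 : s * eta1 <= eta / 2.
  rewrite /eta1 mulrA ler_pdivrMr ?mulr_gt0 ?ltr_wpDl //; nra.
have e2 : (s' - s) * D <= eta / 2.
  have : s' - s <= eta / (2 * D).
    by rewrite (le_trans (ler_norm _)) // distrC ltW.
  rewrite -(ler_pM2r D0); move/le_trans; apply.
  rewrite le_eqVlt; apply/orP; left; apply/eqP; field.
  by rewrite gt_eqF.
rewrite /D in e2 *; nra.
Qed.

Lemma common_eps (U : eqType) (s : seq U) (Q : U -> R -> Prop) :
  (forall v, v \in s -> exists2 eps, 0 < eps & Q v eps) ->
  (forall v eps eps', eps' <= eps -> Q v eps -> Q v eps') ->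
  exists2 eps, 0 < eps & forall v, v \in s -> Q v eps.
Proof.
move=> + mono; elim: s => [_|v s ih Qs]; first by exists 1.
have [|e1 e10 Q1] := ih; first by move=> w ws; apply: Qs; rewrite inE ws orbT.
have [|e2 e20 Q2] := Qs v; first by rewrite inE eqxx.
exists (Num.min e1 e2); first by rewrite lt_min e10.
move=> w; rewrite inE => /predU1P[->|ws].
  by apply: mono Q2; rewrite ge_min lexx orbT.
by apply: mono (Q1 w ws); rewrite ge_min lexx.
Qed.

Lemma exp_decay (A k : R) : 0 <= A -> 0 < k -> exists n0, (0 < n0)%N /\
  forall n, (n0 <= n)%N -> A * n%:R * expR (- (n%:R * k)) <= 1 / 2.
Proof.
move=> A0 k0; have c0 : 0 <= 4 * A / k ^+ 2.
  by apply: divr_ge0; [exact: mulr_ge0|exact: sqr_ge0].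
have h0 : 0 < 1 / 2 :> R by [].
have [n0 [n00 hn]] := div_nat_le c0 h0.
exists n0; split=> // n n0n.
have np : 0 < n%:R :> R by rewrite ltr0n; exact: leq_trans n0n.
apply: le_trans (hn n n0n).
have nk : 0 <= n%:R * k by rewrite mulr_ge0 // ltW.
rewrite expRN ler_pdivrMr ?expR_gt0 //.
have := expR_ge_sqr nk; have cn : 0 <= 4 * A / k ^+ 2 / n%:R by rewrite divr_ge0 // ltW.
move/(ler_wpM2l cn); apply: le_trans.
rewrite le_eqVlt; apply/orP; left; apply/eqP; field.
by rewrite !gt_eqF.
Qed.

Lemma tail_exponent (th dl m n : R) : 0 <= th -> 0 <= n -> th * (4 * m) <= dl ->
  2 * th ^+ 2 * (n * m) - th * (dl * n) <= - (n * (th * dl / 2)).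
Proof.
move=> th0 n0 le.
have : n * th * (th * (4 * m)) <= n * th * dl by rewrite ler_wpM2l // mulr_ge0.
lra.
Qed.

End cost_continuity.

(** * What a good word determines *)

Section good_bounds.
Variables (R : realType) (N : nat) (K : {set 'I_N}) (V : {fset 'rV[int]_N}).
Variable r : 'rV[int]_N -> 'rV[int]_N -> R.
Hypothesis hr : jump_rates K r.
Variable c : 'rV[int]_N -> R.
Hypothesis c0 : forall v, 0 < c v.
Variables (H n g : nat) (dl : R).
Hypotheses (H0 : (0 < H)%N) (n0 : (0 < n)%N).
Local Notation h := (H%:R^-1 : R).
Local Notation M := (n * (H + g))%N.
Local Notation kap := (lamc_sum K V r c).
Variable w : word N.
Hypotheses (wM : w \in words V M) (gw : good K V r c H (dl * n%:R) w).

Let h0 : 0 < h. Proof. by rewrite invr_gt0 ltr0n. Qed.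
Let np : 0 < n%:R :> R. Proof. by rewrite ltr0n. Qed.
Let hM : h * M%:R = n%:R * (1 + h * g%:R).
Proof. by rewrite natrM natrD; field; rewrite pnatr_eq0 -lt0n. Qed.

(** With g larger than twice the total tilted rate, the n g slices added to the
    n H ones that cover the time n outnumber the jumps; so a good word covers
    the time n although its slices with a jump may be arbitrarily short. *)
Lemma good_word_count : h * g%:R <= 1 -> dl * jump_count R V <= 1 ->
  2 * kap + 2 <= g%:R -> (njumps w)%:R + 1 <= g%:R * n%:R :> R.
Proof.
move=> hg d3 gP.
have kap0 : 0 <= kap by apply: sumr_ge0 => I _; exact: (lamc_ge0 V hr c0).
have n1 : 1 <= n%:R :> R by rewrite ler1n.
have nj := good_njumps (ltW h0) c0 hr wM gw.
rewrite hM mulrAC (mulrC _ n%:R) in nj.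
have b1 : n%:R * (dl * jump_count R V) <= n%:R * 1 by rewrite ler_pM2l.
have b2 : n%:R * (1 + h * g%:R) * kap <= n%:R * 2 * kap.
  by rewrite ler_wpM2r // ler_pM2l // -[2]/(1 + 1) lerD2l.
have b3 : n%:R * (2 * kap + 2) <= n%:R * g%:R by rewrite ler_pM2l.
lra.
Qed.

Let rM I := occ R K I w / M%:R.

Let sumM (U : lmodType R) (F : {set 'I_N} -> U) :
  \sum_(I : {set 'I_N}) occ R K I w *: F I = M%:R *: \sum_(I : {set 'I_N}) rM I *: F I.
Proof.
rewrite scaler_sumr; apply: eq_bigr => I _.
rewrite scalerA /rM mulrC divfK // pnatr_eq0 -lt0n muln_gt0 n0 addn_gt0 H0 //.
Qed.

Lemma good_word_cost (cost eps zeta D : R) (beta' : 'rV[R]_N) :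
  (forall rho : {set 'I_N} -> R, (forall I, 0 <= rho I) ->
    (forall I : {set 'I_N}, ~~ (I \subset K) -> rho I = 0) ->
    \sum_(I : {set 'I_N}) rho I = 1 ->
    enorm (\sum_(I : {set 'I_N}) rho I *: drift K V r c I - beta') <= zeta ->
    \sum_(I : {set 'I_N}) rho I * facet_cost K V r c I <= cost + eps) ->
  enorm (n%:R^-1 *: toR R (pos w) - (h * M%:R / n%:R) *: beta') <= D ->
  dl * jump_size R V + D <= zeta ->
  h * (\sum_(I : {set 'I_N}) occ R K I w * facet_cost K V r c I) <=
    n%:R * (1 + h * g%:R) * (cost + eps).
Proof.
move=> near cl small.
have hg0 : 0 <= h * g%:R by rewrite mulr_ge0 // ltW.
have -> : \sum_(I : {set 'I_N}) occ R K I w * facet_cost K V r c I =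
    M%:R * \sum_(I : {set 'I_N}) rM I * facet_cost K V r c I.
  exact: (sumM (U := R^o)).
rewrite mulrA hM ler_wpM2l ?mulr_ge0 ?(ltW np) ?addr_ge0 //; apply: near.
- by move=> I; rewrite divr_ge0 ?occ_ge0.
- by move=> I IK; rewrite /rM occ_outside ?mul0r.
- rewrite -mulr_suml occ_sum (words_size wM) divff //.
  by rewrite pnatr_eq0 -lt0n muln_gt0 n0 addn_gt0 H0.
apply: le_trans small; set v := (X in enorm X).
have vE : (1 + h * g%:R) *: v =
    - (n%:R^-1 *: (toR R (pos w) - h *: \sum_(I : {set 'I_N}) occ R K I w *: drift K V r c I))
    + (n%:R^-1 *: toR R (pos w) - (h * M%:R / n%:R) *: beta').
  rewrite sumM scalerA hM [n%:R * _ / _]mulrAC divff ?gt_eqF // mul1r /v.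
  set S := \sum_(I : {set 'I_N}) _.
  rewrite (scalerBr n%:R^-1) opprB addrA subrK scalerA mulrA mulVf ?gt_eqF // mul1r.
  by rewrite -scalerBr.
apply: (@le_trans _ _ (enorm ((1 + h * g%:R) *: v))).
  rewrite enormZ ger0_norm ?addr_ge0 //.
  by rewrite ler_peMl ?enorm_ge0 // lerDl.
rewrite vE (le_trans (enormD _ _)) // lerD //.
rewrite enormN enormZ ger0_norm ?invr_ge0 ?(ltW np) // mulrC ler_pdivrMr //.
by rewrite (le_trans (good_pos wM gw)) // mulrAC.
Qed.

Lemma good_word_likelihood (f : R) :
  h * (\sum_(I : {set 'I_N}) occ R K I w * facet_cost K V r c I) <=
    n%:R * (1 + h * g%:R) * f -> (njumps w)%:R <= g%:R * n%:R :> R ->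
  wsum (likelihood K V r c H) w <=
  n%:R * ((1 + h * g%:R) * f + dl * jump_log V c + h * (kap * g%:R)).
Proof.
move=> cost nj.
have kap0 : 0 <= kap by apply: sumr_ge0 => I _; exact: (lamc_ge0 V hr c0).
apply: le_trans (good_likelihood (ltW h0) wM gw) _.
rewrite !mulrDr mulrA; apply: lerD; first apply: lerD => //.
  by rewrite mulrAC mulrC.
rewrite (_ : n%:R * _ = kap * h * (g%:R * n%:R)); last by ring.
by rewrite ler_wpM2l // mulr_ge0 // ltW.
Qed.

End good_bounds.

(** * The local rate function is at most the cost *)

Section rate_upper.
Variables (R : realType) (N : nat) (K : {set 'I_N}) (V : {fset 'rV[int]_N}).
Variable r : 'rV[int]_N -> 'rV[int]_N -> R.
Hypothesis hr : jump_rates K r.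
Hypothesis hhom : facet_homogeneous K r.
Hypothesis hlam : forall I : {set 'I_N}, 0 < lamI K V r I.
Hypothesis havg : averaging_regular K V r.
Hypothesis hsk : skorokhod_compatible K V r.
Variables (d : measure_display) (Omega : measurableType d).
Variables (P : 'rV[int]_N -> probability Omega R).
Variables (X : R -> Omega -> 'rV[int]_N).
Hypothesis hX : jump_markov_process K V r P X.

Lemma scaled_small (s : seq R) (x : R) : (forall a, a \in s -> 0 <= a) -> 0 < x ->
  exists2 y, 0 < y & forall a, a \in s -> y * a <= x.
Proof.
move=> s0 x0; have S0 : 0 <= \sum_(a <- s) a by rewrite big_seq sumr_ge0.
exists (x / (\sum_(a <- s) a + 1)); first by rewrite divr_gt0 // ltr_wpDl.
move=> a /[dup] as_ /s0 a0; rewrite mulrAC ler_pdivrMr ?ltr_wpDl //.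
rewrite ler_wpM2l ?(ltW x0) // (big_rem a) //= -addrA lerDl addr_ge0 //.
by rewrite big_seq sumr_ge0 // => b /mem_rem /s0.
Qed.

Section positive_tilt.
Variables (c : 'rV[int]_N -> R).
Hypothesis c0 : forall v, 0 < c v.
Variables (rho : {set 'I_N} -> R) (rbar : 'rV[int]_N -> R) (beta' : 'rV[R]_N).
Hypothesis adm : admissible K V r rho rbar c beta'.
Hypothesis hbeta' : facet K K beta'.

Lemma mean_rates_unique rho' rb : admissible K V r rho' rb c beta' ->
  forall v, v \in V -> rb v = rbar v.
Proof.
move=> adm' v vV; apply/eqP; rewrite -subr_eq0 -normr_le0; apply/ler_addgt0Pr => e e0.
have [avg _] := havg; have [dl dl0 h] := avg c (fun v _ => c0 v) e e0.
rewrite add0r ltW //; apply: (h _ _ _ _ _ _ adm' adm hbeta' hbeta' _ v vV).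
by rewrite subrr enorm0.
Qed.

Lemma mean_rate_ge0 v : v \in V -> 0 <= rbar v.
Proof.
move=> vV; have [rho0 _ rbE _ _] := adm; rewrite rbE //; apply: sumr_ge0 => I IK.
by rewrite mulr_ge0 ?rho0 // (facet_rate_ge0 hr).
Qed.

Local Notation cost := (\sum_(v <- V) rbar v * ellr (c v)).

Lemma cost_ge0 : 0 <= cost.
Proof.
rewrite big_seq; apply: sumr_ge0 => v vV.
by rewrite mulr_ge0 ?mean_rate_ge0 // ellr_ge0 // ltW.
Qed.

(** The tilted process stays near the straight line with velocity beta', its
    occupation of the facets has nearly the mean rates rbar, and so the
    logarithm of its density is about n times the cost. *)
Lemma qn_le_cost (beta : 'rV[R]_N) (e eta : R) : enorm (beta' - beta) < e -> 0 < eta ->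
  exists n0, forall n, (n0 <= n)%N -> (qn P X n 0 beta e <= (cost + eta)%:E)%E.
Proof.
move=> be eta0; case: hX => Y [T [mY mT Tdiv XY law]].
have K0 : lattice K 0 by move=> i _; rewrite mxE.
have [q [nn [dd [_ hG _ hreg hdir]]]] :=
  hsk (c := c) (fun v _ => c0 v) (ex_intro _ rho (ex_intro _ rbar (ex_intro _ beta' (conj adm hbeta')))).
have [C C0 close] := path_close hr hhom hG hreg hdir adm hbeta'.
have eta4 : 0 < eta / 4 by rewrite divr_gt0.
have [zeta zeta0 near] := near_cost c0 mean_rates_unique eta4.
have cost0 := cost_ge0.
pose kap := lamc_sum K V r c.
have kap0 : 0 <= kap by apply: sumr_ge0 => I _; exact: (lamc_ge0 V hr c0).
pose b := enorm beta'; have b0 : 0 <= b by exact: enorm_ge0.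
pose gap := e - enorm (beta' - beta).
have gap0 : 0 < gap by rewrite subr_gt0.
pose m0 := Num.min 1 (Num.min (gap / 8) (Num.min (zeta / 8) (eta / 16))).
have m00 : 0 < m0 by rewrite !lt_min ltr01 !divr_gt0.
have [m1 m2 m3 m4] : [/\ m0 <= 1, m0 <= gap / 8, m0 <= zeta / 8 & m0 <= eta / 16].
  by rewrite /m0 !ge_min !lexx ?orbT.
have small_zeta : m0 + 2 * m0 <= zeta by lra.
have small_eta : forall u, u + eta / 4 + m0 + m0 + m0 <= u + eta / 2 by move=> u; lra.
have small_gap : 2 * m0 + m0 < gap by lra.
clear m2 m3 m4.
pose g := (Num.truncn (2 * kap + 2)).+1.
have gP : 2 * kap + 2 <= g%:R by rewrite ltW // truncnS_gt.
have g0 : 0 <= g%:R :> R by [].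
pose C1 := jump_log V c; pose C2 := jump_size R V; pose C3 := jump_count R V.
pose W := push_size K V r c.
have C10 : 0 <= C1 by apply: sumr_ge0 => I _; exact: sumr_ge0.
have C20 : 0 <= C2.
  by apply: sumr_ge0 => I _; apply: sumr_ge0 => v _; exact: enorm_ge0.
have C30 : 0 <= C3 by apply: sumr_ge0 => I _; exact: sumr_ge0.
have W0 : 0 <= W by apply: sumr_ge0 => I _; exact: enorm_ge0.
have CC2 : 0 <= C * C2 by exact: mulr_ge0.
have [|dl dl0 dlP] := @scaled_small [:: C2; C * C2; C1; C3] m0 _ m00.
  by move=> a; rewrite !inE => /or4P[] /eqP ->.
have d2 : dl * C2 <= m0 by apply: dlP; rewrite !inE eqxx.
have dC2 : dl * (C * C2) <= m0 by apply: dlP; rewrite !inE eqxx orbT.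
have d1 : dl * C1 <= m0 by apply: dlP; rewrite !inE eqxx !orbT.
have d3 : dl * C3 <= m0 by apply: dlP; rewrite !inE eqxx !orbT.
pose k1 := 2 * C * W; pose k2 := g%:R * b; pose k3 := g%:R * (cost + eta / 4).
pose k4 := kap * g%:R.
have k10 : 0 <= k1 by rewrite !mulr_ge0.
have k20 : 0 <= k2 by rewrite mulr_ge0.
have k30 : 0 <= k3 by rewrite mulr_ge0 // addr_ge0 // ltW.
have k40 : 0 <= k4 by rewrite mulr_ge0.
have [|y y0 yP] := @scaled_small [:: k1; k2; k3; k4; kap; g%:R] m0 _ m00.
  by move=> a; rewrite !inE => /or4P[/eqP->|/eqP->|/eqP->|/or3P[] /eqP->].
have [H H0 Hy] := small_inv_nat y0.
pose h : R := H%:R^-1.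
have h0 : 0 < h by rewrite invr_gt0 ltr0n.
have hP a : 0 <= a -> a \in [:: k1; k2; k3; k4; kap; g%:R] -> h * a <= m0.
  by move=> a0 aP; apply: le_trans (yP a aP); rewrite ler_wpM2r.
have h1 : h * k1 <= m0 by apply: hP => //; rewrite !inE eqxx.
have h2 : h * k2 <= m0 by apply: hP => //; rewrite !inE eqxx !orbT.
have h3 : h * k3 <= m0 by apply: hP => //; rewrite !inE eqxx !orbT.
have h4 : h * k4 <= m0 by apply: hP => //; rewrite !inE eqxx !orbT.
have hk : h * kap <= m0 by apply: hP => //; rewrite !inE eqxx !orbT.
have hg : h * g%:R <= m0 by apply: hP => //; rewrite !inE eqxx !orbT.
have hsmall : h * kap <= 1 by exact: le_trans m1.
have D_le : C * (dl * C2 + 2 * h * W) <= 2 * m0.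
  rewrite (_ : C * _ = dl * (C * C2) + h * k1); last by rewrite /k1; ring.
  by rewrite mulr2n mulrDl mul1r lerD.
(* balances 2 th^2 M against th dl n in the Chernoff bound *)
pose th := Num.min (1 / 2) (dl / (4 * (H + g)%:R)).
have Hgp : 0 < (H + g)%:R :> R by rewrite ltr0n addn_gt0 H0.
have th0 : 0 < th by rewrite lt_min !divr_gt0 // mulr_gt0.
have th2 : th <= 1 / 2 by rewrite ge_min lexx.
have th4 : th * (4 * (H + g)%:R) <= dl.
  by rewrite -ler_pdivlMr ?mulr_gt0 // ge_min lexx orbT.
pose A := ((H + g)%:R + 1) * (2 * #|{: {set 'I_N}}|%:R * (size V)%:R) : R.
have A0 : 0 <= A by rewrite !mulr_ge0 ?addr_ge0.
have thdl : 0 < th * dl / 2 by rewrite divr_gt0 // mulr_gt0.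
have [n1 [n10 hn1]] := exp_decay A0 thdl.
have eta2 : 0 < eta / 2 by rewrite divr_gt0.
have ln2 : 0 <= - ln (1 / 2 : R).
  by rewrite oppr_ge0 ln_le0 // ler_pdivrMr // mul1r ler1n.
have [n2 [n20 hn2]] := div_nat_le ln2 eta2.
exists (maxn n1 n2) => n; rewrite geq_max => /andP[nn1 nn2].
have n0 : (0 < n)%N by exact: leq_trans nn1.
have np : 0 < n%:R :> R by rewrite ltr0n.
have n1' : 1 <= n%:R :> R by rewrite ler1n.
have Hp : 0 < H%:R :> R by rewrite ltr0n.
pose M := (n * (H + g))%N.
have M0 : (0 < M)%N by rewrite muln_gt0 n0 addn_gt0 H0.
pose x := dl * n%:R.
pose D := C * (dl * C2 + 2 * h * W).
pose B := n%:R * (cost + eta / 2).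
have hgood w : w \in words V M -> wprod (qstep K V r c H) w != 0 ->
    good K V r c H x w ->
    [/\ ((njumps w).+1 <= g * n)%N, wsum (likelihood K V r c H) w <= B &
      forall k, enorm (n%:R^-1 *: toR R (pos (drop k w)) -
        (h * (size (drop k w))%:R / n%:R) *: beta') <= D].
  move=> wM wN gw.
  have cl k : enorm (n%:R^-1 *: toR R (pos (drop k w)) -
        (h * (size (drop k w))%:R / n%:R) *: beta') <= D.
    apply: le_trans (close _ _ _ _ _ n0 M0 wM wN gw k) _.
    rewrite ler_wpM2l // mulrDl lerD //.
      by rewrite /x mulrAC mulfK ?gt_eqF.
    by rewrite ler_pdivrMr // ler_peMr // mulr_ge0 // mulr_ge0 // ltW.
  have nj := good_word_count hr c0 H0 n0 wM gw (le_trans hg m1) (le_trans d3 m1) gP.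
  have njk : (njumps w)%:R <= g%:R * n%:R :> R by apply: le_trans nj; rewrite lerDl.
  split=> //; first by rewrite -(ler_nat R) natrM -natr1.
  have cl0 : enorm (n%:R^-1 *: toR R (pos w) - (h * M%:R / n%:R) *: beta') <= D.
    by have := cl 0%N; rewrite drop0 (words_size wM).
  have small : dl * jump_size R V + D <= zeta.
    by apply: le_trans (lerD d2 D_le) _; apply: le_trans small_zeta.
  have wc := good_word_cost H0 n0 wM gw near cl0 small.
  apply: le_trans (good_word_likelihood hr c0 H0 wM gw wc njk) _.
  rewrite /B ler_pM2l //.
  rewrite (_ : (1 + h * g%:R) * _ = cost + eta / 4 + h * k3); last by rewrite /k3; ring.
  apply: le_trans (lerD (lerD (lerD (lexx _) h3) d1) h4) _.
  exact: small_eta.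
have hbad : \sum_(w <- words V M) wprod (qstep K V r c H) w *
    (~~ `[< good K V r c H x w >])%:R <= 1 / 2.
  have thP : 0 <= th <= 1 / 2 by rewrite (ltW th0).
  apply: le_trans (bad_words_mass hr c0 H0 hsmall x M thP) _.
  apply: le_trans (hn1 n nn1).
  set A1 := 2 * _ * _; have A10 : 0 <= A1 by rewrite !mulr_ge0.
  apply: ler_pM; rewrite ?expR_ge0 ?mulr_ge0 //.
    rewrite /A -/A1 mulrAC ler_wpM2r // -natr1 /M natrM.
    by rewrite [leRHS]mulrC mulrDr mulr1 lerD2l.
  rewrite ler_expR /M natrM /x.
  exact: tail_exponent (ltW th0) (ltW np) th4.
have hD : D + h * g%:R * enorm beta' + enorm (beta' - beta) < e.
  rewrite -ltrBrDr -/gap; apply: le_lt_trans small_gap.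
  by rewrite lerD // -mulrA.
have := tube_lower hr hhom hlam mY (fun k => (mT k).1) (law 0 K0)
  Tdiv XY c0 H0 n0 hsmall hgood hbad hD.
rewrite /B => low.
apply: le_trans (qn_le n0 _ low) _ => //.
rewrite lee_fin [X in _ <= _ + X](splitr eta) addrA lerD2l -mulNr.
exact: hn2 nn2.
Qed.

End positive_tilt.

End rate_upper.

Section rate_cost.
Variables (R : realType) (N : nat) (K : {set 'I_N}) (V : {fset 'rV[int]_N}).
Variable r : 'rV[int]_N -> 'rV[int]_N -> R.
Hypothesis hr : jump_rates K r.
Hypothesis hhom : facet_homogeneous K r.
Hypothesis hlam : forall I : {set 'I_N}, 0 < lamI K V r I.
Hypothesis havg : averaging_regular K V r.
Hypothesis hsk : skorokhod_compatible K V r.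
Variables (d : measure_display) (Omega : measurableType d).
Variables (P : 'rV[int]_N -> probability Omega R).
Variables (X : R -> Omega -> 'rV[int]_N).
Hypothesis hX : jump_markov_process K V r P X.

Lemma admissible_ext rho rbar (c c' : 'rV[int]_N -> R) beta :
  (forall v, v \in V -> c' v = c v) ->
  admissible K V r rho rbar c beta -> admissible K V r rho rbar c' beta.
Proof.
move=> cc' [a1 a2 a3 a4 a5]; split=> // [v vV|]; first by rewrite cc' ?a4.
by rewrite -a5; apply: eq_big_seq => v vV; rewrite cc'.
Qed.

(** The perturbed system differs little from the given one in velocity and in
    cost, where r v is positive by continuity and elsewhere because c' v stays
    bounded while the mean rate tends to 0. *)
Lemma rate_le_cost rho rbar c beta Lb :
  iterated_limit (fun e delta => limn_einf (fun n =>
    ereal_inf (qn_values K P X beta e delta n))) Lb%:E ->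
  admissible K V r rho rbar c beta -> facet K K beta ->
  Lb <= \sum_(v <- V) rbar v * ellr (c v).
Proof.
move=> hL adm hbeta; have rb0 := mean_rate_ge0 hr adm.
have [_ _ _ ac0 _] := adm.
apply: (rate_le hL) => e eta /andP[e0 _] eta0.
have [_ avg] := havg; have [m hm] := avg _ _ _ _ adm hbeta.
pose cnt := (size V)%:R + 1 : R.
have cnt0 : 0 < cnt by rewrite ltr_wpDl.
pose eta1 := eta / 2 / cnt.
have eta10 : 0 < eta1 by rewrite !divr_gt0.
pose Q v eps := forall s' b, 0 <= s' -> 0 < b -> `|rbar v - s'| < eps ->
  (rbar v != 0 -> `|c v - b| < eps) -> (rbar v = 0 -> b <= m) ->
  s' * ellr b <= rbar v * ellr (c v) + eta1.
have [||eps eps0 Qeps] := @common_eps R _ V Q.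
- by move=> v vV; apply: cost_term_usc => //; [exact: rb0|exact: ac0].
- move=> v e1 e2 le Q1 s' b s'0 b0 h1 h2; apply: Q1 => //.
    exact: lt_le_trans le.
  by move=> /h2 h3; exact: lt_le_trans le.
pose eps1 := Num.min eps e.
have eps10 : 0 < eps1 by rewrite lt_min eps0.
have [rho' [rbar' [c' [beta' [adm' hbeta' bb hv]]]]] := hm eps1 eps10.
(* the lemmas on the tilted law ask for positive values everywhere *)
pose c1 v := if v \in V then c' v else 1.
have c1E v : v \in V -> c1 v = c' v by rewrite /c1 => ->.
have c10 v : 0 < c1 v.
  by rewrite /c1; case: ifP => // vV; have [] := hv v vV.
have adm1 := admissible_ext c1E adm'.
have cost_le : \sum_(v <- V) rbar' v * ellr (c1 v) <=
    \sum_(v <- V) rbar v * ellr (c v) + eta / 2.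
  apply: (@le_trans _ _ (\sum_(v <- V) (rbar v * ellr (c v) + eta1))).
    rewrite big_seq [leRHS]big_seq; apply: ler_sum => v vV.
    have [cp h1 h2 h3] := hv v vV; rewrite c1E //; apply: (Qeps v vV) => //.
    - exact: (mean_rate_ge0 hr adm' vV).
    - by apply: lt_le_trans h1 _; rewrite ge_min lexx.
    - by move=> /h2 h4; apply: lt_le_trans h4 _; rewrite ge_min lexx.
  rewrite big_split /= lerD2l big_const_seq count_predT iter_addr_0 -[leLHS]mulr_natr.
  apply: (@le_trans _ _ (eta1 * cnt)); last by rewrite /eta1 divfK // gt_eqF.
  by rewrite ler_wpM2l ?(ltW eta10) // lerDl.
have be : enorm (beta' - beta) < e.
  by rewrite enormBC; apply: lt_le_trans bb _; rewrite ge_min lexx orbT.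
have eta2 : 0 < eta / 2 by rewrite divr_gt0.
have [n0 hn] := qn_le_cost hr hhom hlam havg hsk hX c10 adm1 hbeta' be eta2.
exists n0 => n /hn /le_trans; apply; rewrite lee_fin.
by rewrite [X in _ <= _ + X](splitr eta) addrA lerD2r.
Qed.

End rate_cost.

(** * The formula for the local rate function *)

Theorem theorem4 (R : realType) (N : nat) (hN : (0 < N)%N) (K : {set 'I_N})
  (V : {fset 'rV[int]_N}) (r : 'rV[int]_N -> 'rV[int]_N -> R)
  (hr : jump_rates K r)
  (hhom : facet_homogeneous K r)
  (hV : forall (I : {set 'I_N}) (v : 'rV[int]_N),
    I \subset K -> 0 < facet_rate K r I v -> v \in V)
  (hcomm : communicating K r)
  (havg : averaging_regular K V r)
  (hsk : skorokhod_compatible K V r)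
  (d : measure_display) (Omega : measurableType d)
  (P : 'rV[int]_N -> probability Omega R)
  (X : R -> Omega -> 'rV[int]_N)
  (hX : jump_markov_process K V r P X)
  (L : 'rV[R]_N -> R) (hL : local_rate_function K P X L)
  (beta : 'rV[R]_N) (hbeta : facet K K beta) :
  (L beta)%:E =
  ereal_inf [set y : \bar R | exists rho rbar c,
    admissible K V r rho rbar c beta /\
    y = (\sum_(v <- V) (rbar v)%:E * ell (c v))%E].
Proof.
have hlam := lamI_gt0 hN hr hhom hV hcomm.
have [_ hinf hsup] := hL beta hbeta.
apply/eqP; rewrite eq_le; apply/andP; split.
  apply: le_ereal_inf_tmp => _ [rho [rbar [c [adm ->]]]].
  have [_ _ _ c0 _] := adm.
  rewrite (cost_fin rbar c0) lee_fin.
  exact: (rate_le_cost hr hhom hlam havg hsk hX hinf adm hbeta).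
have [J J0 hspan] := interior_span hN hhom hV hcomm.
apply/lee_addgt0Pr => e e0.
have [k0 [k00 hk]] := div_nat_le (ler0n R #|{: {set 'I_N}}|) e0.
have k1 : 1 <= k0%:R :> R by rewrite ler1n.
have [alpha [Lam0 [rho [rbar [c [adm ham_le cost_le]]]]]] :=
  dual_system hN hr J0 hspan beta k1.
have [_ _ _ c0 _] := adm.
apply: (@le_trans _ _ (\sum_(v <- V) (rbar v)%:E * ell (c v))%E).
  by apply: ereal_inf_lbound; exists rho, rbar, c.
rewrite (cost_fin rbar c0) -EFinD lee_fin.
apply: le_trans cost_le _; apply: lerD.
  exact: (rate_ge_dual hr hhom hlam hX hsup ham_le).
exact: hk.
Qed.
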